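(* Let $\Omega\subset\mathbb{R}^n$ be a bounded $C^1$ domain, and let $p:\Omega\to(1,\infty)$ be continuous with $p^-:=\inf_{x\in\Omega}p(x)>1$. Let $S\subset W^{1,p^-,p(\cdot)}(\Omega)$ be an arbitrary vector subspace consisting of compactly supported functions. Then, for any $\varphi\in W^{1,p^-,p(\cdot)}(\Omega)$ satisfying $\int_\Omega\frac{|\nabla\varphi|^{p}}{p}\,dx<\infty$, there exists a unique $S$-weak solution in the affine class $\varphi-\overline{S}^{p^-,p(\cdot)}$, denoted by $w\in W^{1,p^-,p(\cdot)}(\Omega)$, of the Dirichlet problem $$\Delta_{p(\cdot)}w=\operatorname{div}\left(|\nabla w|^{p(\cdot)-2}\nabla w\right)=0\ \text{ in }\Omega,\qquad w=\varphi\ \text{ on }\partial\Omega.$$ More precisely, the solution of the corresponding minimization problem (minimizing the Dirichlet integral $F(u)=\int_\Omega\frac{|\nabla(u-\varphi)|^{p}}{p}\,dx$ over $u\in\overline{S}^{p^-,p(\cdot)}$) yields a function $w$ satisfying $$\int_\Omega|\nabla w|^{p-2}\nabla w\cdot\nabla\phi\,dx=0\qquad\text{for every }\phi\in S.$$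
   Context: $L^{p(\cdot)}(\Omega)$ is the space of measurable $u$ with $\int_\Omega|\lambda u(x)|^{p(x)}dx<\infty$ for some $\lambda>0$. Define $W^{1,p^-,p(\cdot)}(\Omega)=\{u\in L^{p^-}(\Omega):\nabla u\in(L^{p(\cdot)}(\Omega))^n\}$, with the convex modular $$\rho_{p^-,p}(u)=\int_\Omega|u|^{p^-}dx+\int_\Omega\frac{|\nabla u|^{p}}{p}\,dx\in[0,\infty],$$ where $|\nabla u|$ is the Euclidean norm of the gradient and $p=p(x)$. The modular topology of $\rho_{p^-,p}$ on $W^{1,p^-,p(\cdot)}(\Omega)$: a set $A$ is open iff for every $u\in A$ there is $\varepsilon>0$ with $\{v:\rho_{p^-,p}(v-u)<\varepsilon\}\subset A$. $\overline{S}^{p^-,p(\cdot)}$ denotes the closure of $S$ in this topology, and $\varphi-\overline{S}^{p^-,p(\cdot)}=\{\varphi-u:u\in\overline{S}^{p^-,p(\cdot)}\}$. The exponent $p$ may be unbounded. The qualifier ''$S$-weak'' records the class of test functions: the equation is tested against all $\phi\in S$, as in the displayed integral identity. The boundary condition $w=\varphi$ on $\partial\Omega$ is understood in the Sobolev-trace sense. A minimizer $u$ of $F$ corresponds to $w=\varphi-u$.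
   Formalization: Uniqueness is proved for the minimizer of F, and for w among S-weak solutions w' in the affine class with finite integral of |∇w'|^p over Ω (automatic if p is bounded); uniqueness among all S-weak solutions is false for unbounded p and some S. *)

(* Defs.v *)
From HB Require Import structures.
From mathcomp Require Import all_boot all_order all_algebra.
From mathcomp Require Import all_classical all_reals all_analysis.

Set Implicit Arguments.
Unset Strict Implicit.
Unset Printing Implicit Defensive.

Import Order.TTheory GRing.Theory Num.Theory.
Import numFieldNormedType.Exports.

Local Open Scope classical_set_scope.
Local Open Scope ring_scope.

(* R^n is 'rV[R]_n, whose library norm is the sup norm.  Its sigma-algebra is
   the one generated by the coordinate functions, i.e. the Borel sets. *)
Section measurable_rV.
Variables (R : realType) (n : nat).

Let coord : 'I_n -> 'rV[R]_n -> R := fun i x => x ord0 i.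

Let rV_set0 : g_sigma_preimage coord set0.
Proof. exact: sigma_algebra0. Qed.

Let rV_setC A : g_sigma_preimage coord A -> g_sigma_preimage coord (~` A).
Proof. exact: sigma_algebraC. Qed.

Let rV_bigcup (F : _^nat) : (forall i, g_sigma_preimage coord (F i)) ->
  g_sigma_preimage coord (\bigcup_i (F i)).
Proof. exact: sigma_algebra_bigcup. Qed.

HB.instance Definition _ := @isMeasurable.Build default_measure_display
  'rV[R]_n (g_sigma_preimage coord) rV_set0 rV_setC rV_bigcup.

End measurable_rV.

Lemma measurable_fun_rVP d (T : measurableType d) (R : realType) n
    (f : T -> 'rV[R]_n) :
  (forall i, measurable_fun [set: T] (fun x => f x ord0 i)) ->
  measurable_fun [set: T] f.
Proof.
move=> mf.
suff H : g_sigma_preimage (fun i x => f x ord0 i) `<=` @measurable d T.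
  move=> _ A mA; rewrite setTI; apply: H.
  rewrite (_ : g_sigma_preimage _ =
    g_sigma_preimage ((fun i : 'I_n => (fun x : 'rV[R]_n => x ord0 i) \o f)))//.
  by rewrite (g_sigma_preimage_comp (fun (i : 'I_n) (x : 'rV[R]_n) => x ord0 i) f);
    exists A => //; rewrite setTI.
apply: smallest_sub; first exact: sigma_algebra_measurable.
case: n => [|n] in f mf *; first by rewrite big_ord0.
rewrite -bigcup_mkord_ord; apply: bigcup_sub => i Ii.
by move=> A [B mB <-]; exact: mf.
Qed.

Lemma measurable_coord (R : realType) n (i : 'I_n) :
  measurable_fun [set: 'rV[R]_n] (fun x : 'rV[R]_n => x ord0 i).
Proof.
move=> _ Y mY; apply: sub_sigma_algebra => /=.
by rewrite -bigcup_seq/=; exists i => /=; [rewrite mem_index_enum | exists Y].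
Qed.

Definition rV_cons (R : realType) n (z : measurableTypeR R * 'rV[R]_n) :
  'rV[R]_n.+1 := row_mx (z.1 : R)%:M z.2.

Lemma measurable_rV_cons (R : realType) n :
  measurable_fun [set: _] (@rV_cons R n).
Proof.
apply: measurable_fun_rVP => i.
case: (@split_ordP 1 n i) => j ->.
  rewrite (_ : (fun x => _) = (fst : measurableTypeR R * 'rV[R]_n -> _))//.
  by apply/funext => x; rewrite /rV_cons (@row_mxEl _ 1 1 n) (ord1 j) mxE.
rewrite (_ : (fun x => _) = (fun y : 'rV[R]_n => y ord0 j) \o
    (snd : measurableTypeR R * 'rV[R]_n -> _)).
  by apply: measurableT_comp; [exact: measurable_coord|exact: measurable_snd].
by apply/funext => x; rewrite /rV_cons/= (@row_mxEr _ 1 1 n).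
Qed.

Definition rV_uncons (R : realType) n (x : 'rV[R]_n.+1) :
  measurableTypeR R * 'rV[R]_n :=
  (x ord0 ord0, \row_j x ord0 (lift ord0 j)).

Lemma rV_consK (R : realType) n : cancel (@rV_cons R n) (@rV_uncons R n).
Proof.
move=> [a y]; rewrite /rV_cons /rV_uncons; congr pair.
  have -> : ord0 = lshift n (ord0 : 'I_1) by exact/val_inj.
  by rewrite (@row_mxEl _ 1 1 n) mxE eqxx.
apply/rowP => j; rewrite mxE.
have -> : lift ord0 j = rshift 1 j by exact/val_inj.
by rewrite (@row_mxEr _ 1 1 n).
Qed.

Lemma measurable_rV_uncons (R : realType) n :
  measurable_fun [set: _] (@rV_uncons R n).
Proof.
apply: measurable_fun_pair; first exact: measurable_coord.
apply: measurable_fun_rVP => i.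
rewrite (_ : (fun x => _) = (fun x : 'rV[R]_n.+1 => x ord0 (lift ord0 i))).
  exact: measurable_coord.
by apply/funext => x; rewrite mxE.
Qed.

(* Not inferred by the library: its sigma-finite instance for products is
   shadowed by the one for subprobabilities. *)
Lemma prod_sigma_finite d1 d2 (T1 : measurableType d1) (T2 : measurableType d2)
    (R : realType) (m1 : {sigma_finite_measure set T1 -> \bar R})
    (m2 : {sigma_finite_measure set T2 -> \bar R}) :
  sigma_finite setT (m1 \x m2)%E.
Proof.
have /sigma_finiteP[F [TF ndF Foo]] := sigma_finiteT m1.
have /sigma_finiteP[G [TG ndG Goo]] := sigma_finiteT m2.
exists (fun n => F n `*` G n).
  rewrite -setXTT TF TG predeqE => -[x y]; split.
    move=> [/= [n _ Fnx] [k _ Gky]]; exists (maxn n k) => //; split.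
    - by move: x Fnx; exact/subsetPset/ndF/leq_maxl.
    - by move: y Gky; exact/subsetPset/ndG/leq_maxr.
  by move=> [n _ []/= ? ?]; split; exists n.
move=> k; have [? ?] := Foo k; have [? ?] := Goo k.
split; first exact: measurableX.
by rewrite product_measure1E// lte_mul_pinfty// ge0_fin_numE.
Qed.

Section lebesgue_rV_step.
Variables (R : realType) (n : nat).
Variable m : {sigma_finite_measure set 'rV[R]_n -> \bar R}.

Definition lebesgue_rV_step : set 'rV[R]_n.+1 -> \bar R :=
  pushforward (@lebesgue_measure R \x m)%E (@rV_cons R n).

Let step0 : lebesgue_rV_step set0 = 0%E.
Proof. by rewrite /lebesgue_rV_step /pushforward preimage_set0 measure0. Qed.

Let step_ge0 A : (0 <= lebesgue_rV_step A)%E.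
Proof. by rewrite /lebesgue_rV_step /pushforward; exact: measure_ge0. Qed.

Let step_sigma_additive : semi_sigma_additive lebesgue_rV_step.
Proof.
move=> F mF tF mUF; rewrite /lebesgue_rV_step /pushforward preimage_bigcup.
apply: measure_semi_sigma_additive.
- by move=> k; rewrite -[X in measurable X]setTI; exact: measurable_rV_cons.
- apply/trivIsetP => /= i j _ _ ij; rewrite -preimage_setI.
  by move/trivIsetP : tF => /(_ _ _ _ _ ij) ->//; rewrite preimage_set0.
- rewrite -preimage_bigcup -[X in measurable X]setTI.
  exact: measurable_rV_cons.
Qed.

HB.instance Definition _ := isMeasure.Build _ _ _ lebesgue_rV_step
  step0 step_ge0 step_sigma_additive.

Let step_sigma_finite : sigma_finite setT lebesgue_rV_step.
Proof.
have [F TF Foo] := prod_sigma_finite (@lebesgue_measure R) m.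
exists (fun k => @rV_uncons R n @^-1` F k); first by rewrite -preimage_bigcup -TF.
move=> k; have [mF Fk] := Foo k; split.
  by rewrite -[X in measurable X]setTI; exact: measurable_rV_uncons.
rewrite /lebesgue_rV_step /pushforward -comp_preimage.
by rewrite (_ : _ \o _ = id) ?preimage_id//; apply/funext => z /=; rewrite rV_consK.
Qed.

HB.instance Definition _ := Measure_isSigmaFinite.Build _ _ _ lebesgue_rV_step
  step_sigma_finite.

End lebesgue_rV_step.

(* Lebesgue measure on R^n, as the iterated product L^1 x L^n; R^0 is a point of
   mass 1. *)
Fixpoint lebesgue_rV (R : realType) (n : nat) :
    {sigma_finite_measure set 'rV[R]_n -> \bar R} :=
  match n with
  | 0 => \d_(0 : 'rV[R]_0)
  | k.+1 => lebesgue_rV_step (lebesgue_rV R k)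
  end.

Section euclidean_space.
Variables (R : realType) (n : nat).
Implicit Types (f : 'rV[R]_n -> R) (x v w : 'rV[R]_n).

Definition dotv v w : R := \sum_i v ord0 i * w ord0 i.

Definition enorm v : R := Num.sqrt (\sum_i v ord0 i ^+ 2).

Definition partial (i : 'I_n) f x : R := 'D_(delta_mx ord0 i) f x.

Definition C1 f := (forall x, differentiable f x) /\
  forall i, continuous (partial i f).

Definition classical_grad f x : 'rV[R]_n := \row_i partial i f x.

End euclidean_space.

Section C1_domains.
Variables (R : realType) (n : nat).
Implicit Types (Omega : set 'rV[R]_n.+1) (gamma : 'rV[R]_n -> R).

Definition boundary Omega := closure Omega `\` interior Omega.

(* Near x0 (in the sup-norm ball of radius r), after singling out the i-th
   coordinate and possibly reversing its orientation (b = true), Omega is the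
   region above the graph of the C^1 function gamma of the other coordinates. *)
Definition C1_chart Omega (x0 : 'rV[R]_n.+1) (r : R) (i : 'I_n.+1) (b : bool)
    gamma :=
  [/\ boundary Omega x0, 0 < r, C1 gamma &
      forall x, ball x0 r x ->
        (Omega x <-> (-1) ^+ b * gamma (col' i x) < (-1) ^+ b * x ord0 i)].

Definition graph_point (i : 'I_n.+1) gamma (y : 'rV[R]_n) : 'rV[R]_n.+1 :=
  \row_j oapp (fun k => y ord0 k) (gamma y) (unlift i j).

Definition bounded_C1_domain Omega :=
  [/\ open Omega, connected Omega, Omega !=set0, bounded_set Omega &
      forall x0, boundary Omega x0 ->
        exists r i b gamma, C1_chart Omega x0 r i b gamma].

(* Surface integral of h over the part of the boundary of Omega covered by the
   chart. *)
Definition chart_integral (x0 : 'rV[R]_n.+1) (r : R) (i : 'I_n.+1) gamma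
    (h : 'rV[R]_n.+1 -> R) : \bar R :=
  \int[lebesgue_rV R n]_(y in [set y | ball x0 r (graph_point i gamma y)])
    (h (graph_point i gamma y) *
     Num.sqrt (1 + enorm (classical_grad gamma y) ^+ 2))%:E.

End C1_domains.

(* Functions on Omega are represented by functions on R^n whose values outside
   Omega are irrelevant; almost everywhere equal functions are not identified. *)
Section variable_exponent_sobolev.
Variables (R : realType) (n : nat) (Omega : set 'rV[R]_n).
Implicit Types (p u v f : 'rV[R]_n -> R) (G : 'rV[R]_n -> 'rV[R]_n) (q : R).

Local Notation mu := (lebesgue_rV R n).

Definition ae_eq_on u v := {ae mu, forall x, Omega x -> u x = v x}.

Definition Lvar p u := measurable_fun Omega u /\
  exists2 l : R, 0 < l & (\int[mu]_(x in Omega) (`|l * u x| `^ p x)%:E < +oo)%E.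

Definition loc_integrable u :=
  forall K, compact K -> K `<=` Omega -> mu.-integrable K (EFin \o u).

Definition C1c f := C1 f /\
  exists K, [/\ compact K, K `<=` Omega & forall x, ~ K x -> f x = 0].

(* First-order weak gradients, tested against C^1_c(Omega) as in Gilbarg and
   Trudinger; by mollification C^oo_c(Omega) gives the same notion. *)
Definition is_weak_grad u G :=
  [/\ loc_integrable u,
      forall i, loc_integrable (fun x => G x ord0 i) &
      forall f, C1c f -> forall i,
        \int[mu]_(x in Omega) (u x * partial i f x) =
        - \int[mu]_(x in Omega) (G x ord0 i * f x)].

Definition weakly_differentiable u := exists G, is_weak_grad u G.

(* Weak gradients are unique almost everywhere on Omega; wgrad u is one of them
   (and the zero function when there is none). *)
Definition wgrad u : 'rV[R]_n -> 'rV[R]_n :=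
  xget (fun=> 0) [set G | is_weak_grad u G].

(* W^{1,q,p(.)}(Omega): u in L^q and grad u in L^p(.)^n *)
Definition Wvar q p : set ('rV[R]_n -> R) := [set u |
  [/\ Lvar (fun=> q) u, weakly_differentiable u &
      forall i, Lvar p (fun x => wgrad u x ord0 i)]].

Definition W1 q := Wvar q (fun=> q).

Definition exp_inf p : R := inf [set p x | x in Omega].

Definition WOmega p := Wvar (exp_inf p) p.

Definition grad_energy p u : \bar R :=
  \int[mu]_(x in Omega) (enorm (wgrad u x) `^ p x / p x)%:E.

Definition rho p u : \bar R :=
  (\int[mu]_(x in Omega) (`|u x| `^ exp_inf p)%:E + grad_energy p u)%E.

Definition modular_open p (A : set ('rV[R]_n -> R)) :=
  A `<=` WOmega p /\
  forall u, A u -> exists2 e : R, 0 < e &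
    forall v, WOmega p v -> (rho p (v \- u)%R < e%:E)%E -> A v.

Definition modular_closure p (S : set ('rV[R]_n -> R)) := [set u |
  WOmega p u /\ forall A, modular_open p A -> A u -> A `&` S !=set0].

Definition compactly_supported u := exists K,
  [/\ compact K, K `<=` Omega & ae_eq_on u (fun x => u x * \1_K x)].

Definition vector_subspace (S : set ('rV[R]_n -> R)) :=
  S (fun=> 0) /\
  forall (a : R) u v, S u -> S v -> S (fun x => a * u x + v x).

Definition dirichlet_integral p (phi u : 'rV[R]_n -> R) : \bar R :=
  grad_energy p (u \- phi).

Definition is_minimizer (F : ('rV[R]_n -> R) -> \bar R)
    (A : set ('rV[R]_n -> R)) u :=
  A u /\ forall v, A v -> (F u <= F v)%E.

(* The integrand of the weak formulation; where the gradient vanishes it is 0,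
   also when p x < 2. *)
Definition weak_integrand p (w psi : 'rV[R]_n -> R) : 'rV[R]_n -> \bar R :=
  fun x => (enorm (wgrad w x) `^ (p x - 2) * dotv (wgrad w x) (wgrad psi x))%:E.

(* S-weak solutions of div (|grad w|^(p-2) grad w) = 0 in the affine class
   phi - closure S. *)
Definition S_weak_solution p (S : set ('rV[R]_n -> R)) (phi w : 'rV[R]_n -> R) :=
  [/\ WOmega p w,
      exists2 u, modular_closure p S u & w = phi \- u &
      forall psi, S psi ->
        mu.-integrable Omega (weak_integrand p w psi) /\
        (\int[mu]_(x in Omega) weak_integrand p w psi x = 0)%E].

End variable_exponent_sobolev.

(* The Sobolev trace of v on the boundary of a C^1 domain is g: v is the
   W^{1,q}(Omega)-limit of functions of W^{1,q}(Omega) that are continuous up to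
   the boundary and whose boundary values tend to g in L^q of the boundary, the
   latter being measured on each chart. *)
Definition has_trace (R : realType) (n : nat) (Omega : set 'rV[R]_n.+1) (q : R)
    (v g : 'rV[R]_n.+1 -> R) :=
  measurable_fun (boundary Omega) g /\
  exists f : nat -> 'rV[R]_n.+1 -> R,
  [/\ forall k, W1 Omega q (f k) /\ {within closure Omega, continuous (f k)},
      (\int[lebesgue_rV R n.+1]_(x in Omega) (`|f k x - v x| `^ q)%:E
        @[k --> \oo] --> 0)%E,
      (\int[lebesgue_rV R n.+1]_(x in Omega)
        (enorm (wgrad Omega (f k \- v) x) `^ q)%:E @[k --> \oo] --> 0)%E &
      forall x0 r i b gamma, C1_chart Omega x0 r i b gamma ->
        (chart_integral x0 r i gamma (fun x => `|f k x - g x| `^ q)%R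
          @[k --> \oo] --> 0)%E].

(* Main.v *)
Require Import Defs.
From mathcomp Require Import all_boot all_order all_algebra.
From mathcomp Require Import all_classical all_reals all_analysis.
From mathcomp Require Import measurable_realfun ring lra.

Set Implicit Arguments.
Unset Strict Implicit.
Unset Printing Implicit Defensive.

Import Order.TTheory GRing.Theory Num.Theory.
Import numFieldNormedType.Exports.

Local Open Scope classical_set_scope.
Local Open Scope ring_scope.

(* The integrand |xi|^p / p is uniformly convex with constants depending only on
   a lower bound q > 1 of p, so for two near-minimizers u, v the modular of
   grad (u - v) / 2 is small; on a set of finite measure this forces grad (u - v)
   to be small in L^q, and Poincare's inequality does the same for u - v.  A fast
   minimizing sequence thus converges almost everywhere together with its
   gradients, and Fatou's lemma makes the limit a minimizer in the closure of S,
   as well as the unique one.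

   Closures are handled through sequences: a set containing the limits of its
   sequences with rho(v_k - v) <= 2^-k and containing S contains the closure of
   S.  In this way the closure of S is a vector space, consists of W^{1,q}-limits
   of C^1_c functions (hence Poincare's inequality and the zero trace), and
   inherits the weak equation of a solution w' with |grad w'|^p integrable, by
   Young's inequality and dominated convergence.  Convexity then shows that such
   a w' comes from a minimizer.

   The Euler-Lagrange equation is obtained by testing convexity at
   grad w - t grad psi and letting t -> 0; the exponent is bounded on the support
   of psi, which provides the domination. *)

(** * Sequences of integrals *)

(** Since [p] may be unbounded, the modular is not doubling: finite energy of [u] says nothing about
    [2 u], and a finite integral of [|grad u|^p / p] does not make that of [|grad u|^p] finite. This
    shapes three steps. Uniform convexity bounds only half differences of near-minimizers, so a
    minimizing sequence is shown to converge to [v] in the modular only after halving; [v / 2] lies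
    in the closure, and [v] is recovered because the closure is a vector space. That closure absorbs
    large factors through repeated addition, as scaling by a number above 1 is not controlled by the
    modular. Finally, Young's inequality for the flux leaves a multiple of [|grad w'|^p] not divided
    by [p], which explains the integrability asked of a competing weak solution [w']. Mollifications
    are differentiated by means of a second-order remainder bound that passes through the integral,
    rather than by differentiation under the integral sign. *)

Lemma measurable_powR2 d (T : measurableType d) (R : realType) (D : set T)
    (f g : T -> R) : measurable D ->
  measurable_fun D f -> measurable_fun D g ->
  measurable_fun D (fun x => f x `^ g x).
Proof.
move=> mD mf mg; rewrite /powR; apply: measurable_fun_if => //.
- by apply: measurable_fun_eqr => //; exact: measurable_cst.
- apply: (@measurable_funS _ _ _ _ D) => //.
  apply: (@measurableT_comp _ _ _ _ _ _ (fun b : bool => b%:R : R)) => //.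
  by apply: measurable_fun_eqr => //; exact: measurable_cst.
- apply: (@measurable_funS _ _ _ _ D) => //.
  apply: measurableT_comp => //; apply: measurable_funM => //.
  by apply: measurableT_comp => //; exact: measurable_ln.
Qed.

Lemma cvg_half_pow (R : realType) : (fun k => 2^-1 ^+ k : R) @ \oo --> 0.
Proof. by apply: cvg_expr; rewrite ger0_norm ?invr_ge0// invf_lt1 ?ltr1n. Qed.

Lemma sum_half_le (R : realType) (n : nat) :
  \sum_(0 <= k < n) 2^-1 ^+ k <= 2 :> R.
Proof.
have -> : \sum_(0 <= k < n) 2^-1 ^+ k = 2 - 2 * 2^-1 ^+ n :> R.
  elim: n => [|n IH]; first by rewrite big_nil expr0 mulr1 subrr.
  rewrite big_nat_recr//= IH exprS; lra.
by rewrite gerBl mulr_ge0// exprn_ge0// invr_ge0.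
Qed.

Section generic_measure.
Context d (T : measurableType d) (R : realType).
Variables (mu : {measure set T -> \bar R}) (D : set T).
Hypothesis mD : measurable D.

(** The majorant is the sum of all [f k]: by monotone convergence its integral is at most the sum of
    the [2^-k], hence finite, so the series converges almost everywhere and its terms tend to 0. The
    geometric rate replaces the extraction of subsequences. *)
Lemma fast_dominated (f : nat -> T -> R) :
  (forall k, measurable_fun D (f k)) ->
  (forall k x, D x -> 0 <= f k x) ->
  (forall k, (\int[mu]_(x in D) (f k x)%:E <= (2^-1 ^+ k)%:E)%E) ->
  exists g : T -> \bar R, [/\ mu.-integrable D g,
    forall k x, D x -> ((f k x)%:E <= g x)%E,
    {ae mu, forall x, D x -> cvgn (series (f ^~ x))} &
    {ae mu, forall x, D x -> f ^~ x @ \oo --> 0}].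
Proof.
move=> mf f0 If; pose g x := (\sum_(0 <= k <oo) (f k x)%:E)%E.
have mg : measurable_fun D g.
  apply: (ge0_emeasurable_sum (P := xpredT)).
  - by move=> k x Dx _; rewrite lee_fin f0.
  - by move=> k _; exact/measurable_EFinP.
have g0 x : D x -> (0 <= g x)%E.
  by move=> Dx; apply: nneseries_ge0 => k _ _; rewrite lee_fin f0.
have ig : mu.-integrable D g.
  apply/integrableP; split => //.
  rewrite (_ : (\int[mu]_(x in D) `|g x| = \int[mu]_(x in D) g x)%E); last first.
    by apply: eq_integral => x /set_mem Dx; rewrite gee0_abs// g0.
  rewrite integral_nneseries//; last first.
    by move=> k; exact/measurable_EFinP.
  apply: (@le_lt_trans _ _ (2 : R)%:E); last by rewrite ltry.
  apply: lime_le.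
    by apply: is_cvg_nneseries => k _ _; apply: integral_ge0 => x Dx;
      rewrite lee_fin f0.
  apply: nearW => n; apply: (@le_trans _ _ (\sum_(0 <= k < n) (2^-1 ^+ k : R)%:E)%E).
    exact: lee_sum.
  by rewrite sumEFin lee_fin sum_half_le.
have fg k x : D x -> ((f k x)%:E <= g x)%E.
  move=> Dx; apply: le_trans (nneseries_lim_ge k.+1 _); last first.
    by move=> n _ _; rewrite lee_fin f0.
  rewrite big_nat_recr//= leeDr// sume_ge0// => i _.
  by rewrite lee_fin f0.
have H : {ae mu, forall x, D x -> cvgn (series (f ^~ x))}.
  have := integrable_ae mD ig; apply: filterS => x gfin Dx.
  have {}gfin := gfin Dx.
  apply: nondecreasing_is_cvgn.
    apply/nondecreasing_seqP => n.
    by rewrite /series/= big_nat_recr//= lerDl f0.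
  exists (fine (g x)) => _ [n _ <-].
  rewrite -lee_fin fineK// /series/= -sumEFin; apply: nneseries_lim_ge.
  by move=> k _ _; rewrite lee_fin f0.
exists g; split => //.
by move: H; apply: filterS => x H Dx; apply: cvg_series_cvg_0; exact: H.
Qed.

(** Lower semicontinuity of energies, and bounds on the distance to an almost everywhere limit, are
    read off from this form of Fatou's lemma. An eventual bound is enough because each tail infimum
    lies below some late term. *)
Lemma fatou_bound (F : nat -> T -> R) (G : T -> R) (c : \bar R) :
  (forall k, measurable_fun D (F k)) -> measurable_fun D G ->
  (forall k x, D x -> 0 <= F k x) ->
  {ae mu, forall x, D x -> F ^~ x @ \oo --> G x} ->
  (\forall k \near \oo, (\int[mu]_(x in D) (F k x)%:E <= c)%E) ->
  (\int[mu]_(x in D) (G x)%:E <= c)%E.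
Proof.
move=> mF mG F0 FG Fc.
have -> : (\int[mu]_(x in D) (G x)%:E =
    \int[mu]_(x in D) limn_einf (fun k => (F k x)%:E))%E.
  apply: ae_eq_integral => //.
  - exact/measurable_EFinP.
  - rewrite /limn_einf; apply: measurableT_comp => //.
    apply: measurable_fun_limn_esup => k; apply: measurableT_comp => //.
    exact/measurable_EFinP.
  - move: FG; apply: filterS => x FG Dx; apply/esym.
    apply: (cvg_limn_einf_sup _).1.
    by apply: cvg_EFin (FG Dx); exact: nearW.
apply: le_trans (fatou mu mD _ _) _.
- by move=> k; exact/measurable_EFinP.
- by move=> k x Dx; rewrite lee_fin F0.
rewrite limn_einf_lim.
apply: lime_le; first exact: is_cvg_einfs.
case: Fc => N _ Fc; apply: nearW => k.
apply: le_trans (Fc (maxn k N) (leq_maxr _ _)).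
by apply: ereal_inf_lbound; exists (maxn k N) => //=; exact: leq_maxl.
Qed.

(** [fast_dominated] applied to the increments makes the telescoping series absolutely convergent
    almost everywhere. The limit is defined through [limn_esup], which is measurable whatever the
    sequence does, and [fine] keeps it real-valued on the exceptional set. *)
Lemma fast_cauchy (f : nat -> T -> R) :
  (forall k, measurable_fun D (f k)) ->
  (forall k, (\int[mu]_(x in D) `|f k.+1 x - f k x|%:E <= (2^-1 ^+ k)%:E)%E) ->
  exists g : T -> R, measurable_fun D g /\
    {ae mu, forall x, D x -> f ^~ x @ \oo --> g x}.
Proof.
move=> mf If.
have mdf k : measurable_fun D (fun x => `|f k.+1 x - f k x|).
  by apply: measurableT_comp => //; exact: measurable_funB.
have [h [_ _ cvh _]] := fast_dominated mdf (fun k x _ => normr_ge0 _) If.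
exists (fun x => fine (limn_esup (fun k => (f k x)%:E))); split.
  apply: measurableT_comp => //.
  by apply: measurable_fun_limn_esup => k; exact/measurable_EFinP.
move: cvh; apply: filterS => x cvh Dx; have {}cvh := cvh Dx.
have : cvgn (f ^~ x).
  have := normed_cvg (cvh : cvgn [normed series (fun k => f k.+1 x - f k x)]).
  move=> /cvg_ex[l lP]; apply/cvg_ex; exists (f 0 x + l).
  have -> : f ^~ x = (fun k => f 0 x + series (fun k => f k.+1 x - f k x) k).
    by apply/funext => k; rewrite /series/= telescope_sumr//; lra.
  by apply: cvgD => //; exact: cvg_cst.
move=> cf; have [_ ->//] : (limn_einf (fun k => (f k x)%:E) = (limn (f ^~ x))%:E) *
    (limn_esup (fun k => (f k x)%:E) = (limn (f ^~ x))%:E).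
by apply: cvg_limn_einf_sup; apply: cvg_EFin => //; exact: nearW.
Qed.

Lemma dominated_integral0 (f : nat -> T -> R) (g : T -> \bar R) :
  (forall k, measurable_fun D (f k)) ->
  (forall k x, D x -> 0 <= f k x) ->
  mu.-integrable D g ->
  {ae mu, forall x, D x -> forall k, ((f k x)%:E <= g x)%E} ->
  {ae mu, forall x, D x -> f ^~ x @ \oo --> 0} ->
  (fun k => \int[mu]_(x in D) (f k x)%:E)%E @ \oo --> 0%E.
Proof.
move=> mf f0 ig fg fc.
have mf' k : measurable_fun D (fun x => (f k x)%:E) by exact/measurable_EFinP.
have [] := dominated_convergence (f := cst 0%E) mD mf' _ _ ig.
- exact: measurable_cst.
- move: fc; apply: filterS => x fc Dx.
  by apply: cvg_EFin (fc Dx); exact: nearW.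
- move: fg; apply: filterS => x fg k Dx.
  by rewrite gee0_abs ?lee_fin ?f0// fg.
by move=> _ _; rewrite integral0.
Qed.

Lemma cvge0_lt (u : nat -> \bar R) (e : R) : u @ \oo --> 0%E -> 0 < e ->
  \forall k \near \oo, (u k < e%:E)%E.
Proof.
move=> u0 e0.
have [ufin uc] := (fine_cvgP u 0).1 u0.
have uc' : \forall k \near \oo, `|0 - (fine \o u) k| < e.
  by move/cvgrPdist_lt : uc; apply.
apply: filterS2 ufin uc' => k uk; rewrite sub0r normrN => ue.
by rewrite -(fineK uk) lte_fin (le_lt_trans (ler_norm _) ue).
Qed.

Lemma cvge0P (u : nat -> \bar R) : (forall k, (0 <= u k)%E) ->
  (forall e : R, 0 < e -> \forall k \near \oo, (u k < e%:E)%E) ->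
  u @ \oo --> 0%E.
Proof.
move=> u0 H; apply/fine_cvgP; split.
  move: (H 1 ltr01); apply: filterS => k uk.
  by rewrite ge0_fin_numE// (lt_trans uk)// ltry.
apply/cvgrPdist_lt => e e0; move: (H e e0); apply: filterS => k uk.
rewrite sub0r normrN /= ger0_norm ?fine_ge0//.
by rewrite -lte_fin fineK// ge0_fin_numE// (lt_trans uk)// ltry.
Qed.

End generic_measure.

(** * Elementary inequalities for real powers *)

Section powR_inequalities.
Variable R : realType.
Implicit Types (a b c v q : R).

(** Read as [v^q >= c^q + q c^(q-1) (v - c)], this is the tangent inequality of [t -> t^q] at [c];
    in that form it gives Jensen's inequality, midpoint convexity and the convexity of powers of the
    Euclidean norm. It is the inequality for conjugate exponents multiplied by [q]; the case [q = 1]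
    stands apart, having no finite conjugate. *)
Lemma young_powR c v q : 0 <= c -> 0 <= v -> 1 <= q ->
  q * c `^ (q - 1) * v <= (q - 1) * c `^ q + v `^ q.
Proof.
move=> c0 v0; rewrite le_eqVlt => /predU1P[<-|q1].
  by rewrite subrr powRr0 mulr1 mul1r mul0r add0r powRr1.
have q0 : 0 < q by lra.
have q10 : 0 < q - 1 by lra.
have := @conjugate_powR R (c `^ (q - 1)) v (q / (q - 1)) q (powR_ge0 _ _) v0.
rewrite divr_gt0// => /(_ isT q0).
have -> : (q / (q - 1))^-1 + q^-1 = 1 by field; rewrite !gt_eqF.
move=> /(_ erefl); rewrite -powRrM mulrCA divff ?gt_eqF// mulr1 => H.
have := ler_wpM2l (ltW q0) H; rewrite mulrA => /le_trans; apply.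
rewrite mulrDr invf_div [q * (v `^ q / q)]mulrC divfK ?gt_eqF// lerD2r.
rewrite [leLHS](_ : _ = (q - 1) * c `^ q)//; field; by rewrite gt_eqF.
Qed.

Lemma powR_le_lin (t K q : R) : 0 <= t -> t <= K -> 1 <= q ->
  t `^ q <= K `^ (q - 1) * t.
Proof.
move=> t0 tK q1; rewrite -mulr_powRB1//; last lra.
rewrite mulrC; apply: ler_wpM2r => //; apply: ge0_ler_powR; rewrite ?nnegrE//.
- by lra.
- exact: le_trans t0 tK.
Qed.

(** The sum is at most twice the larger term. Unlike the convexity constant [2^(q-1)], the constant
    [2^q] also covers [q < 1]. *)
Lemma powR_add_le a b q : 0 <= a -> 0 <= b -> 0 <= q ->
  (a + b) `^ q <= 2 `^ q * (a `^ q + b `^ q).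
Proof.
move=> a0 b0 q0.
wlog ab : a b a0 b0 / a <= b.
  move=> H; have [|/ltW] := leP a b; first exact: H.
  by move=> /(H b a b0 a0); rewrite addrC [_ `^ _ + _]addrC.
apply: (@le_trans _ _ ((2 * b) `^ q)).
  by apply: ge0_ler_powR; rewrite ?nnegrE ?addr_ge0 ?mulr_ge0//; lra.
by rewrite powRM// ler_wpM2l ?powR_ge0// lerDr powR_ge0.
Qed.

Lemma powR_norm_add_le a b q : 0 <= q ->
  `|a + b| `^ q <= 2 `^ q * (`|a| `^ q + `|b| `^ q).
Proof.
move=> q0; apply: le_trans (powR_add_le (normr_ge0 a) (normr_ge0 b) q0).
by apply: ge0_ler_powR; rewrite ?nnegrE ?addr_ge0//; exact: ler_normD.
Qed.

End powR_inequalities.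

(** * Inequalities between integrals *)

Section integral_inequalities.
Context d (T : measurableType d) (R : realType).
Variables (mu : {measure set T -> \bar R}) (D : set T).
Hypothesis mD : measurable D.
Implicit Types f g h : T -> R.

Lemma integral_leD f g h :
  measurable_fun D g -> measurable_fun D h -> measurable_fun D f ->
  (forall x, D x -> 0 <= f x) -> (forall x, D x -> 0 <= g x) ->
  (forall x, D x -> 0 <= h x) ->
  (forall x, D x -> f x <= g x + h x) ->
  (\int[mu]_(x in D) (f x)%:E <=
   \int[mu]_(x in D) (g x)%:E + \int[mu]_(x in D) (h x)%:E)%E.
Proof.
move=> mg mh mf f0 g0 h0 fgh; rewrite -ge0_integralD//.
- apply: ge0_le_integral => //.
  + exact/measurable_EFinP.
  + by apply/emeasurable_funD; exact/measurable_EFinP.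
- exact/measurable_EFinP.
- exact/measurable_EFinP.
Qed.

Lemma integral_leZ f g (c : R) : 0 <= c ->
  measurable_fun D f -> measurable_fun D g ->
  (forall x, D x -> 0 <= f x) -> (forall x, D x -> 0 <= g x) ->
  (forall x, D x -> f x <= c * g x) ->
  (\int[mu]_(x in D) (f x)%:E <= c%:E * \int[mu]_(x in D) (g x)%:E)%E.
Proof.
move=> c0 mf mg f0 g0 fg; rewrite -ge0_integralZl//.
- apply: ge0_le_integral => //.
  + exact/measurable_EFinP.
  + by apply/measurable_EFinP; apply: measurable_funM => //; exact: measurable_cst.
- exact/measurable_EFinP.
Qed.

Lemma integral_le f g :
  measurable_fun D f -> measurable_fun D g ->
  (forall x, D x -> 0 <= f x) ->
  (forall x, D x -> f x <= g x) ->
  (\int[mu]_(x in D) (f x)%:E <= \int[mu]_(x in D) (g x)%:E)%E.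
Proof.
move=> mf mg f0 fg; apply: ge0_le_integral => //.
- exact/measurable_EFinP.
- exact/measurable_EFinP.
Qed.

Lemma integrable_scalel f (c : R) : mu.-integrable D (EFin \o f) ->
  mu.-integrable D (fun x => (c * f x)%:E).
Proof. by move=> fi; under eq_fun do rewrite EFinM; exact: integrableZl. Qed.

Lemma integrable_scaler f (c : R) : mu.-integrable D (EFin \o f) ->
  mu.-integrable D (fun x => (f x * c)%:E).
Proof.
by move=> fi; under eq_fun do rewrite mulrC; exact: integrable_scalel.
Qed.

Lemma integrable_addr f g : mu.-integrable D (EFin \o f) ->
  mu.-integrable D (EFin \o g) -> mu.-integrable D (fun x => (f x + g x)%:E).
Proof. by move=> fi gi; under eq_fun do rewrite EFinD; exact: integrableD. Qed.

Lemma integrable_subr f g : mu.-integrable D (EFin \o f) ->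
  mu.-integrable D (EFin \o g) -> mu.-integrable D (fun x => (f x - g x)%:E).
Proof. by move=> fi gi; under eq_fun do rewrite EFinB; exact: integrableB. Qed.

Lemma integrable_sumr (I : Type) (s : seq I) (F : I -> T -> R) :
  (forall i, mu.-integrable D (EFin \o F i)) ->
  mu.-integrable D (fun x => (\sum_(i <- s) F i x)%:E).
Proof.
move=> iF; under eq_fun do rewrite -sumEFin.
by apply: integrable_sum => // i _; exact: iF.
Qed.

Lemma measurable_powR_normr f (p : T -> R) : measurable_fun D f ->
  measurable_fun D p -> measurable_fun D (fun x => `|f x| `^ p x).
Proof. by move=> mf mp; apply: measurable_powR2 => //; exact: measurableT_comp. Qed.

Lemma integral_powR_normD f g (q : R) : 0 <= q ->
  measurable_fun D f -> measurable_fun D g ->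
  (\int[mu]_(x in D) (`|f x + g x| `^ q)%:E <=
   (2 `^ q)%:E * (\int[mu]_(x in D) (`|f x| `^ q)%:E +
                 \int[mu]_(x in D) (`|g x| `^ q)%:E))%E.
Proof.
move=> q0 mf mg.
have mF : measurable_fun D (fun x => `|f x| `^ q).
  by apply: measurable_powR_normr => //; exact: measurable_cst.
have mG : measurable_fun D (fun x => `|g x| `^ q).
  by apply: measurable_powR_normr => //; exact: measurable_cst.
have mFG : measurable_fun D (fun x => `|f x + g x| `^ q).
  apply: measurable_powR_normr; last exact: measurable_cst.
  exact: measurable_funD.
rewrite -ge0_integralD; [|by []|by move=> x _; rewrite lee_fin powR_ge0|
  exact/measurable_EFinP|by move=> x _; rewrite lee_fin powR_ge0|
  exact/measurable_EFinP].
under [X in (_ <= _ * X)%E]eq_integral do rewrite -EFinD.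
apply: integral_leZ.
- exact: powR_ge0.
- exact: mFG.
- exact: measurable_funD.
- by move=> x _; exact: powR_ge0.
- by move=> x _; rewrite addr_ge0 ?powR_ge0.
- by move=> x _; exact: powR_norm_add_le.
Qed.

(** The tangent inequality [young_powR] at the mean [c] is multiplied by the density [w] and
    integrated. Its terms are arranged so that both sides are nonnegative, which lets the integral
    of [v^q w] be infinite. *)
Lemma jensen_powR (v w : T -> R) (q : R) : 1 <= q ->
  measurable_fun D v -> measurable_fun D w ->
  (forall x, D x -> 0 <= v x) -> (forall x, D x -> 0 <= w x) ->
  (\int[mu]_(x in D) (w x)%:E = 1)%E ->
  mu.-integrable D (fun x => (v x * w x)%:E) ->
  (((\int[mu]_(x in D) (v x * w x)) `^ q)%:E <=
    \int[mu]_(x in D) (v x `^ q * w x)%:E)%E.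
Proof.
move=> q1 mv mw v0 w0 w1 ivw; set c := (\int[mu]_(x in D) (v x * w x))%R.
have q0 : 0 < q by lra.
have c0 : 0 <= c by apply: Rintegral_ge0 => x Dx; rewrite mulr_ge0 ?v0 ?w0.
have cE : (\int[mu]_(x in D) (v x * w x)%:E = c%:E)%E.
  by rewrite /c /Rintegral fineK//; exact: integrable_fin_num.
have mvw : measurable_fun D (fun x => v x * w x) by exact: measurable_funM.
have mvq : measurable_fun D (fun x => v x `^ q * w x).
  by apply: measurable_funM => //; apply: measurable_powR2.
have H := @integral_leD (fun x => c `^ q * w x + q * c `^ (q - 1) * (v x * w x))
  (fun x => v x `^ q * w x) (fun x => q * c `^ q * w x).
have {}H : (\int[mu]_(x in D) (c `^ q * w x + q * c `^ (q - 1) * (v x * w x))%:E <=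
    \int[mu]_(x in D) (v x `^ q * w x)%:E + \int[mu]_(x in D) (q * c `^ q * w x)%:E)%E.
  apply: H => //.
  - by apply: measurable_funM => //; exact: measurable_cst.
  - apply: measurable_funD.
      by apply: measurable_funM => //; exact: measurable_cst.
    by apply: measurable_funM => //; exact: measurable_cst.
  - by move=> x Dx; rewrite addr_ge0// !mulr_ge0 ?powR_ge0 ?v0 ?w0// ltW.
  - by move=> x Dx; rewrite mulr_ge0 ?powR_ge0 ?w0.
  - by move=> x Dx; rewrite !mulr_ge0 ?powR_ge0 ?w0// ltW.
  - move=> x Dx; have := young_powR c0 (v0 x Dx) q1.
    move=> /(ler_wpM2r (w0 x Dx)); lra.
have E1 (k : R) : 0 <= k -> (\int[mu]_(x in D) (k * w x)%:E = k%:E)%E.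
  move=> k0; under eq_integral do rewrite EFinM.
  rewrite ge0_integralZl//; first by rewrite w1 mule1.
  exact/measurable_EFinP.
move: H; under eq_integral do rewrite EFinD.
rewrite ge0_integralD//; last 4 first.
- by move=> x Dx; rewrite lee_fin mulr_ge0 ?powR_ge0 ?w0.
- by apply/measurable_EFinP; apply: measurable_funM => //; exact: measurable_cst.
- by move=> x Dx; rewrite lee_fin !mulr_ge0 ?powR_ge0 ?v0 ?w0// ltW.
- by apply/measurable_EFinP; apply: measurable_funM => //; exact: measurable_cst.
rewrite !E1 ?mulr_ge0 ?powR_ge0 ?(ltW q0)//.
under [X in (_ + X <= _)%E]eq_integral do rewrite EFinM.
rewrite ge0_integralZl//; last 3 first.
- exact/measurable_EFinP.
- by move=> x Dx; rewrite lee_fin !mulr_ge0 ?v0 ?w0.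
- by rewrite lee_fin mulr_ge0 ?powR_ge0 ?(ltW q0).
rewrite cE -EFinM -mulrA [_ * c]mulrC mulr_powRB1//.
by rewrite leeD2rE.
Qed.

End integral_inequalities.

(** * Lebesgue measure on R^n *)

Section euclidean_measurability.
Variables (R : realType) (n : nat).
Implicit Types (x y h : 'rV[R]_n) (A U : set 'rV[R]_n).

Lemma coord_norm_le x (i : 'I_n) : `|x ord0 i| <= `|x|.
Proof.
rewrite [leRHS]/Num.Def.normr /= mx_normrE; apply/bigmax_geP; right => /=.
by exists (ord0, i).
Qed.

Lemma norm_lt_coord x (r : R) : 0 < r ->
  (forall i, `|x ord0 i| < r) -> `|x| < r.
Proof.
move=> r0 xr; rewrite /Num.Def.normr /= mx_normrE; apply/bigmax_ltP; split => //=.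
by move=> [i j] _ /=; rewrite (ord1 i).
Qed.

Lemma norm_le_coord x (r : R) : 0 <= r ->
  (forall i, `|x ord0 i| <= r) -> `|x| <= r.
Proof.
move=> r0 xr; rewrite /Num.Def.normr /= mx_normrE; apply/bigmax_leP; split => //=.
by move=> [i j] _ /=; rewrite (ord1 i).
Qed.

Lemma measurable_rV_ball x (r : R) : 0 < r -> measurable (ball x r).
Proof.
move=> r0.
have -> : ball x r = \bigcap_(i in [set: 'I_n])
    ((fun y : 'rV[R]_n => y ord0 i) @^-1` (ball (x ord0 i) r)).
  rewrite -ball_normE; apply/seteqP; split => y /=.
    move=> xy i _; rewrite /= -ball_normE /=.
    by apply: le_lt_trans xy; have := coord_norm_le (x - y) i; rewrite !mxE.
  move=> xy; apply: norm_lt_coord => // i.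
  by have := xy i I; rewrite /= -ball_normE /= !mxE.
apply: fin_bigcap_measurable; first exact: finite_finset.
move=> i _; rewrite -[X in measurable X]setTI; apply: measurable_coord => //.
exact: measurable_ball.
Qed.

Lemma rV_rat_approx x (e : R) : 0 < e ->
  exists c : 'rV[rat]_n, `|x - map_mx ratr c| < e.
Proof.
move=> e0.
have H i : exists q : rat, `|x ord0 i - ratr q| < e.
  have : x ord0 i - e < x ord0 i + e by lra.
  move=> /rat_in_itvoo[q]; rewrite in_itv/= => qe; exists q.
  by rewrite ltr_distlC; lra.
exists (\row_i xget 0 [set q : rat | `|x ord0 i - ratr q| < e]).
apply: norm_lt_coord => // i; rewrite !mxE.
have [q qe] := H i.
exact: (@xgetPex _ 0 [set q : rat | `|x ord0 i - ratr q| < e]) (ex_intro _ q qe).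
Qed.

(** The sigma-algebra is generated by the coordinates, so an open set must be written as a countable
    union of boxes: sup-norm balls with rational centre and radius. [F] ranges over all rational
    data and is empty when the ball is not contained in [U]. *)
Lemma open_rV_measurable U : open U -> measurable U.
Proof.
move=> oU.
pose F (c : 'rV[rat]_n * rat) : set 'rV[R]_n :=
  if `[< 0 < c.2 /\ ball (map_mx ratr c.1 : 'rV[R]_n) (ratr c.2 : R) `<=` U >]
  then ball (map_mx ratr c.1 : 'rV[R]_n) (ratr c.2 : R) else set0.
have -> : U = \bigcup_c F c.
  apply/seteqP; split => [x Ux|x [c _]]; last first.
    by rewrite /F; case: asboolP => // -[_]; apply.
  have := open_nbhs_nbhs (conj oU Ux) => /nbhs_ballP[e /= e0 xeU].
  have [q /andP[q0 qe]] : exists q : rat, 0 < (ratr q : R) < e / 2.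
    have : 0 < e / 2 by lra.
    by move=> /rat_in_itvoo[q]; rewrite in_itv/= => qe; exists q.
  have [c xc] := rV_rat_approx x q0.
  exists (c, q) => //; rewrite /F; case: asboolP => /=; last first.
    case; split; first by rewrite -(ltr0q R).
    move=> y yc; apply: xeU; rewrite -ball_normE /=.
    move: yc; rewrite -ball_normE /= => yc.
    have := ler_normD (x - map_mx ratr c) (map_mx ratr c - y).
    by rewrite addrA subrK; lra.
  by move=> _; rewrite -ball_normE /= distrC.
apply: countable_bigcupT_measurable => // c; rewrite /F.
case: asboolP => // -[c0 _]; apply: measurable_rV_ball.
by rewrite ltr0q.
Qed.

Lemma closed_rV_measurable U : closed U -> measurable U.
Proof.
move=> cU; rewrite -[U]setCK; apply: measurableC.
by apply: open_rV_measurable; exact: closed_openC.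
Qed.

Lemma compact_rV_measurable U : compact U -> measurable U.
Proof.
by move=> cU; apply: closed_rV_measurable; exact: compact_closed.
Qed.

Lemma open_continuous_measurable U (f : 'rV[R]_n -> R) : open U ->
  {within U, continuous f} -> measurable_fun U f.
Proof.
move=> oU cf; apply: (measurability _ (RGenOpens.measurableE R)) => //.
move=> _ [_ [a [b ->]] <-]; apply: open_rV_measurable.
have : open (f @^-1` `]a, b[%classic : set (subspace U)).
  by move/continuousP : cf; apply; exact: interval_open.
by move=> /open_subspaceP[V oV VU]; rewrite setIC -VU; exact: openI.
Qed.

Lemma continuous_rV_measurable (f : 'rV[R]_n -> R) : continuous f ->
  measurable_fun [set: 'rV[R]_n] f.
Proof.
move=> cf; apply: open_continuous_measurable; first exact: openT.
exact: continuous_subspaceT.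
Qed.

Lemma measurable_rV_add : measurable_fun [set: 'rV[R]_n * 'rV[R]_n]
  (fun z : 'rV[R]_n * 'rV[R]_n => z.1 + z.2).
Proof.
apply: measurable_fun_rVP => i.
rewrite [X in measurable_fun _ X](_ : _ = (fun z : 'rV[R]_n * 'rV[R]_n =>
    z.1 ord0 i + z.2 ord0 i)).
  apply: measurable_funD.
    exact: (measurableT_comp (@measurable_coord R n i) measurable_fst).
  exact: (measurableT_comp (@measurable_coord R n i) measurable_snd).
by apply/funext => z; rewrite mxE.
Qed.

Lemma measurable_rV_shift h : measurable_fun [set: 'rV[R]_n] (+%R h).
Proof.
apply: measurable_fun_rVP => i.
rewrite [X in measurable_fun _ X](_ : _ = (fun z : 'rV[R]_n => h ord0 i + z ord0 i)).
  apply: measurable_funD; first exact: measurable_cst.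
  exact: measurable_coord.
by apply/funext => z; rewrite mxE.
Qed.

End euclidean_measurability.

(** The pushforward of Lebesgue measure by a translation gives every half-open interval its length,
    and these values determine the measure. *)
Lemma lebesgue_measure_shift (R : realType) (h : R) (A : set R) :
  measurable A -> lebesgue_measure (+%R h @^-1` A) = lebesgue_measure A.
Proof.
move=> mA.
have mh : measurable_fun [set: measurableTypeR R]
    (+%R h : measurableTypeR R -> measurableTypeR R).
  by apply: measurable_funD; [exact: measurable_cst|exact: measurable_id].
transitivity (pushforward (@lebesgue_measure R)
  (+%R h : measurableTypeR R -> measurableTypeR R) A) => //.
apply/esym/lebesgue_measure_unique => //= _ [[a b]] _ <-.
rewrite /pushforward [X in _ = lebesgue_measure X](_ : _ = `]a - h, b - h]%classic).
  by rewrite !lebesgue_measure_itv/= !lte_fin ltrD2r -!EFinB opprB addrA subrK.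
by apply/seteqP; split => x /=; rewrite !in_itv/=; lra.
Qed.

Section lebesgue_rV_translation.
Variable R : realType.

Lemma rV_shiftE n (h : 'rV[R]_n.+1) (z : measurableTypeR R * 'rV[R]_n) :
  h + rV_cons z =
  rV_cons (((h ord0 ord0 + (z.1 : R) : R) : measurableTypeR R),
           (\row_j h ord0 (lift ord0 j)) + z.2).
Proof.
apply/rowP => i; rewrite /rV_cons mxE.
case: (@split_ordP 1 n i) => j ->.
  by rewrite !(@row_mxEl _ 1 1 n) (ord1 j) !mxE eqxx; congr (h _ _ + _); exact/val_inj.
by rewrite !(@row_mxEr _ 1 1 n) !mxE; congr (h _ _ + _); exact/val_inj.
Qed.

(** By [rV_shiftE] a translation splits into one of the first coordinate and one of the others. By
    induction on the dimension it preserves the measure of rectangles, and these determine the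
    product measure. *)
Lemma lebesgue_rV_shift n (h : 'rV[R]_n) (A : set 'rV[R]_n) :
  measurable A -> lebesgue_rV R n (+%R h @^-1` A) = lebesgue_rV R n A.
Proof.
elim: n h A => [|n IH] h A mA.
  by congr (lebesgue_rV R 0 _); apply/seteqP; split => x /=;
    rewrite (_ : h + x = x)//; apply/rowP => -[].
rewrite /= /lebesgue_rV_step/=.
set h0 := h ord0 ord0; set h1 := \row_j h ord0 (lift ord0 j).
set B := @rV_cons R n @^-1` A.
have mB : measurable B.
  by rewrite -[X in measurable X]setTI; exact: measurable_rV_cons.
pose s (z : measurableTypeR R * 'rV[R]_n) : measurableTypeR R * 'rV[R]_n :=
  ((h0 + (z.1 : R) : measurableTypeR R), h1 + z.2).
have ms : measurable_fun [set: measurableTypeR R * 'rV[R]_n] s.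
  apply: measurable_fun_pair => /=.
    by apply: measurable_funD; [exact: measurable_cst|exact: measurable_fst].
  by apply: (measurableT_comp (measurable_rV_shift h1)); exact: measurable_snd.
rewrite /pushforward.
transitivity (pushforward (@lebesgue_measure R \x lebesgue_rV R n)%E s B).
  rewrite /pushforward; congr (_ _); apply/seteqP; split => z /=;
  by rewrite /B/= rV_shiftE.
apply/esym; apply: product_measure_unique => // X Y mX mY.
transitivity ((@lebesgue_measure R \x lebesgue_rV R n)%E
  ((+%R h0 @^-1` X) `*` (+%R h1 @^-1` Y))) => //.
rewrite product_measure1E//.
- by rewrite [X in (X * _)%E](lebesgue_measure_shift h0 mX) IH.
- rewrite -[X in measurable X]setTI.
  have : measurable_fun [set: measurableTypeR R] (+%R h0 : measurableTypeR R -> measurableTypeR R).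
    by apply: measurable_funD; [exact: measurable_cst|exact: measurable_id].
  exact.
- by rewrite -[X in measurable X]setTI; exact: (measurable_rV_shift h1).
Qed.

(** For the sup norm a ball is a cube of side [2 r]: an interval times a ball in one dimension
    less. *)
Lemma lebesgue_rV_ball n (x : 'rV[R]_n) (r : R) : 0 < r ->
  lebesgue_rV R n (ball x r) = ((r *+ 2) ^+ n)%:E.
Proof.
move=> r0; elim: n x => [|n IH] x.
  rewrite expr0 /= diracE mem_set//.
  by rewrite -ball_normE/=; apply: norm_lt_coord => // -[].
rewrite /= /lebesgue_rV_step/= /pushforward.
rewrite (_ : _ @^-1` _ = (ball (x ord0 ord0) r) `*`
    (ball (\row_j x ord0 (lift ord0 j) : 'rV[R]_n) r)).
  rewrite product_measure1E//.
  - by rewrite [X in (X * _)%E](lebesgue_measure_ball _ (ltW r0)) IH exprS EFinM.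
  - exact: measurable_ball.
  - exact: measurable_rV_ball.
apply/seteqP; split => -[a y]; rewrite /= -!ball_normE /= => H.
  split => /=.
    apply: le_lt_trans H; have := coord_norm_le (x - rV_cons (a, y)) ord0.
    have /(congr1 fst)/= Ea := rV_consK (a, y).
    by rewrite [X in `|X|]mxE [X in _ + X]mxE Ea.
  apply: norm_lt_coord => // i; rewrite !mxE.
  apply: le_lt_trans H; have := coord_norm_le (x - rV_cons (a, y)) (lift ord0 i).
  have /(congr1 (fun z : _ * 'rV[R]_n => z.2 ord0 i)) /= := rV_consK (a, y).
  by rewrite !mxE => ->.
case: H => /= H1 H2; apply: norm_lt_coord => // i; rewrite mxE [X in _ + X]mxE.
have [E1 E2] := rV_consK (a, y).
case: (unliftP ord0 i) => [j ->|->]; last by rewrite E1.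
have /(congr1 (fun z : 'rV[R]_n => z ord0 j)) := E2; rewrite mxE => ->.
by apply: le_lt_trans H2; have := coord_norm_le (\row_j x ord0 (lift ord0 j) - y) j;
  rewrite !mxE.
Qed.

Lemma ge0_integral_rV_shift n (h : 'rV[R]_n) (f : 'rV[R]_n -> \bar R) :
  measurable_fun [set: 'rV[R]_n] f -> (forall x, (0 <= f x)%E) ->
  (\int[lebesgue_rV R n]_x f (h + x)%R = \int[lebesgue_rV R n]_x f x)%E.
Proof.
move=> mf f0.
transitivity (\int[pushforward (lebesgue_rV R n) (+%R h)]_x f x)%E.
  by rewrite (ge0_integral_pushforward (measurable_rV_shift h))// preimage_setT.
apply: eq_measure_integral; first exact: measurable_rV_shift.
by move=> mh A mA _; exact: (lebesgue_rV_shift h mA).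
Qed.

Lemma integrable_rV_shift n (h : 'rV[R]_n) (f : 'rV[R]_n -> \bar R) :
  (lebesgue_rV R n).-integrable setT f ->
  (lebesgue_rV R n).-integrable setT (fun x => f (h + x)).
Proof.
move=> /integrableP[mf fi]; apply/integrableP; split.
  exact: (measurableT_comp mf (measurable_rV_shift h)).
rewrite (ge0_integral_rV_shift h (f := fun x => `|f x|%E))//.
exact: measurableT_comp.
Qed.

Lemma integral_rV_shift n (h : 'rV[R]_n) (f : 'rV[R]_n -> \bar R) :
  (lebesgue_rV R n).-integrable setT f ->
  (\int[lebesgue_rV R n]_x f (h + x)%R = \int[lebesgue_rV R n]_x f x)%E.
Proof.
move=> fi; have mf := measurable_int _ fi.
rewrite [LHS]integralE [RHS]integralE; congr (_ - _)%E.
  rewrite -(ge0_integral_rV_shift h (measurable_funepos mf) (funepos_ge0 f)).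
  by apply: eq_integral => x _; rewrite !funepos.unlock.
rewrite -(ge0_integral_rV_shift h (measurable_funeneg mf) (funeneg_ge0 f)).
by apply: eq_integral => x _; rewrite !funeneg.unlock.
Qed.

End lebesgue_rV_translation.

(** * Mollifiers *)

Section quadratic_remainder.
Variables (R : realType) (n : nat).
Implicit Types (f : 'rV[R]_n -> R) (g : 'I_n -> 'rV[R]_n -> R) (x h : 'rV[R]_n).

(** A quantitative form of being C^1 with bounded Lipschitz gradient [g]. Every clause is a bound
    uniform in [x], so the whole property survives convolution with an integrable function. *)
Definition C11 f g := exists2 C : R, 0 <= C &
  [/\ forall x, `|f x| <= C, forall i x, `|g i x| <= C,
      forall i x h, `|g i (x + h) - g i x| <= C * `|h| &
      forall x h, `|f (x + h) - f x - \sum_i h ord0 i * g i x| <= C * `|h| ^+ 2].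

Lemma sum_coord_le h (c : 'I_n -> R) (C : R) : (forall i, `|c i| <= C) ->
  `|\sum_i h ord0 i * c i| <= n%:R * C * `|h|.
Proof.
move=> cC; apply: le_trans (ler_norm_sum _ _ _) _.
apply: (@le_trans _ _ (\sum_(i < n) (C * `|h|))); last first.
  by rewrite sumr_const card_ord -[X in X <= _]mulr_natl mulrA.
apply: ler_sum => i _; rewrite normrM mulrC.
by apply: ler_pM => //; exact: coord_norm_le.
Qed.

Lemma lipschitz_continuous (f : 'rV[R]_n -> R) (C : R) :
  (forall x h, `|f (x + h) - f x| <= C * `|h|) -> continuous f.
Proof.
move=> fC x.
apply/(@cvgrPdist_lt _ _ _ (nbhs (x : 'rV[R]_n)) _ f (f x)) => e e0.
have C0 : 0 < `|C| + 1 by rewrite ltr_wpDl.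
near=> y.
have := fC x (y - x); rewrite [x + _]addrC subrK distrC => /le_lt_trans; apply.
apply: (@le_lt_trans _ _ ((`|C| + 1) * `|y - x|)).
  by apply: ler_wpM2r => //; have := ler_norm C; lra.
rewrite mulrC -ltr_pdivlMr// distrC; near: y.
apply/nbhs_ballP; exists (e / (`|C| + 1)) => /=; first by rewrite divr_gt0.
by move=> y; rewrite -ball_normE.
Unshelve. all: by end_near. Qed.

Lemma C11_grad_continuous f g i : C11 f g -> continuous (g i).
Proof. by move=> [C C0 [_ _ gC _]]; exact: lipschitz_continuous (gC i). Qed.

(** Increments of norm at least 1 are covered by the bound on [f], smaller ones by the remainder
    estimate, where [|h|^2 <= |h|]. *)
Lemma C11_lipschitz f g : C11 f g ->
  exists2 K : R, 0 <= K & forall x h, `|f (x + h) - f x| <= K * `|h|.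
Proof.
move=> [C C0 [fC gC _ fT]].
exists (2 * C + C + n%:R * C); first by rewrite !addr_ge0 ?mulr_ge0.
move=> x h.
have [h1|h1] := leP 1 `|h|.
  apply: (@le_trans _ _ (2 * C)).
    have := ler_normB (f (x + h)) (f x); have := fC (x + h); have := fC x; lra.
  apply: (@le_trans _ _ (2 * C * `|h|)); first by rewrite ler_peMr// mulr_ge0.
  by rewrite ler_wpM2r// -addrA lerDl addr_ge0// mulr_ge0.
have H := ler_normD (f (x + h) - f x - \sum_i h ord0 i * g i x)
   (\sum_i h ord0 i * g i x).
rewrite subrK in H; apply: le_trans H _.
rewrite mulrDl; apply: lerD; last exact: sum_coord_le.
apply: le_trans (fT _ _) _; rewrite expr2 mulrA ler_wpM2r//.
have : C * `|h| <= C by rewrite ler_piMr// ltW.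
by lra.
Qed.

Lemma C11_continuous f g : C11 f g -> continuous f.
Proof. by move=> /C11_lipschitz[K _]; exact: lipschitz_continuous. Qed.

Lemma C11_derive f g x v : C11 f g ->
  is_derive x v f (\sum_i v ord0 i * g i x).
Proof.
move=> [C C0 [fC gC _ fT]].
have H : h^-1 *: (f (h *: v + x) - f x) @[h --> 0^'] --> \sum_i v ord0 i * g i x.
  have p0 : 0 < C * `|v| ^+ 2 + 1 by rewrite ltr_wpDl// mulr_ge0// exprn_ge0.
  apply/cvgrPdist_le => e e0; near=> h.
  have h0 : h != 0 by near: h; exact: nbhs_dnbhs_neq.
  have -> : \sum_i v ord0 i * g i x - h^-1 *: (f (h *: v + x) - f x) =
     - (h^-1 * (f (x + h *: v) - f x - \sum_i (h *: v) ord0 i * g i x)).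
    under [in RHS]eq_bigr do rewrite mxE -mulrA.
    rewrite -mulr_sumr [_ *: v + _]addrC; set S := \sum_i _.
    by rewrite [in RHS]mulrBr mulKf// opprB.
  rewrite normrN normrM normfV ler_pdivrMl ?normr_gt0//.
  apply: le_trans (fT _ _) _; rewrite normrZ exprMn mulrCA expr2 -!mulrA ler_wpM2l//.
  apply: (@le_trans _ _ (`|h| * (C * `|v| ^+ 2 + 1))).
    by rewrite ler_wpM2l// lerDl.
  rewrite -ler_pdivlMr//.
  by near: h; apply: dnbhs0_le; rewrite divr_gt0.
split; first by apply/cvg_ex; exists (\sum_i v ord0 i * g i x).
exact/cvg_lim.
Unshelve. all: by end_near. Qed.

Lemma C11_partial f g i : C11 f g -> partial i f = g i.
Proof.
move=> fg; apply/funext => x; rewrite /partial.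
have -> := @derive_val _ _ _ _ _ _ _ (C11_derive x (delta_mx ord0 i) fg).
rewrite (bigD1 i)//= big1 ?addr0; first by rewrite mxE !eqxx mul1r.
by move=> j ji; rewrite mxE (negbTE ji) andbF mul0r.
Qed.

Lemma C11_C1 f g : C11 f g -> C1 f.
Proof.
move=> fg; split; last first.
  by move=> i; rewrite (C11_partial i fg); exact: C11_grad_continuous fg.
move=> x; have [C C0 [fC gC _ fT]] := fg.
have [L LE] : exists L : {linear 'rV[R]_n -> R},
    forall h, L h = \sum_i h ord0 i * g i x.
  have @L : {linear 'rV[R]_n -> R}.
    exists (fun h : 'rV[R]_n => \sum_i h ord0 i * g i x); do 2![eexists]; do ?[constructor].
    - by rewrite big1// => i _; rewrite mxE mul0r.
    - by move=> a b; rewrite -big_split/=; apply: eq_bigr => i _; rewrite mxE mulrDl.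
    - move=> a b; rewrite /= scaler_sumr; apply: eq_bigr => i _.
      by rewrite mxE /GRing.scale/= mulrA.
  by exists L.
have cL : continuous L.
  apply: (@lipschitz_continuous L (n%:R * C)) => y h.
  by rewrite linearD addrC addKr LE; exact: sum_coord_le.
have H := @diff_unique R 'rV[R]_n R f L x cL.
match type of H with ?A -> _ => have E : A end.
  have C1 : 0 < C + 1 by lra.
  apply/eqaddoP => e e0; near=> h.
  have -> : (f \o shift x - (cst (f x) + L)) h =
    f (x + h) - f x - \sum_i h ord0 i * g i x.
    by rewrite -LE [x + h]addrC -addrA -opprD.
  apply: le_trans (fT _ _) _; rewrite expr2 mulrA ler_wpM2r//.
  apply: (@le_trans _ _ ((C + 1) * `|h|)); first by rewrite ler_wpM2r//; lra.
  rewrite mulrC -ler_pdivlMr//; near: h.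
  suff : \forall y \near (0 : 'rV[R]_n), `|y| <= e / (C + 1) by [].
  apply/nbhs_ballP; exists (e / (C + 1)) => /=; first by rewrite divr_gt0.
  by move=> y; rewrite -ball_normE /= sub0r normrN => /ltW.
by apply/diff_locallyP; rewrite (H E).
Unshelve. all: by end_near. Qed.

Lemma C11_cst (c : R) : C11 (fun=> c) (fun _ _ => 0).
Proof.
exists `|c| => //; split => //.
- by move=> i x; rewrite normr0.
- by move=> i x h; rewrite subrr normr0 mulr_ge0.
- move=> x h; rewrite big1 ?subrr ?subr0 ?normr0 ?mulr_ge0//.
  by move=> i _; rewrite mulr0.
Qed.

Lemma C11M f g f' g' : C11 f g -> C11 f' g' ->
  C11 (fun x => f x * f' x) (fun i x => f x * g' i x + f' x * g i x).
Proof.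
move=> fg fg'.
have [K K0 fL] := C11_lipschitz fg; have [K' K'0 fL'] := C11_lipschitz fg'.
case: fg => C C0 [fC gC gL fT]; case: fg' => C' C'0 [fC' gC' gL' fT'].
(* [C] and [C'] bound the factors and their gradients, [K] and [K'] are Lipschitz constants of the
   factors; the sum is generous enough for all four clauses at once. *)
exists (2 * C * C' + (C * C' + K * C') + (C * C' + K' * C) + (K * K' + C * C' + C * C')).
  by rewrite !addr_ge0 ?mulr_ge0.
have p1 : 0 <= C * C' by rewrite mulr_ge0.
have p2 : 0 <= K * K' by rewrite mulr_ge0.
have p3 : 0 <= K * C' by rewrite mulr_ge0.
have p4 : 0 <= K' * C by rewrite mulr_ge0.
split.
- move=> x; rewrite normrM; have : `|f x| * `|f' x| <= C * C' by exact: ler_pM.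
  lra.
- move=> i x; apply: le_trans (ler_normD _ _) _; rewrite !normrM.
  have : `|f x| * `|g' i x| <= C * C' by exact: ler_pM.
  have : `|f' x| * `|g i x| <= C * C' by rewrite mulrC; exact: ler_pM.
  lra.
- move=> i x h.
  have -> : f (x + h) * g' i (x + h) + f' (x + h) * g i (x + h) -
     (f x * g' i x + f' x * g i x) =
     (f (x + h) * (g' i (x + h) - g' i x) + (f (x + h) - f x) * g' i x) +
     (f' (x + h) * (g i (x + h) - g i x) + (f' (x + h) - f' x) * g i x) by ring.
  have h1 : `|f (x + h) * (g' i (x + h) - g' i x)| <= C * (C' * `|h|).
    by rewrite normrM; exact: ler_pM.
  have h2 : `|(f (x + h) - f x) * g' i x| <= K * `|h| * C'.
    by rewrite normrM; exact: ler_pM.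
  have h3 : `|f' (x + h) * (g i (x + h) - g i x)| <= C' * (C * `|h|).
    by rewrite normrM; exact: ler_pM.
  have h4 : `|(f' (x + h) - f' x) * g i x| <= K' * `|h| * C.
    by rewrite normrM; exact: ler_pM.
  apply: le_trans (ler_normD _ _) _.
  apply: le_trans (lerD (ler_normD _ _) (ler_normD _ _)) _.
  apply: le_trans (lerD (lerD h1 h2) (lerD h3 h4)) _.
  have -> : C * (C' * `|h|) + K * `|h| * C' + (C' * (C * `|h|) + K' * `|h| * C) =
    (2 * (C * C') + K * C' + K' * C) * `|h| by ring.
  by apply: ler_wpM2r => //; lra.
- move=> x h.
  under eq_bigr do rewrite mulrDr mulrCA [h _ _ * (f' x * _)]mulrCA.
  rewrite big_split/= -!mulr_sumr.
  set s := \sum_i _; set s' := \sum_i _.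
  (* The remainder of a product is the product of the two increments plus each factor times the
     remainder of the other. *)
  have -> : f (x + h) * f' (x + h) - f x * f' x - (f x * s + f' x * s') =
    (f (x + h) - f x) * (f' (x + h) - f' x) + f x * (f' (x + h) - f' x - s) +
    f' x * (f (x + h) - f x - s') by ring.
  have h1 : `|(f (x + h) - f x) * (f' (x + h) - f' x)| <= (K * `|h|) * (K' * `|h|).
    by rewrite normrM; exact: ler_pM.
  have h2 : `|f x * (f' (x + h) - f' x - s)| <= C * (C' * `|h| ^+ 2).
    by rewrite normrM; exact: ler_pM.
  have h3 : `|f' x * (f (x + h) - f x - s')| <= C' * (C * `|h| ^+ 2).
    by rewrite normrM; exact: ler_pM.
  apply: le_trans (ler_normD _ _) _.
  apply: le_trans (lerD (ler_normD _ _) (lexx _)) _.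
  apply: le_trans (lerD (lerD h1 h2) h3) _.
  have -> : K * `|h| * (K' * `|h|) + C * (C' * `|h| ^+ 2) + C' * (C * `|h| ^+ 2) =
    (K * K' + 2 * (C * C')) * `|h| ^+ 2 by ring.
  by apply: ler_wpM2r; [exact: exprn_ge0|lra].
Qed.

Lemma C11Z f g (c : R) : C11 f g -> C11 (fun x => c * f x) (fun i x => c * g i x).
Proof.
move=> [C C0 [fC gC gL fT]]; exists (`|c| * C); first by rewrite mulr_ge0.
split.
- by move=> x; rewrite normrM ler_wpM2l.
- by move=> i x; rewrite normrM ler_wpM2l.
- by move=> i x h; rewrite -mulrBr normrM -mulrA ler_wpM2l.
- move=> x h; under eq_bigr do rewrite mulrCA.
  by rewrite -mulr_sumr -!mulrBr normrM -mulrA ler_wpM2l.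
Qed.

Lemma C11_reflect f g x0 : C11 f g ->
  C11 (fun y => f (x0 - y)) (fun i y => - g i (x0 - y)).
Proof.
move=> [C C0 [fC gC gL fT]]; exists C => //; split => //.
- by move=> i x; rewrite normrN.
- move=> i x h; rewrite -opprD normrN opprD addrA.
  by have := gL i (x0 - x) (- h); rewrite normrN.
- move=> x h; rewrite opprD addrA.
  have := fT (x0 - x) (- h); rewrite normrN.
  by under eq_bigr do rewrite mxE mulNr -mulrN.
Qed.

End quadratic_remainder.

(** * A compactly supported bump with Lipschitz gradient *)

Section bump.
Variable R : realType.

Definition pos_sq (s : R) := Num.max 0 s ^+ 2.

(** Inside []-r, r[] this is the polynomial [(r^2 - t^2)^2], which vanishes to second order at both
    ends: just enough for the extension by 0 to be C^1 with Lipschitz derivative. *)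
Definition bump1 (r t : R) := pos_sq (r ^+ 2 - t ^+ 2).

Definition dbump1 (r t : R) := - (4 * t * Num.max 0 (r ^+ 2 - t ^+ 2)).

Lemma bump1_ge0 r t : 0 <= bump1 r t.
Proof. exact: sqr_ge0. Qed.

Lemma bump1_eq0 r t : 0 <= r -> r <= `|t| -> bump1 r t = 0 /\ dbump1 r t = 0.
Proof.
move=> r0 rt; have H : r ^+ 2 - t ^+ 2 <= 0.
  by rewrite subr_le0 -[leRHS]real_normK ?num_real// lerXn2r ?nnegrE.
by rewrite /bump1 /dbump1 /pos_sq max_l// expr0n mulr0 oppr0.
Qed.

Lemma bump1N r t : bump1 r (- t) = bump1 r t.
Proof. by rewrite /bump1 sqrrN. Qed.

Lemma bump1_pos r t : 0 < r -> `|t| < r -> 0 < bump1 r t.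
Proof.
move=> r0 tr; have H : 0 < r ^+ 2 - t ^+ 2.
  by rewrite subr_gt0 -[ltLHS]real_normK ?num_real// ltrXn2r ?nnegrE.
by rewrite /bump1 /pos_sq max_r ?ltW// exprn_gt0.
Qed.

(** When [|t| < r], the factorization [(r - |t|) (r + |t|)] is at most [2 r (|u| - |t|)]. This
    linear bound treats increments that cross an endpoint of the support. *)
Lemma pos_part_outside (r t u : R) : 0 <= r -> r <= `|u| ->
  Num.max 0 (r ^+ 2 - t ^+ 2) <= 2 * r * `|u - t|.
Proof.
move=> r0 ru; have [tr|tr] := leP r `|t|.
  rewrite max_l ?mulr_ge0// subr_le0 -[leRHS]real_normK ?num_real//.
  by rewrite lerXn2r ?nnegrE.
have H : `|u| - `|t| <= `|u - t| by exact: lerB_dist.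
rewrite ge_max !mulr_ge0//= -[in leLHS](real_normK (num_real t)).
have := normr_ge0 t; move: (`|t|) (`|u|) (`|u - t|) tr ru H => a b c *; nra.
Qed.

(** For two points inside the interval the increments are polynomial identities. Otherwise the bump
    and its derivative vanish at one of the points, and [pos_part_outside] bounds the values at the
    other. *)
Lemma bump1_bounds r : 0 < r -> exists2 C : R, 0 <= C &
  [/\ forall t, `|bump1 r t| <= C, forall t, `|dbump1 r t| <= C,
      forall t h, `|dbump1 r (t + h) - dbump1 r t| <= C * `|h| &
      forall t h, `|bump1 r (t + h) - bump1 r t - h * dbump1 r t| <= C * `|h| ^+ 2].
Proof.
move=> r0; have rr := ltW r0.
pose m (t : R) := Num.max 0 (r ^+ 2 - t ^+ 2).
have m0 t : 0 <= m t by rewrite /m le_max lexx.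
have mr t : m t <= r ^+ 2 by rewrite /m ge_max sqr_ge0 /= gerBl sqr_ge0.
have mo t u : r <= `|u| -> m t <= 2 * r * `|u - t| by exact: pos_part_outside.
have mE t : `|t| <= r -> m t = r ^+ 2 - t ^+ 2.
  move=> tr; rewrite /m max_r// subr_ge0 -[leLHS]real_normK ?num_real//.
  by rewrite lerXn2r ?nnegrE.
have dE t : dbump1 r t = - (4 * t * m t) by [].
have bE t : bump1 r t = m t ^+ 2 by [].
have r4 : 0 <= r ^+ 4 by exact: exprn_ge0.
have r3 : 0 <= r ^+ 3 by exact: exprn_ge0.
have r2 : 0 <= r ^+ 2 by exact: exprn_ge0.
(* The three terms serve in turn the bound on [bump1], the bound on [dbump1], and the two increment
   estimates. *)
exists (r ^+ 4 + 4 * r ^+ 3 + 16 * r ^+ 2); first by rewrite !addr_ge0// mulr_ge0.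
split.
- move=> t; rewrite bE ger0_norm ?sqr_ge0//.
  apply: (@le_trans _ _ (r ^+ 4)); last lra.
  by rewrite -[4%N]/(2 * 2)%N exprM lerXn2r ?nnegrE.
- move=> t; have [tr|tr] := leP r `|t|.
    by rewrite (bump1_eq0 rr tr).2 normr0; lra.
  rewrite dE normrN !normrM [`|4|]ger0_norm// [`|m t|]ger0_norm//.
  apply: (@le_trans _ _ (4 * r * r ^+ 2)); last by lra.
  by apply: ler_pM; rewrite ?mulr_ge0// ler_wpM2l// ltW.
- move=> t h.
  have [ur|ur] := leP r `|t + h|.
    rewrite (bump1_eq0 rr ur).2 sub0r normrN.
    have [tr|tr] := leP r `|t|.
      by rewrite (bump1_eq0 rr tr).2 normr0 mulr_ge0//; lra.
    rewrite dE normrN !normrM [`|4|]ger0_norm// [`|m t|]ger0_norm//.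
    have := mo t _ ur; rewrite [t + h]addrC addrK => H.
    apply: (@le_trans _ _ (4 * r * (2 * r * `|h|))).
      by apply: ler_pM; rewrite ?mulr_ge0// ler_wpM2l// ltW.
    have -> : 4 * r * (2 * r * `|h|) = 8 * r ^+ 2 * `|h| by ring.
    by apply: ler_wpM2r => //; lra.
  have [tr|tr] := leP r `|t|.
    rewrite (bump1_eq0 rr tr).2 subr0.
    rewrite dE normrN !normrM [`|4|]ger0_norm// [`|m _|]ger0_norm//.
    have := mo (t + h) _ tr; rewrite opprD addNKr normrN => H.
    apply: (@le_trans _ _ (4 * r * (2 * r * `|h|))).
      by apply: ler_pM; rewrite ?mulr_ge0// ler_wpM2l// ltW.
    have -> : 4 * r * (2 * r * `|h|) = 8 * r ^+ 2 * `|h| by ring.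
    by apply: ler_wpM2r => //; lra.
  rewrite !dE (mE _ (ltW ur)) (mE _ (ltW tr)).
  have -> : - (4 * (t + h) * (r ^+ 2 - (t + h) ^+ 2)) - - (4 * t * (r ^+ 2 - t ^+ 2))
    = (4 * ((t + h) ^+ 2 + (t + h) * t + t ^+ 2 - r ^+ 2)) * h by ring.
  rewrite normrM; apply: ler_wpM2r => //.
  move: ur tr; rewrite !ltr_norml => /andP[u1 u2] /andP[t1 t2].
  apply: (@le_trans _ _ (16 * r ^+ 2)); last by lra.
  by rewrite ler_norml; apply/andP; split; nra.
- move=> t h.
  have [ur|ur] := leP r `|t + h|.
    rewrite (bump1_eq0 rr ur).1.
    have [tr|tr] := leP r `|t|.
      rewrite (bump1_eq0 rr tr).1 (bump1_eq0 rr tr).2 mulr0 !subr0 normr0.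
      by rewrite mulr_ge0 ?exprn_ge0//; lra.
    have := mo t _ ur; rewrite [t + h]addrC addrK => H.
    rewrite bE dE sub0r -opprD normrN.
    apply: le_trans (ler_normD _ _) _.
    rewrite mulrN normrN !normrM [`|4|]ger0_norm// [`|m _|]ger0_norm//.
    apply: (@le_trans _ _ (12 * r ^+ 2 * `|h| ^+ 2)); last first.
      by apply: ler_wpM2r; [exact: exprn_ge0|lra].
    have := m0 t; have := normr_ge0 t; have := normr_ge0 h.
    move: (m t) (`|t|) (`|h|) tr H => a b c tr H c0 b0 a0.
    have H1 : a ^+ 2 <= (2 * r * c) ^+ 2 by rewrite lerXn2r ?nnegrE// !mulr_ge0.
    have H2 : b * a <= r * (2 * r * c) by apply: ler_pM => //; exact: ltW.
    have H3 : c * (b * a) <= c * (r * (2 * r * c)) by exact: ler_wpM2l.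
    lra.
  have [tr|tr] := leP r `|t|.
    rewrite (bump1_eq0 rr tr).1 (bump1_eq0 rr tr).2 mulr0 !subr0 bE.
    have := mo (t + h) _ tr; rewrite opprD addNKr normrN => H.
    rewrite ger0_norm ?sqr_ge0//.
    apply: (@le_trans _ _ ((2 * r * `|h|) ^+ 2)).
      by rewrite lerXn2r ?nnegrE// !mulr_ge0.
    rewrite exprMn; apply: ler_wpM2r; first exact: exprn_ge0.
    lra.
  rewrite !bE dE (mE _ (ltW ur)) (mE _ (ltW tr)).
  have -> : (r ^+ 2 - (t + h) ^+ 2) ^+ 2 - (r ^+ 2 - t ^+ 2) ^+ 2 -
      h * - (4 * t * (r ^+ 2 - t ^+ 2)) =
    ((t + h) ^+ 2 + 2 * (t + h) * t + 3 * t ^+ 2 - 2 * r ^+ 2) * h ^+ 2 by ring.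
  rewrite normrM normrX; apply: ler_wpM2r; first exact: exprn_ge0.
  move: ur tr; rewrite !ltr_norml => /andP[u1 u2] /andP[t1 t2].
  apply: (@le_trans _ _ (16 * r ^+ 2)); last by lra.
  by rewrite ler_norml; apply/andP; split; nra.
Qed.

End bump.

Section product_bump.
Variables (R : realType) (n : nat).

Lemma C11_bump1 (r : R) (i : 'I_n) : 0 < r ->
  C11 (fun x : 'rV[R]_n => bump1 r (x ord0 i))
      (fun j x => (j == i)%:R * dbump1 r (x ord0 i)).
Proof.
move=> /bump1_bounds[C C0 [b1 b2 b3 b4]]; exists C => //; split => //.
- move=> j x; case: eqP => _; first by rewrite mul1r.
  by rewrite mul0r normr0.
- move=> j x h; case: eqP => _; last first.
    by rewrite !mul0r subrr normr0 mulr_ge0.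
  rewrite !mul1r mxE; apply: le_trans (b3 _ _) _.
  by apply: ler_wpM2l => //; exact: coord_norm_le.
- move=> x h; rewrite (bigD1 i)//= big1 => [|j /negbTE ->]; last by rewrite mul0r mulr0.
  rewrite eqxx mul1r addr0 mxE; apply: le_trans (b4 _ _) _.
  apply: ler_wpM2l => //; rewrite lerXn2r ?nnegrE//; exact: coord_norm_le.
Qed.

(** A product of one-dimensional bumps fits the sup norm, which is not differentiable: for [r > 0]
    it is positive exactly on the ball of radius [r] about 0. *)
Definition cube_bump (r : R) (x : 'rV[R]_n) := \prod_i bump1 r (x ord0 i).

Lemma C11_bump r : 0 < r -> exists g, C11 (cube_bump r) g.
Proof.
move=> r0; rewrite /cube_bump; elim: (index_enum _) => [|i s [g IH]].
  exists (fun _ _ => 0).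
  by have -> : (fun x : 'rV[R]_n => \prod_(i <- [::]) bump1 r (x ord0 i)) = (fun=> 1);
    [apply/funext => x; rewrite big_nil|exact: C11_cst].
eexists; have -> : (fun x : 'rV[R]_n => \prod_(i <- i :: s) bump1 r (x ord0 i)) =
    (fun x => bump1 r (x ord0 i) * \prod_(i <- s) bump1 r (x ord0 i)).
  by apply/funext => x; rewrite big_cons.
exact: (C11M (C11_bump1 i r0) IH).
Qed.

Lemma bump_ge0 r x : 0 <= cube_bump r x.
Proof. by apply: prodr_ge0 => i _; exact: bump1_ge0. Qed.

Lemma bumpN r x : cube_bump r (- x) = cube_bump r x.
Proof. by apply: eq_bigr => i _; rewrite mxE bump1N. Qed.

Lemma bump_eq0 r x : 0 < r -> r <= `|x| -> cube_bump r x = 0.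
Proof.
move=> r0 rx.
have [i ri] : exists i, r <= `|x ord0 i|.
  apply: contrapT => /forallNP H.
  suff : `|x| < r by rewrite ltNge rx.
  by apply: norm_lt_coord => // i; rewrite ltNge; apply/negP; exact: H.
by rewrite /cube_bump (bigD1 i)//= (bump1_eq0 (ltW r0) ri).1 mul0r.
Qed.

Lemma bump_gt0 r x : 0 < r -> `|x| < r -> 0 < cube_bump r x.
Proof.
move=> r0 xr; apply: prodr_gt0 => i _; apply: bump1_pos => //.
exact: le_lt_trans (coord_norm_le _ _) xr.
Qed.

End product_bump.

(** * Continuity of translations and mollification *)

Section translation_continuity.
Variables (R : realType) (n : nat).
Local Notation mu := (lebesgue_rV R n).
Implicit Types (u v : 'rV[R]_n -> R) (O A : set 'rV[R]_n).

Import HBSimple.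

Lemma integrable_indic_lty A : measurable A -> (mu A < +oo)%E ->
  mu.-integrable setT (fun x => (\1_A x)%:E).
Proof.
move=> mA Afin; apply/integrableP; split.
  by apply/measurable_EFinP; exact: measurable_indic.
under eq_integral do rewrite gee0_abs ?lee_fin//.
by rewrite integral_indic// setIT.
Qed.

Definition translation_continuous u := forall e : R, 0 < e ->
  exists2 d : R, 0 < d & forall z, `|z| < d ->
    (\int[mu]_x `|u (z + x)%R - u x|%:E <= e%:E)%E.

Lemma measurable_shift u z : measurable_fun [set: 'rV[R]_n] u ->
  measurable_fun [set: 'rV[R]_n] (fun x => u (z + x)).
Proof. by move=> mu_; exact: (measurableT_comp mu_ (measurable_rV_shift z)). Qed.

Lemma measurable_normB u v : measurable_fun [set: 'rV[R]_n] u ->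
  measurable_fun [set: 'rV[R]_n] v ->
  measurable_fun [set: 'rV[R]_n] (fun x => `|u x - v x|).
Proof. by move=> mu_ mv; apply: measurableT_comp => //; exact: measurable_funB. Qed.

Lemma ge0_integral_rV_shiftR (z : 'rV[R]_n) u :
  measurable_fun [set: 'rV[R]_n] u -> (forall x, 0 <= u x) ->
  (\int[mu]_x (u (z + x)%R)%:E = \int[mu]_x (u x)%:E)%E.
Proof.
move=> mu_ u0; apply: (ge0_integral_rV_shift z (f := EFin \o u)).
  exact/measurable_EFinP.
by move=> x; rewrite lee_fin.
Qed.

(** The usual three-term argument; the error at the translated point has the same integral as the
    error itself by translation invariance. *)
Lemma translation_continuous_approx u : measurable_fun [set: 'rV[R]_n] u ->
  (forall e, 0 < e -> exists v, [/\ measurable_fun [set: 'rV[R]_n] v,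
    translation_continuous v & (\int[mu]_x `|u x - v x|%:E <= e%:E)%E]) ->
  translation_continuous u.
Proof.
move=> mu_ H e e0; have e3 : 0 < e / 3 by lra.
have [v [mv tv uv]] := H _ e3; have [d d0 dv] := tv _ e3.
exists d => // z zd.
have m1 := measurable_shift z mu_; have m2 := measurable_shift z mv.
apply: (@le_trans _ _ (\int[mu]_x `|u (z + x)%R - v (z + x)%R|%:E +
   \int[mu]_x (`|v (z + x)%R - v x| + `|u x - v x|)%:E)%E).
  apply: integral_leD => //.
  - exact: measurable_normB.
  - by apply: measurable_funD; exact: measurable_normB.
  - exact: measurable_normB.
  - move=> x _; rewrite [`|u x - v x|]distrC.
    have -> : u (z + x) - u x = (u (z + x) - v (z + x)) +
      ((v (z + x) - v x) + (v x - u x)) by ring.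
    apply: le_trans (ler_normD _ _) _; rewrite lerD2l; exact: ler_normD.
have -> : e = e / 3 + (e / 3 + e / 3) by field.
rewrite EFinD; apply: leeD.
  rewrite (ge0_integral_rV_shiftR z (u := fun x => `|u x - v x|))//.
  exact: measurable_normB.
rewrite EFinD; apply: le_trans (leeD (dv z zd) uv).
apply: integral_leD => //.
- exact: measurable_normB.
- exact: measurable_normB.
- by apply: measurable_funD; exact: measurable_normB.
Qed.

Lemma translation_continuousD u v : measurable_fun [set: 'rV[R]_n] u ->
  measurable_fun [set: 'rV[R]_n] v ->
  translation_continuous u -> translation_continuous v ->
  translation_continuous (fun x => u x + v x).
Proof.
move=> mu_ mv tu tv e e0; have e2 : 0 < e / 2 by lra.
have [d d0 du] := tu _ e2; have [d' d'0 dv] := tv _ e2.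
exists (Num.min d d') => [|z]; first by rewrite lt_min d0.
rewrite lt_min => /andP[zd zd'].
have m1 := measurable_shift z mu_; have m2 := measurable_shift z mv.
have -> : e = e / 2 + e / 2 by field.
rewrite EFinD; apply: le_trans (leeD (du z zd) (dv z zd')).
apply: integral_leD => //.
- exact: measurable_normB.
- exact: measurable_normB.
- by apply: measurable_normB; exact: measurable_funD.
- move=> x _.
  have -> : u (z + x) + v (z + x) - (u x + v x) =
    (u (z + x) - u x) + (v (z + x) - v x) by ring.
  exact: ler_normD.
Qed.

Lemma translation_continuousZ (c : R) u : measurable_fun [set: 'rV[R]_n] u ->
  translation_continuous u -> translation_continuous (fun x => c * u x).
Proof.
move=> mu_ tu e e0; have c1 : 0 < `|c| + 1 by rewrite ltr_wpDl.
have [d d0 du] := tu _ (divr_gt0 e0 c1); exists d => // z zd.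
have m1 := measurable_shift z mu_.
have -> : e = (`|c| + 1) * (e / (`|c| + 1)) by field; rewrite gt_eqF.
apply: (@le_trans _ _ ((`|c| + 1)%:E * \int[mu]_x `|u (z + x)%R - u x|%:E)%E).
  apply: integral_leZ => //.
  - by apply: measurable_normB; apply: measurable_funM => //; exact: measurable_cst.
  - exact: measurable_normB.
  - by move=> x _; rewrite -mulrBr normrM ler_wpM2r// lerDl.
by rewrite EFinM lee_wpmul2l ?lee_fin ?(ltW c1)// du.
Qed.

(* The indicator of an open set is lower semicontinuous, so 1_O (1 - 1_O(z + .))
   tends to 0 pointwise; its integral is half of the L^1 distance. *)
Lemma translation_continuous_open O : open O -> (mu O < +oo)%E ->
  translation_continuous \1_O.
Proof.
move=> oO Ofin e e0; have mO := open_rV_measurable oO.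
apply: contrapT => H.
(* Radii [1 / (k + 1)] turn the failure of continuity into a sequence of translations tending to 0,
   to which dominated convergence applies. *)
have {}H k : exists z : 'rV[R]_n, `|z| < k.+1%:R^-1 /\
    ~ (\int[mu]_x `|\1_O (z + x)%R - \1_O x : R|%:E <= e%:E)%E.
  apply: contrapT => Hk; apply: H; exists k.+1%:R^-1; first by rewrite invr_gt0.
  by move=> z zk; apply: contrapT => Hz; apply: Hk; exists z.
have [z zP] := choice H.
pose f k x : R := \1_O x * (1 - \1_O (z k + x)).
have m1 : measurable_fun [set: 'rV[R]_n] (\1_O : _ -> R) by exact: measurable_indic.
have m2 k := measurable_shift (z k) m1.
have mf k : measurable_fun [set: 'rV[R]_n] (f k).
  apply: measurable_funM => //; apply: measurable_funB => //.
have i01 x : 0 <= (\1_O x : R) <= 1 by rewrite indicE; case: (x \in O); rewrite ?lexx ?ler01.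
have f0 k x : [set: 'rV[R]_n] x -> 0 <= f k x.
  by move=> _; rewrite /f; have := i01 x; have := i01 (z k + x); nra.
have Hf : (fun k => \int[mu]_x (f k x)%:E)%E @ \oo --> 0%E.
  apply: (@dominated_integral0 _ _ _ mu setT measurableT f (fun x => (\1_O x)%:E)) => //.
  - exact: integrable_indic_lty.
  - apply: aeW => x _ k; rewrite lee_fin /f.
    by have := i01 x; have := i01 (z k + x); nra.
  - apply: aeW => x _; have [xO|xO] := pselect (O x); last first.
      rewrite (_ : (fun k => f k x) = cst 0); first exact: cvg_cst.
      by apply/funext => k; rewrite /f indicE memNset// mul0r.
    have /nbhs_ballP[r /= r0 rO] := open_nbhs_nbhs (conj oO xO).
    apply: cvg_near_cst.
    have : \forall k \near \oo, k.+1%:R^-1 < r.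
      have := @near_infty_natSinv_lt R (PosNum r0); exact.
    apply: filterS => k kr; rewrite /f [\1_O (z k + x)]indicE mem_set ?subrr ?mulr0//.
    apply: rO; rewrite -ball_normE /= opprD addrCA subrr addr0 normrN.
    exact: lt_trans (zP k).1 kr.
have e2 : 0 < e / 2 by lra.
have [k /= _] : exists2 k, True & (\int[mu]_x (f k x)%:E < (e / 2)%:E)%E.
  have [N _ HN] := cvge0_lt Hf e2; exists N => //; exact: HN (leqnn N).
move=> fk; case: (zP k) => _; apply.
(* Pointwise [|a - b| + b = a + 2 b (1 - a)] for [a] and [b] in {0, 1}. The integrals of [\1_O] and
   of its translate are equal and finite, so they cancel. *)
have E : (\int[mu]_x `|\1_O (z k + x)%R - \1_O x : R|%:E + \int[mu]_x (\1_O x)%:E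
   = \int[mu]_x (\1_O (z k + x)%R)%:E + 2%:E * \int[mu]_x (f k x)%:E)%E.
  rewrite -ge0_integralZl//; last 2 first.
  - exact/measurable_EFinP.
  - by move=> x _; rewrite lee_fin f0.
  rewrite -!ge0_integralD//; last 5 first.
  - exact/measurable_EFinP.
  - by move=> x _; rewrite mule_ge0// lee_fin f0.
  - by apply/measurable_EFinP; apply: measurable_funM => //; exact: measurable_cst.
  - by apply/measurable_EFinP; exact: measurable_normB.
  - exact/measurable_EFinP.
  apply: eq_integral => x _; rewrite -EFinM -!EFinD; congr EFin.
  rewrite /f !indicE; case: (x \in O); case: (_ \in O) => /=;
    rewrite ?subrr ?subr0 ?sub0r ?normr0 ?normrN ?normr1; ring.
move: E; rewrite (ge0_integral_rV_shiftR (z k) (u := \1_O))//.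
rewrite integral_indic// setIT addeC.
have Ofin' : mu O \is a fin_num by rewrite ge0_fin_numE.
move=> /(congr1 (fun t => t - mu O)%E).
rewrite ![(mu O + _)%E]addeC !addeK// => ->.
have -> : e = 2 * (e / 2) by field.
by rewrite EFinM lee_wpmul2l// ltW.
Qed.

(** Each coordinate is continuous, so the sigma-algebra of the coordinates is contained in the one
    generated by the open sets. This lets a monotone class argument start from open sets. *)
Lemma measurable_rV_open_generated A : measurable A ->
  <<s [set O : set 'rV[R]_n | open O] >> A.
Proof.
pose G := [set O : set 'rV[R]_n | open O].
have /= H : measurable_fun [set: g_sigma_algebraType G] (idfun : g_sigma_algebraType G -> 'rV[R]_n).
  apply: measurable_fun_rVP => i.
  apply: (measurability _ (RGenOpens.measurableE R)) => //.
  move=> _ [_ [a [b ->]] <-]; rewrite setTI; apply: sub_sigma_algebra => /=.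
  have /continuousP := @coord_continuous R 1 n ord0 i; apply.
  exact: interval_open.
by move=> mA; have := H measurableT A mA; rewrite setTI preimage_id.
Qed.

(** Open sets are stable under intersection, and the sets [X] for which [\1_(X]&[B)] is translation
    continuous form a lambda-system. Intersecting with the fixed ball keeps all measures finite, so
    that increasing unions converge in L^1. *)
Lemma translation_continuous_indic A (M : R) : 0 < M -> measurable A ->
  translation_continuous \1_(A `&` ball 0 M).
Proof.
move=> M0 mA; set B := ball _ _.
have mB : measurable B by exact: measurable_rV_ball.
have oB : open B by exact: ball_open.
have muB : (mu B < +oo)%E by rewrite lebesgue_rV_ball// ltry.
move: (B : set 'rV[R]_n) mB oB muB => {}B mB oB muB.
have Bfin X : measurable X -> (mu (X `&` B) < +oo)%E.
  move=> mX; apply: (@le_lt_trans _ _ (mu B)).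
    by apply: le_measure => //; rewrite inE//; exact: measurableI.
  by [].
pose H := [set X | measurable X /\ translation_continuous \1_(X `&` B)].
suff : <<s [set O : set 'rV[R]_n | open O] >> `<=` H.
  by move=> /(_ A (measurable_rV_open_generated mA))[].
have mI X : measurable X -> measurable_fun [set: 'rV[R]_n] (\1_(X `&` B) : _ -> R).
  by move=> mX; apply: measurable_indic; exact: measurableI.
apply: lambda_system_subset => //.
- by move=> X Y /= oX oY; exact: openI.
- split => //.
  + split => //; rewrite setTI; exact: translation_continuous_open.
  + move=> X Y YX [mX tX] [mY tY]; split; first exact: measurableD.
    rewrite (_ : \1_ _ = (fun x => \1_(X `&` B) x + (-1) * \1_(Y `&` B) x) :> (_ -> R)).
      apply: translation_continuousD; [exact: mI| | |exact: translation_continuousZ (mI _ mY) tY].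
        by apply: measurable_funM; [exact: measurable_cst|exact: mI].
      by [].
    apply/funext => x; rewrite !indicE setDE !in_setI in_setC.
    have [xY|xY] := boolP (x \in Y); last by rewrite andbT andFb mulr0 addr0.
    rewrite (mem_set (YX _ (set_mem xY))) /=; case: (x \in B) => /=; ring.
  + move=> F ndF HF; have mF : measurable (\bigcup_i F i).
      by apply: bigcupT_measurable => i; case: (HF i).
    split => //; apply: translation_continuous_approx; first exact: mI.
    move=> e e0.
    have Hc : (fun k => \int[mu]_x `|\1_(\bigcup_i F i `&` B) x - \1_(F k `&` B) x : R|%:E)%E
        @ \oo --> 0%E.
      apply: (@dominated_integral0 _ _ _ mu setT measurableT _ (fun x => (\1_B x)%:E)) => //.
      - move=> k; apply: measurable_normB; apply: mI => //; by case: (HF k).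
      - exact: integrable_indic_lty.
      - apply: aeW => x _ k; rewrite lee_fin !indicE !in_setI.
        by case: (x \in B); case: (x \in F k); case: (x \in \bigcup_i _);
          rewrite /= ?subrr ?subr0 ?sub0r ?normrN ?normr0 ?normr1 ?lexx ?ler01.
      - apply: aeW => x _; apply: cvg_near_cst.
        have [[i _ Fix]|xF] := pselect ((\bigcup_i F i) x).
          exists i => //= k ik; rewrite !indicE !in_setI.
          have -> : x \in F k by apply: mem_set; have /subsetPset := ndF _ _ ik; exact.
          have -> : x \in \bigcup_i F i by apply: mem_set; exists i.
          by rewrite subrr normr0.
        apply: nearW => k; rewrite !indicE !in_setI (memNset xF) [x \in F k]memNset.
          by rewrite /= subrr normr0.
        by move=> Fkx; apply: xF; exists k.
    have [N _ HN] := cvge0_lt Hc e0.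
    exists (\1_(F N `&` B)); split; first by apply: mI; case: (HF N).
      by case: (HF N).
    by apply/ltW; exact: HN (leqnn N).
- move=> O oO; split; first exact: open_rV_measurable.
  apply: translation_continuous_open; last by apply: Bfin; exact: open_rV_measurable.
  exact: openI.
Qed.

(** [u] is cut off to a large ball and approximated there by a simple function, which is a finite
    combination of the indicators already treated. *)
Lemma translation_continuous_integrable u :
  mu.-integrable setT (EFin \o u) -> translation_continuous u.
Proof.
move=> iu; have mu_ : measurable_fun [set: 'rV[R]_n] u.
  by apply/measurable_EFinP; exact: measurable_int iu.
apply: translation_continuous_approx => // e e0.
have e2 : 0 < e / 2 by lra.
have mB (k : nat) : measurable (ball (0 : 'rV[R]_n) k.+1%:R) by exact: measurable_rV_ball.
have muB k : measurable_fun [set: 'rV[R]_n] (fun x => u x * \1_(ball 0 k.+1%:R) x).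
  by apply: measurable_funM => //; exact: measurable_indic.
have Hc : (fun k => \int[mu]_x `|u x - u x * \1_(ball 0 k.+1%:R) x|%:E)%E @ \oo --> 0%E.
  apply: (@dominated_integral0 _ _ _ mu setT measurableT _ (fun x => `|u x|%:E)) => //.
  - by move=> k; exact: measurable_normB.
  - exact: (integrable_norm iu).
  - apply: aeW => x _ k; rewrite lee_fin indicE; case: (x \in _).
      by rewrite mulr1 subrr normr0.
    by rewrite mulr0 subr0.
  - apply: aeW => x _; apply: cvg_near_cst.
    exists (Num.bound `|x|) => // k /= xk.
    rewrite indicE mem_set ?mulr1 ?subrr ?normr0//.
    rewrite -ball_normE /= sub0r normrN.
    apply: lt_le_trans (archi_boundP (normr_ge0 _)) _.
    by rewrite ler_nat leqW.
have [N _ /(_ N (leqnn N)) /= HN] := cvge0_lt Hc e2.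
have [B [mBN tB {}HN]] : exists B : set 'rV[R]_n, [/\ measurable B,
    forall A, measurable A -> translation_continuous \1_(A `&` B) &
    (\int[mu]_x `|u x - u x * \1_B x|%:E < (e / 2)%:E)%E].
  exists (ball 0 N.+1%:R); split => // A mA.
  exact: translation_continuous_indic.
have [g [ig _ gu]] := @approximation_sfun_integrable _ _ _ mu B mBN (EFin \o u)
  (integrableS measurableT mBN (@subsetT _ _) iu).
have [K _ /(_ K (leqnn K)) /= HK] := cvge0_lt gu e2.
exists (fun x => g K x * \1_B x); split.
- by apply: measurable_funM => //; exact: measurable_indic.
- have [s sE] : exists s : seq R, forall x, g K x =
      \sum_(r <- s) r * \1_(g K @^-1` [set r]) x.
    by eexists => x; rewrite {1}(fimfunE (g K) x) fsbig_finite.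
  have -> : (fun x => g K x * \1_B x) = (fun x =>
    \sum_(r <- s) r * \1_((g K @^-1` [set r]) `&` B) x).
    apply/funext => x; rewrite sE mulr_suml.
    by apply: eq_bigr => r _; rewrite -mulrA !indicE in_setI -natrM mulnb.
  elim: s {sE} => [|r s IH].
    under eq_fun do rewrite big_nil.
    move=> e' e'0; exists 1 => // z _; under eq_integral do rewrite subrr normr0.
    by rewrite integral0 lee_fin ltW.
  under eq_fun do rewrite big_cons.
  have mr r' : measurable_fun [set: 'rV[R]_n]
      (fun x => r' * \1_((g K @^-1` [set r']) `&` B) x).
    apply: measurable_funM; first exact: measurable_cst.
    by apply: measurable_indic; exact: measurableI.
  apply: translation_continuousD => //.
  + apply: measurable_sum => //.
  + apply: translation_continuousZ.
      by apply: measurable_indic; exact: measurableI.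
    exact: tB.
- apply: (@le_trans _ _ ((e / 2)%:E + (e / 2)%:E)%E); last by rewrite -EFinD -splitr.
  apply: le_trans (leeD (ltW HN) (ltW HK)).
  rewrite [X in (_ + X)%E]integral_mkcond.
  have E : forall x, (((fun z => `|(u z)%:E - (g K z)%:E|) \_ B) x =
      (`|u x * \1_B x - g K x * \1_B x|)%:E)%E.
    move=> x; rewrite patchE indicE; case: (x \in B).
      by rewrite !mulr1.
    by rewrite !mulr0 subrr normr0.
  under [X in (_ <= _ + X)%E]eq_integral do rewrite E.
  have mg : measurable_fun [set: 'rV[R]_n] (fun x => g K x * \1_B x).
    by apply: measurable_funM => //; exact: measurable_indic.
  have mub : measurable_fun [set: 'rV[R]_n] (fun x => u x * \1_B x).
    by apply: measurable_funM => //; exact: measurable_indic.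
  apply: integral_leD => //; try exact: measurable_normB.
  by move=> x _; exact: ler_distD.
Qed.

End translation_continuity.

(** * Continuity of translations in L^q *)

Section translation_continuity_Lq.
Variables (R : realType) (n : nat).
Local Notation mu := (lebesgue_rV R n).
Implicit Types (u v : 'rV[R]_n -> R).

Lemma measurable_powR_norm u q : measurable_fun [set: 'rV[R]_n] u ->
  measurable_fun [set: 'rV[R]_n] (fun x => `|u x| `^ q).
Proof.
by move=> mu_; apply: measurable_powR2 => //; exact: measurableT_comp.
Qed.

(** The truncation [w M] keeps [u] where both [|u|] and [|x|] are at most about [M]. It is bounded
    and integrable, so its L^q increments are controlled by its L^1 increments through
    [powR_le_lin]; the part cut off is small in L^q. *)
Lemma translation_continuous_Lq u q : 1 <= q ->
  measurable_fun [set: 'rV[R]_n] u ->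
  (\int[mu]_x (`|u x| `^ q)%:E < +oo)%E ->
  forall e : R, 0 < e -> exists2 d : R, 0 < d & forall z, `|z| < d ->
    (\int[mu]_x (`|u (z + x)%R - u x| `^ q)%:E <= e%:E)%E.
Proof.
move=> q1 mu_ uq e e0; have q0 : 0 < q by lra.
pose T (M : nat) := [set x : 'rV[R]_n | `|u x| <= M.+1%:R] `&` ball (0 : 'rV[R]_n) M.+1%:R.
have mT M : measurable (T M).
  apply: measurableI; last exact: measurable_rV_ball.
  rewrite -[X in measurable X]setTI.
  have : measurable_fun [set: 'rV[R]_n] (fun x => `|u x|) by exact: measurableT_comp.
  move=> /(_ measurableT `]-oo, M.+1%:R]%classic); rewrite (_ : _ @^-1` _ = [set x | `|u x| <= M.+1%:R]).
    by apply; exact: measurable_itv.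
  by apply/seteqP; split => x /=; rewrite in_itv.
have mTf M : (mu (T M) < +oo)%E.
  apply: (@le_lt_trans _ _ (mu (ball (0 : 'rV[R]_n) M.+1%:R))).
    by apply: le_measure; rewrite ?inE//; [exact: measurable_rV_ball|exact: subIsetr].
  by rewrite lebesgue_rV_ball// ltry.
pose w M x := u x * \1_(T M) x.
have mw M : measurable_fun [set: 'rV[R]_n] (w M).
  by apply: measurable_funM => //; exact: measurable_indic.
have w_le M x : `|w M x| <= M.+1%:R * \1_(T M) x.
  rewrite /w normrM indicE; case: (boolP (x \in T M)) => [/set_mem[uM _]|_].
    by rewrite normr1 !mulr1.
  by rewrite normr0 !mulr0.
have ind1 M x : \1_(T M) x <= 1 :> R by rewrite indicE; case: (_ \in _); rewrite ?ler01.
have iw M : mu.-integrable setT (EFin \o w M).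
  apply: (@le_integrable _ _ _ mu setT measurableT _ (fun x => (M.+1%:R%:E * (\1_(T M) x)%:E)%E)).
  - exact/measurable_EFinP.
  - move=> x _; rewrite -EFinM /= lee_fin.
    by apply: le_trans (w_le M x) _; exact: ler_norm.
  - by apply: integrableZl => //; exact: integrable_indic_lty.
have Hc : (fun M => \int[mu]_x (`|u x - w M x| `^ q)%:E)%E @ \oo --> 0%E.
  apply: (@dominated_integral0 _ _ _ mu setT measurableT _ (fun x => (`|u x| `^ q)%:E)) => //.
  - by move=> M; apply: measurable_powR_norm; exact: measurable_funB.
  - apply/integrableP; split.
      by apply/measurable_EFinP; exact: measurable_powR_norm.
    by under eq_integral do rewrite gee0_abs ?lee_fin ?powR_ge0//.
  - apply: aeW => x _ k; rewrite lee_fin; apply: ge0_ler_powR; rewrite ?nnegrE ?(ltW q0)//.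
    rewrite /w indicE; case: (x \in _); first by rewrite mulr1 subrr normr0.
    by rewrite mulr0 subr0.
  - apply: aeW => x _; apply: cvg_near_cst.
    exists (maxn (Num.bound `|x|) (Num.bound `|u x|)) => // k /=.
    rewrite geq_max => /andP[k1 k2].
    rewrite /w indicE mem_set ?mulr1 ?subrr ?normr0 ?powR0 ?gt_eqF//.
    split => /=.
      apply/ltW; apply: lt_le_trans (archi_boundP (normr_ge0 _)) _.
      by rewrite ler_nat leqW.
    rewrite -ball_normE /= sub0r normrN.
    apply: lt_le_trans (archi_boundP (normr_ge0 _)) _.
    by rewrite ler_nat leqW.
pose K := 2 `^ q : R.
have K0 : 0 < K by exact: powR_gt0.
(* Two uses of the quasi-triangle inequality with constant [K = 2^q] on three errors [e1] give
   [K (e1 + K (e1 + e1)) = e]. *)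
pose e1 := e / (K + 2 * K ^+ 2).
have e10 : 0 < e1 by rewrite divr_gt0// addr_gt0// mulr_gt0// exprn_gt0.
have [M _ /(_ M (leqnn M)) /= HM] := cvge0_lt Hc e10.
pose L := (2 * M.+1%:R) `^ (q - 1) : R.
have L0 : 0 < L by apply: powR_gt0; rewrite mulr_gt0.
have [d d0 Hd] := translation_continuous_integrable (iw M) (divr_gt0 e10 L0).
exists d => // z zd.
have m1 := measurable_shift z mu_; have m2 := measurable_shift z (mw M).
have I1 : (\int[mu]_x (`|w M (z + x)%R - w M x| `^ q)%:E <= e1%:E)%E.
  apply: (@le_trans _ _ (L%:E * \int[mu]_x `|w M (z + x)%R - w M x|%:E)%E).
    apply: integral_leZ => //.
    - exact: ltW.
    - by apply: measurable_powR_norm; exact: measurable_funB.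
    - exact: measurable_normB.
    - move=> x _; apply: powR_le_lin => //.
      apply: le_trans (ler_normB _ _) _; rewrite mulr_natl mulr2n.
      by apply: lerD; apply: le_trans (w_le M _) _; rewrite ler_piMr.
  have -> : e1 = L * (e1 / L) by field; rewrite gt_eqF.
  by rewrite EFinM lee_wpmul2l ?lee_fin ?(ltW L0)// Hd.
have I2 : (\int[mu]_x (`|u (z + x)%R - w M (z + x)%R| `^ q)%:E <= e1%:E)%E.
  have mq : measurable_fun [set: 'rV[R]_n] (fun x => `|u x - w M x| `^ q).
    by apply: measurable_powR_norm; exact: measurable_funB.
  have := ge0_integral_rV_shiftR z mq (fun x => powR_ge0 _ _) => ->; exact: ltW.
have I3 : (\int[mu]_x (`|w M x - u x| `^ q)%:E <= e1%:E)%E.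
  apply: le_trans (ltW HM); rewrite le_eqVlt; apply/orP; left; apply/eqP.
  by apply: eq_integral => x _; rewrite distrC.
have mA : measurable_fun [set: 'rV[R]_n] (fun x => u (z + x) - w M (z + x)).
  exact: measurable_funB.
have mB : measurable_fun [set: 'rV[R]_n] (fun x => w M (z + x) - w M x).
  exact: measurable_funB.
have mC : measurable_fun [set: 'rV[R]_n] (fun x => w M x - u x).
  exact: measurable_funB.
have E1 : (\int[mu]_x (`|u (z + x)%R - u x| `^ q)%:E =
    \int[mu]_x (`|(u (z + x)%R - w M (z + x)%R) +
      ((w M (z + x)%R - w M x) + (w M x - u x))| `^ q)%:E)%E.
  by apply: eq_integral => x _; congr ((`|_| `^ _)%:E); ring.
rewrite E1; apply: le_trans (integral_powR_normD mu measurableT (ltW q0) mA (measurable_funD mB mC)) _.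
have KK : (0 <= K%:E)%E by rewrite lee_fin ltW.
have Ke : K * (e1 + K * (e1 + e1)) = e.
  have K1 : K + 2 * K ^+ 2 != 0 by rewrite gt_eqF// addr_gt0// mulr_gt0// exprn_gt0.
  by rewrite /e1; field.
rewrite -Ke EFinM EFinD; apply: lee_wpmul2l; first exact: KK.
apply: leeD; first exact: I2.
apply: le_trans (integral_powR_normD mu measurableT (ltW q0) mB mC) _.
rewrite EFinM EFinD; apply: lee_wpmul2l; first exact: KK.
by apply: leeD; [exact: I1|exact: I3].
Qed.

End translation_continuity_Lq.

(** * Mollification *)

Section mollification.
Variables (R : realType) (n : nat).
Local Notation mu := (lebesgue_rV R n).
Implicit Types (U k : 'rV[R]_n -> R) (x y z h : 'rV[R]_n).

Lemma integrable_bounded_mul U k (C : R) : mu.-integrable setT (EFin \o U) ->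
  measurable_fun [set: 'rV[R]_n] k -> (forall x, `|k x| <= C) ->
  mu.-integrable setT (fun y => (U y * k y)%:E).
Proof.
move=> iU mk kC.
have mU : measurable_fun [set: 'rV[R]_n] U.
  by apply/measurable_EFinP; exact: measurable_int iU.
apply: (@le_integrable _ _ _ mu setT measurableT _ (fun x => (C%:E * (U x)%:E)%E)).
- by apply/measurable_EFinP; exact: measurable_funM.
- move=> x _; rewrite -EFinM /= lee_fin !normrM mulrC ler_wpM2r//.
  exact: le_trans (kC x) (ler_norm _).
- exact: integrableZl.
Qed.

Definition convolution U k x := (\int[mu]_y (U y * k (x - y)))%R.

Lemma measurable_reflect k x : measurable_fun [set: 'rV[R]_n] k ->
  measurable_fun [set: 'rV[R]_n] (fun y => k (x - y)).
Proof.
move=> mk; apply: (measurableT_comp mk).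
apply: measurable_fun_rVP => i.
rewrite [X in measurable_fun _ X](_ : _ = (fun y : 'rV[R]_n => x ord0 i - y ord0 i)).
  by apply: measurable_funB; [exact: measurable_cst|exact: measurable_coord].
by apply/funext => y; rewrite !mxE.
Qed.

(** The clauses of [C11] bound linear expressions in the kernel uniformly in the point, so
    multiplying by [U] and integrating only multiplies the constant by the L^1 norm [N] of [U]. *)
Lemma conv_C11 U k (g : 'I_n -> 'rV[R]_n -> R) :
  mu.-integrable setT (EFin \o U) -> C11 k g ->
  C11 (convolution U k) (fun i => convolution U (g i)).
Proof.
move=> iU kg; have mk := continuous_rV_measurable (C11_continuous kg).
have mg i := continuous_rV_measurable (C11_grad_continuous (i := i) kg).
case: (kg) => C C0 [kC gC gL kT].
have iUk x : mu.-integrable setT (fun y => (U y * k (x - y))%:E).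
  by apply: (integrable_bounded_mul (C := C)) => //; exact: measurable_reflect.
have iUg i x : mu.-integrable setT (fun y => (U y * g i (x - y))%:E).
  by apply: (integrable_bounded_mul (C := C)) => //; exact: measurable_reflect.
set N := (\int[mu]_y `|U y|)%R.
have N0 : 0 <= N by exact: Rintegral_ge0.
have iN : mu.-integrable setT (EFin \o (fun y => `|U y|)) by exact: integrable_norm.
have key (F : 'rV[R]_n -> R) (D : R) : 0 <= D ->
    mu.-integrable setT (fun y => (U y * F y)%:E) -> (forall y, `|F y| <= D) ->
    `|(\int[mu]_y (U y * F y))%R| <= N * D.
  move=> D0 iF FD; apply: le_trans (le_normr_Rintegral measurableT iF) _.
  rewrite /N -RintegralZr//; apply: le_Rintegral => //.
  - exact: (integrable_norm iF).
  - exact: integrable_scaler.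
  - by move=> y _; rewrite normrM ler_wpM2l.
exists (N * C); first by rewrite mulr_ge0.
split.
- by move=> x; apply: key.
- by move=> i x; apply: key.
- move=> i x h; rewrite /convolution -RintegralB//; last 2 first.
  + exact: iUg.
  + exact: iUg.
  under eq_Rintegral do rewrite -mulrBr.
  rewrite -mulrA; apply: key.
  + by rewrite mulr_ge0.
  + under eq_fun do rewrite mulrBr EFinB; exact: integrableB.
  + by move=> y; rewrite [x + h - y]addrAC.
- move=> x h.
  have -> : convolution U k (x + h) - convolution U k x - \sum_i h ord0 i * convolution U (g i) x =
     (\int[mu]_y (U y * (k (x + h - y) - k (x - y) - \sum_i h ord0 i * g i (x - y))))%R.
    rewrite /convolution -RintegralB//; last 2 first.
    + exact: iUk.
    + exact: iUk.
    have -> : \sum_i h ord0 i * (\int[mu]_y (U y * g i (x - y)))%R =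
       (\int[mu]_y \sum_i h ord0 i * (U y * g i (x - y)))%R.
      rewrite /Rintegral; under eq_integral do rewrite -sumEFin.
      rewrite integral_sum//; last first.
        by move=> i; under eq_fun do rewrite EFinM; exact: integrableZl.
      rewrite -sum_fine; last first.
        move=> i _; apply: integrable_fin_num => //.
        by under eq_fun do rewrite EFinM; exact: integrableZl.
      apply: eq_bigr => i _; under [in RHS]eq_integral do rewrite EFinM.
      rewrite integralZl// fineM//; exact: integrable_fin_num.
    rewrite -RintegralB//; last 2 first.
    + by apply: integrable_subr => //; exact: iUk.
    + by apply: integrable_sumr => // i; apply: integrable_scalel => //; exact: iUg.
    apply: eq_Rintegral => y _; rewrite !mulrBr mulr_sumr; congr (_ - _).
    by apply: eq_bigr => i _; rewrite mulrCA.
  rewrite -mulrA; apply: key.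
  + by rewrite mulr_ge0 ?exprn_ge0.
  + apply: (integrable_bounded_mul (C := C * `|h| ^+ 2)) => //.
      apply: measurable_funB.
        by apply: measurable_funB; exact: measurable_reflect.
      apply: measurable_sum => i; apply: measurable_funM; first exact: measurable_cst.
      exact: measurable_reflect.
    by move=> y; rewrite [x + h - y]addrAC.
  + by move=> y; rewrite [x + h - y]addrAC.
Qed.

Lemma bump_integrable (r : R) : 0 < r ->
  mu.-integrable setT (EFin \o @cube_bump R n r).
Proof.
move=> r0; have [g kg] := @C11_bump R n r r0.
have mk := continuous_rV_measurable (C11_continuous kg).
have [C C0 [kC _ _ _]] := kg.
apply: (@le_integrable _ _ _ mu setT measurableT _
    (fun x => (C%:E * (\1_(ball (0 : 'rV[R]_n) r) x)%:E)%E)).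
- exact/measurable_EFinP.
- move=> x _; rewrite -EFinM /= lee_fin indicE.
  have [xr|xr] := leP r `|x|.
    by rewrite bump_eq0// normr0.
  rewrite mem_set ?mulr1; last by rewrite -ball_normE /= sub0r normrN.
  exact: le_trans (kC x) (ler_norm _).
- apply: integrableZl => //; apply: integrable_indic_lty.
    exact: measurable_rV_ball.
  by rewrite lebesgue_rV_ball// ltry.
Qed.

(** A nonnegative function of integral 0 vanishes almost everywhere, whereas the bump is positive on
    a ball of positive measure. *)
Lemma bump_mass_gt0 (r : R) : 0 < r -> 0 < (\int[mu]_x @cube_bump R n r x)%R.
Proof.
move=> r0; have [g kg] := @C11_bump R n r r0.
have mk := continuous_rV_measurable (C11_continuous kg).
rewrite lt0r Rintegral_ge0 ?andbT; last by move=> x _; exact: bump_ge0.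
apply/negP => /eqP B0.
have : (\int[mu]_x `|(@cube_bump R n r x)%:E|)%E = 0%E.
  under eq_integral do rewrite gee0_abs ?lee_fin ?bump_ge0//.
  rewrite -[LHS]fineK; first by congr EFin.
  by apply: integrable_fin_num => //; exact: bump_integrable.
have mk' : measurable_fun [set: 'rV[R]_n] (fun x => (@cube_bump R n r x)%:E).
  exact/measurable_EFinP.
move/(ae_eq_integral_abs mu measurableT mk') => [N [mN N0 HN]].
have : (mu (ball (0 : 'rV[R]_n)%R r) <= mu N)%E.
  apply: le_measure; rewrite ?inE//; first exact: measurable_rV_ball.
  move=> x xr; apply: HN => /= /(_ I) [] /eqP; apply/negP; rewrite gt_eqF//.
  by apply: bump_gt0 => //; move: xr; rewrite -ball_normE /= sub0r normrN.
by rewrite N0 lebesgue_rV_ball// lee_fin leNgt exprn_gt0// mulrn_wgt0.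
Qed.

Definition mollifier (r : R) x := (\int[mu]_y @cube_bump R n r y)^-1 * cube_bump r x.

Lemma mollifier_C11 (r : R) : 0 < r -> exists g, C11 (mollifier r) g.
Proof.
by move=> r0; have [g kg] := @C11_bump R n r r0; eexists; exact: C11Z _ kg.
Qed.

Lemma mollifier_ge0 (r : R) x : 0 < r -> 0 <= mollifier r x.
Proof.
by move=> r0; rewrite mulr_ge0 ?bump_ge0// invr_ge0 ltW// bump_mass_gt0.
Qed.

Lemma mollifierN (r : R) x : mollifier r (- x) = mollifier r x.
Proof. by rewrite /mollifier bumpN. Qed.

Lemma mollifier_eq0 (r : R) x : 0 < r -> r <= `|x| -> mollifier r x = 0.
Proof. by move=> r0 rx; rewrite /mollifier bump_eq0// mulr0. Qed.

Lemma mollifier_integrable (r : R) : 0 < r ->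
  mu.-integrable setT (EFin \o mollifier r).
Proof.
move=> r0; rewrite /mollifier /comp.
by under eq_fun do rewrite EFinM; apply: integrableZl => //; exact: bump_integrable.
Qed.

Lemma mollifier_mass (r : R) : 0 < r -> (\int[mu]_x (mollifier r x)%:E = 1)%E.
Proof.
move=> r0; rewrite /mollifier; under eq_integral do rewrite EFinM.
rewrite integralZl//; last exact: bump_integrable.
rewrite -[X in (_ * X)%E]fineK; last first.
  by apply: integrable_fin_num => //; exact: bump_integrable.
by rewrite -EFinM mulVf// gt_eqF// bump_mass_gt0.
Qed.

(** The substitution [y = x + z], the evenness of the mollifier and its unit mass express the error
    as an average of increments of [U]. *)
Lemma conv_mollifierE U r x : 0 < r -> mu.-integrable setT (EFin \o U) ->
  convolution U (mollifier r) x - U x =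
  (\int[mu]_z ((U (x + z)%R - U x) * mollifier r z))%R.
Proof.
move=> r0 iU; have [g kg] := mollifier_C11 r0.
have mk := continuous_rV_measurable (C11_continuous kg).
have [C C0 [kC _ _ _]] := kg.
have iUk : mu.-integrable setT (fun y => (U y * mollifier r (x - y))%:E).
  by apply: (integrable_bounded_mul (C := C)) => //; exact: measurable_reflect.
have i1 := integrable_rV_shift x iUk.
have i2 : mu.-integrable setT (fun z => (U (x + z)%R * mollifier r z)%:E).
  move: i1; congr (mu.-integrable _ _); apply/funext => z.
  by rewrite opprD addrA subrr sub0r mollifierN.
have E : (\int[mu]_z (U (x + z)%R * mollifier r z) = convolution U (mollifier r) x)%R.
  rewrite /convolution /Rintegral -(integral_rV_shift x iUk); congr fine.
  by apply: eq_integral => z _; rewrite opprD addrA subrr sub0r mollifierN.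
under [RHS]eq_Rintegral do rewrite mulrBl.
rewrite RintegralB//; last first.
  by apply: integrable_scalel => //; exact: mollifier_integrable.
rewrite E RintegralZl//; last exact: mollifier_integrable.
by rewrite /Rintegral mollifier_mass//= mulr1.
Qed.

(** Jensen's inequality for the probability density [mollifier r] followed by Tonelli's theorem:
    what remains inside is the L^q increment for a translation [z], and only [|z| < r]
    contributes. *)
Lemma conv_mollifier_Lq U q : 1 <= q -> mu.-integrable setT (EFin \o U) ->
  (\int[mu]_x (`|U x| `^ q)%:E < +oo)%E ->
  forall e : R, 0 < e -> exists2 d : R, 0 < d & forall r, 0 < r < d ->
    (\int[mu]_x (`|convolution U (mollifier r) x - U x| `^ q)%:E <= e%:E)%E.
Proof.
move=> q1 iU Uq e e0; have q0 : 0 < q by lra.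
have mU : measurable_fun [set: 'rV[R]_n] U.
  by apply/measurable_EFinP; exact: measurable_int iU.
have [d d0 Hd] := translation_continuous_Lq q1 mU Uq e0.
exists d => // r /andP[r0 rd]; have [g kg] := mollifier_C11 r0.
have mk := continuous_rV_measurable (C11_continuous kg).
have [C C0 [kC _ _ _]] := kg.
have mconv : measurable_fun [set: 'rV[R]_n] (convolution U (mollifier r)).
  by apply: continuous_rV_measurable; exact: C11_continuous (conv_C11 iU kg).
have mshift x : measurable_fun [set: 'rV[R]_n] (fun z => U (x + z) - U x).
  by apply: measurable_funB; [exact: measurable_shift|exact: measurable_cst].
have ishift x : mu.-integrable setT (fun z => ((U (x + z) - U x) * mollifier r z)%:E).
  under eq_fun do rewrite mulrBl EFinB; apply: integrableB => //.
    apply: (integrable_bounded_mul (U := fun z => U (x + z)) (C := C)) => //.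
    exact: integrable_rV_shift iU.
  by under eq_fun do rewrite EFinM; apply: integrableZl => //; exact: mollifier_integrable.
pose f (w : 'rV[R]_n * 'rV[R]_n) : \bar R :=
  (`|U (w.1 + w.2) - U w.1| `^ q * mollifier r w.2)%:E.
have mf : measurable_fun [set: 'rV[R]_n * 'rV[R]_n] f.
  apply/measurable_EFinP; apply: measurable_funM; last first.
    exact: (measurableT_comp mk measurable_snd).
  apply: measurable_powR2 => //; apply: measurableT_comp => //.
  apply: measurable_funB; first exact: (measurableT_comp mU (@measurable_rV_add R n)).
  exact: (measurableT_comp mU measurable_fst).
have f0 w : (0 <= f w)%E by rewrite lee_fin mulr_ge0 ?mollifier_ge0 ?powR_ge0.
apply: (@le_trans _ _ (\int[mu]_x \int[mu]_z f (x, z))%E).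
  apply: ge0_le_integral => //.
  - by apply/measurable_EFinP; apply: measurable_powR_norm; exact: measurable_funB.
  - exact: measurable_fun_fubini_tonelli_F.
  - move=> x _; rewrite conv_mollifierE//.
    apply: (@le_trans _ _ (((\int[mu]_z (`|U (x + z)%R - U x| * mollifier r z)) `^ q)%:E)%E).
      rewrite lee_fin; apply: ge0_ler_powR; rewrite ?nnegrE ?(ltW q0)//.
        by apply: Rintegral_ge0 => z _; rewrite mulr_ge0 ?mollifier_ge0.
      apply: le_trans (le_normr_Rintegral measurableT (ishift x)) _.
      rewrite le_eqVlt; apply/orP; left; apply/eqP; apply: eq_Rintegral => z _.
      by rewrite normrM [`|mollifier r z|]ger0_norm ?mollifier_ge0.
    apply: jensen_powR => //.
    + exact: measurableT_comp.
    + by move=> z _; rewrite mollifier_ge0.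
    + exact: mollifier_mass.
    + have := integrable_norm (ishift x); congr (mu.-integrable _ _).
      by apply/funext => z /=; rewrite normrM [`|mollifier r z|]ger0_norm ?mollifier_ge0.
rewrite (fubini_tonelli f mf f0).
have -> : e%:E = (\int[mu]_z (e%:E * (mollifier r z)%:E))%E.
  rewrite ge0_integralZl//.
  - by rewrite mollifier_mass// mule1.
  - exact/measurable_EFinP.
  - by move=> z _; rewrite lee_fin mollifier_ge0.
  - by rewrite lee_fin ltW.
apply: ge0_le_integral => //.
- by move=> z _; apply: integral_ge0 => x _; exact: f0.
- exact: measurable_fun_fubini_tonelli_G.
- apply: emeasurable_funM; first exact: measurable_cst.
  exact/measurable_EFinP.
- move=> z _; rewrite /f /=.
  have [zr|zr] := leP r `|z|.
    rewrite mollifier_eq0// mule0.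
    by under eq_integral do rewrite mulr0; rewrite integral0.
  under eq_integral do rewrite EFinM.
  rewrite ge0_integralZr//.
  - rewrite lee_wpmul2r ?lee_fin ?mollifier_ge0//.
    under eq_integral do rewrite [_ + z]addrC.
    exact: Hd (lt_trans zr rd).
  - apply/measurable_EFinP; apply: measurable_powR_norm; apply: measurable_funB => //.
    under eq_fun do rewrite addrC; exact: measurable_shift.
  - by rewrite lee_fin mollifier_ge0.
Qed.

End mollification.

(** * Test functions and the fundamental lemma *)

Section compact_supports.
Variables (R : realType) (n : nat).
Implicit Types (Omega K : set 'rV[R]_n) (f : 'rV[R]_n -> R).

Lemma compact_open_thick K Omega : compact K -> open Omega -> K `<=` Omega ->
  exists2 d : R, 0 < d & forall x y, K x -> `|x - y| < d -> Omega y.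
Proof.
move=> cK oO KO.
have /compact_near_coveringP/(_ R (0^'+) (fun e x => forall y, `|x - y| < e -> Omega y) _) := cK.
case.
  move=> x Kx; have /nbhs_ballP[r /= r0 rO] := open_nbhs_nbhs (conj oO (KO _ Kx)).
  exists (ball x (r / 2), [set e | e < r / 2]) => /=.
    split; first by apply: nbhsx_ballx; rewrite divr_gt0.
    by apply: nbhs_right_lt; rewrite divr_gt0.
  move=> [x' e] /= [xx' er] y x'y; apply: rO; move: xx'; rewrite -!ball_normE /= => xx'.
  have := ler_normD (x - x') (x' - y); rewrite addrA subrK.
  move: (`|x - y|) (`|x - x'|) (`|x' - y|) xx' x'y => a b c *; lra.
move=> e /= e0 H; exists (e / 2); first by rewrite divr_gt0.
move=> x y Kx xy; apply: (H (e / 2)) xy => //=; last by rewrite divr_gt0.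
by rewrite sub0r normrN gtr0_norm ?divr_gt0//; lra.
Qed.

(** A closed sup-norm neighbourhood written as a Minkowski sum with a cube, so that compactness
    follows from the continuity of addition. *)
Definition thickening K (r : R) : set 'rV[R]_n :=
  [set x + z | x in K & z in [set z : 'rV[R]_n | forall i, z ord0 i \in `[- r, r]]].

Lemma thickening_compact K r : compact K -> compact (thickening K r).
Proof.
move=> cK.
have cB : compact [set z : 'rV[R]_n | forall i, z ord0 i \in `[- r, r]].
  apply: (@rV_compact _ _ (fun=> `[- r, r]%classic)) => _; exact: segment_compact.
have := continuous_compact _ (compact_setX cK cB).
move=> /(_ 'rV[R]_n (fun z => z.1 + z.2)).
have -> : (fun z : 'rV[R]_n * 'rV[R]_n => z.1 + z.2) @`
  (K `*` [set z : 'rV[R]_n | forall i, z ord0 i \in `[- r, r]]) = thickening K r.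
  apply/seteqP; split => x.
    by move=> [[y z] [/= Ky Kz] <-]; exists y => //; exists z.
  by move=> [y Ky [z Kz <-]]; exists (y, z).
apply; apply: continuous_subspaceT => z; exact: add_continuous.
Qed.

Lemma in_thickening K r x y : K y -> `|x - y| <= r -> thickening K r x.
Proof.
move=> Ky xy; exists y => //; exists (x - y); last by rewrite addrC subrK.
by move=> i; rewrite in_itv/= -ler_norml; apply: le_trans (coord_norm_le _ _) xy.
Qed.

Lemma thickeningP K r x : 0 <= r -> thickening K r x ->
  exists2 y, K y & `|x - y| <= r.
Proof.
move=> r0 [y Ky [z zr <-]]; exists y => //; rewrite addrAC subrr add0r.
by apply: norm_le_coord => // i; have := zr i; rewrite in_itv/= -ler_norml.
Qed.

Lemma compact_in_ball K : compact K ->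
  exists2 M : R, 0 < M & forall x, K x -> `|x| < M.
Proof.
move=> /compact_bounded[M [_ HM]]; exists (`|M| + 2); first by rewrite ltr_wpDl.
move=> x Kx; apply: (@le_lt_trans _ _ (`|M| + 1)); last by lra.
by apply: HM Kx; have := ler_norm M; lra.
Qed.

Lemma continuous_support_bounded f K : continuous f -> compact K ->
  (forall x, ~ K x -> f x = 0) -> exists2 C : R, 0 <= C & forall x, `|f x| <= C.
Proof.
move=> cf cK f0.
have := continuous_compact (continuous_subspaceT cf) cK.
move=> /(@compact_bounded R R) [M [_ HM]]; exists (`|M| + 1); first by rewrite addr_ge0.
move=> x; have [Kx|Kx] := pselect (K x); last by rewrite f0// normr0 addr_ge0.
by apply: HM; [have := ler_norm M; lra|exists x].
Qed.

Lemma closed_zero_derive f K x v : closed K -> (forall y, ~ K y -> f y = 0) ->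
  ~ K x -> 'D_v f x = 0.
Proof.
move=> cK f0 Kx.
rewrite (@near_eq_derive _ _ _ f (cst 0) x v) ?derive_cst//.
have oK : open (~` K) by exact: closed_openC.
by have := open_nbhs_nbhs (conj oK Kx); apply: filterS => y Ky; exact: f0.
Qed.

End compact_supports.

(** * Directional derivatives integrate to zero *)

Section line_derivative.
Variables (R : realType) (n : nat).
Local Notation mu := (lebesgue_rV R n).
Implicit Types (F f : 'rV[R]_n -> R) (x v : 'rV[R]_n).

Lemma is_derive_line F x v (s : R) : derivable F (x + s *: v) v ->
  is_derive s 1 (fun t : R => F (x + t *: v)) ('D_v F (x + s *: v)).
Proof.
have E : (fun h : R => h^-1 *: (((fun t : R => F (x + t *: v)) \o shift s) (h *: 1) - F (x + s *: v))) =
   (fun h : R => h^-1 *: ((F \o shift (x + s *: v)) (h *: v) - F (x + s *: v))).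
  apply/funext => h /=; congr (_ *: (F _ - _)).
  by rewrite [h *: 1]mulr1 scalerDl addrCA.
by move=> dF; split; rewrite /derivable/derive/= E.
Qed.

Lemma mean_value_line F x v (K t : R) : 0 < t ->
  (forall y, derivable F y v) -> (forall y, `|'D_v F y| <= K) ->
  `|F (x + t *: v) - F x| <= K * t.
Proof.
move=> t0 dF FK.
have H (s : R) : is_derive s 1 (fun t : R => F (x + t *: v)) ('D_v F (x + s *: v)).
  exact: is_derive_line.
have [|c _] := @MVT R (fun t : R => F (x + t *: v)) (fun s => 'D_v F (x + s *: v)) 0 t t0.
  apply: continuous_subspaceT => s; apply: differentiable_continuous.
  by apply/derivable1_diffP; have [] := H s.
rewrite scale0r addr0 subr0 => ->.
by rewrite normrM (gtr0_norm t0) ler_wpM2r// ltW.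
Qed.

Lemma Rintegral_rV_shift (z : 'rV[R]_n) F : mu.-integrable setT (EFin \o F) ->
  (\int[mu]_x (F (z + x)))%R = (\int[mu]_x (F x))%R.
Proof. by move=> iF; rewrite /Rintegral (integral_rV_shift z iF). Qed.

Lemma integrable_bounded_support F (C M : R) : 0 < M ->
  measurable_fun [set: 'rV[R]_n] F -> (forall x, `|F x| <= C) ->
  (forall x, M <= `|x| -> F x = 0) -> mu.-integrable setT (EFin \o F).
Proof.
move=> M0 mF FC F0.
apply: (@le_integrable _ _ _ mu setT measurableT _
    (fun x => (C%:E * (\1_(ball (0 : 'rV[R]_n) M) x)%:E)%E)).
- exact/measurable_EFinP.
- move=> x _; rewrite -EFinM /= lee_fin indicE.
  have [xM|xM] := leP M `|x|; first by rewrite F0// normr0.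
  rewrite mem_set ?mulr1; last by rewrite -ball_normE /= sub0r normrN.
  exact: le_trans (FC x) (ler_norm _).
- apply: integrableZl => //; apply: integrable_indic_lty.
    exact: measurable_rV_ball.
  by rewrite lebesgue_rV_ball// ltry.
Qed.

(* Translation invariance makes every difference quotient integrate to 0. *)
Lemma integral_line_derivative F v (M K : R) : 0 < M ->
  measurable_fun [set: 'rV[R]_n] F -> measurable_fun [set: 'rV[R]_n] ('D_v F) ->
  (forall x, M <= `|x| -> F x = 0) -> (exists C, forall x, `|F x| <= C) ->
  (forall x, derivable F x v) -> (forall x, `|'D_v F x| <= K) ->
  (\int[mu]_x 'D_v F x)%R = 0.
Proof.
move=> M0 mF mD F0 [C FC] dF FK.
pose t (k : nat) : R := k.+1%:R^-1.
have t0 k : 0 < t k by rewrite invr_gt0.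
have t1 k : t k <= 1 by rewrite invf_le1// ler1n.
have iF := integrable_bounded_support M0 mF FC F0.
pose d k x : R := (t k)^-1 * (F (t k *: v + x) - F x).
have md k : measurable_fun [set: 'rV[R]_n] (d k).
  apply: measurable_funM; first exact: measurable_cst.
  by apply: measurable_funB => //; exact: measurable_shift.
have dK k x : `|d k x| <= K.
  rewrite normrM gtr0_norm ?invr_gt0// mulrC ler_pdivrMr// [_ *: v + x]addrC.
  exact: mean_value_line.
(* Since [t k <= 1], all difference quotients vanish outside one ball of radius [M + |v|], and [dK]
   bounds them by [K]: this gives the majorant for dominated convergence. *)
have dM k x : M + `|v| <= `|x| -> d k x = 0.
  move=> xM; rewrite /d !F0 ?subrr ?mulr0//.
    by apply: le_trans xM; rewrite lerDl.
  rewrite [_ *: v + x]addrC; apply: le_trans (lerB_normD x (t k *: v)).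
  rewrite normrZ gtr0_norm// lerBrDr; apply: le_trans xM.
  by rewrite lerD2l ler_piMl.
have id k : mu.-integrable setT (EFin \o d k).
  apply: (integrable_bounded_support (M := M + `|v|)) (dK k) (dM k) => //.
  by rewrite ltr_wpDr.
have d0 k : (\int[mu]_x d k x)%R = 0.
  have i1 : mu.-integrable setT (EFin \o (fun x => F (t k *: v + x))).
    exact: integrable_rV_shift iF.
  rewrite /d RintegralZl//; last by apply: integrable_subr.
  by rewrite RintegralB// Rintegral_rV_shift// subrr mulr0.
have dc x : (fun k => d k x) @ \oo --> 'D_v F x.
  have := dF x; rewrite /derivable => /cvg_ex[l Hl].
  have -> : 'D_v F x = l by exact: cvg_lim Hl.
  have [_] := cvgr_dnbhsP (fun h : R => h^-1 *: ((F \o shift x) (h *: v) - F x)) 0 l.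
  have [H _] := cvgr_dnbhsP (fun h : R => h^-1 *: ((F \o shift x) (h *: v) - F x)) 0 l.
  move=> _; apply: (H Hl t); split; last exact: cvg_harmonic.
  by move=> k; rewrite gt_eqF.
have ig : mu.-integrable setT
    (fun x => (`|K| * \1_(ball (0 : 'rV[R]_n) (M + `|v|)) x)%:E).
  apply: integrable_scalel => //; apply: integrable_indic_lty.
    by apply: measurable_rV_ball; rewrite ltr_wpDr.
  by rewrite lebesgue_rV_ball ?ltry// ltr_wpDr.
have [||||_ _] := @dominated_convergence _ _ _ mu setT measurableT (fun k => EFin \o d k)
  (EFin \o 'D_v F) _ _ _ _ ig.
- by move=> k; exact/measurable_EFinP.
- exact/measurable_EFinP.
- by apply: aeW => x _; apply: cvg_EFin; [exact: nearW|exact: dc].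
- apply: aeW => x k _; rewrite /= lee_fin indicE.
  have [xM|xM] := leP (M + `|v|) `|x|; first by rewrite dM// normr0 mulr_ge0.
  rewrite mem_set ?mulr1; last by rewrite -ball_normE /= sub0r normrN.
  exact: le_trans (dK k x) (ler_norm _).
rewrite (_ : (fun k => _) = cst 0%E).
  by move/(cvg_unique (@ereal_hausdorff R) (cvg_cst _)) => H; rewrite /Rintegral -H.
apply/funext => k; have := d0 k; rewrite /Rintegral => H.
by rewrite -[LHS]fineK ?H//; apply: integrable_fin_num => //; exact: id.
Qed.

End line_derivative.

(** * Test functions on an open set *)

Section test_functions.
Variables (R : realType) (n : nat) (Omega : set 'rV[R]_n).
Hypothesis oO : open Omega.
Local Notation mu := (lebesgue_rV R n).
Implicit Types (f u v : 'rV[R]_n -> R) (K : set 'rV[R]_n).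

Lemma C1_continuous f : C1 f -> continuous f.
Proof. by move=> [df _] x; exact: differentiable_continuous. Qed.

Lemma C1_measurable f : C1 f -> measurable_fun [set: 'rV[R]_n] f.
Proof. by move=> /C1_continuous; exact: continuous_rV_measurable. Qed.

Lemma C1_partial_measurable f i : C1 f ->
  measurable_fun [set: 'rV[R]_n] (partial i f).
Proof. by move=> [_ cf]; exact: continuous_rV_measurable (cf i). Qed.

Lemma C1_derivable f x (h : 'rV[R]_n) : C1 f -> derivable f x h.
Proof. by move=> [df _]; exact: diff_derivable. Qed.

Lemma C1c_bounds f : C1c Omega f -> exists2 C : R, 0 <= C &
  (forall x, `|f x| <= C) /\ (forall i x, `|partial i f x| <= C).
Proof.
move=> [f1 [K [cK KO f0]]].
have p0 i x : ~ K x -> partial i f x = 0.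
  exact: closed_zero_derive (compact_closed (@norm_hausdorff _ _) cK) f0.
have [C C0 fC] := continuous_support_bounded (C1_continuous f1) cK f0.
have H i : exists C : R, 0 <= C /\ forall x, `|partial i f x| <= C.
  have [D D0 HD] := continuous_support_bounded (f1.2 i) cK (p0 i).
  by exists D.
have [D DP] := choice H.
exists (C + \sum_i D i); first by rewrite addr_ge0// sumr_ge0// => i _; case: (DP i).
have S0 : 0 <= \sum_i D i by rewrite sumr_ge0// => i _; case: (DP i).
split=> [x|i x]; first by apply: le_trans (fC x) _; rewrite lerDl.
apply: le_trans ((DP i).2 x) _.
rewrite (bigD1 i)//= addrCA lerDl addr_ge0// sumr_ge0// => j _; by case: (DP j).
Qed.

Lemma C1c_partial0 f K i x : compact K -> (forall x, ~ K x -> f x = 0) ->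
  ~ K x -> partial i f x = 0.
Proof.
move=> cK f0; exact: closed_zero_derive (compact_closed (@norm_hausdorff _ _) cK) f0.
Qed.

Lemma partialM f g i x : C1 f -> C1 g ->
  partial i (fun x => f x * g x) x = f x * partial i g x + g x * partial i f x.
Proof.
by move=> f1 g1; apply: (@deriveM _ _ f g); exact: C1_derivable.
Qed.

Lemma loc_integrable_indic u K : loc_integrable Omega u -> compact K ->
  K `<=` Omega -> mu.-integrable setT (EFin \o (fun x => u x * \1_K x)).
Proof.
move=> lu cK KO; have mK := compact_rV_measurable cK.
have := lu K cK KO; rewrite integrable_mkcond//; congr (mu.-integrable _ _).
apply/funext => x; rewrite patchE /= indicE; case: (x \in K).
  by rewrite mulr1.
by rewrite mulr0.
Qed.

Lemma Rintegral_indic_support (D : set 'rV[R]_n) u f K : measurable D -> K `<=` D ->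
  (forall x, ~ K x -> f x = 0) ->
  (\int[mu]_(x in D) (u x * f x))%R = (\int[mu]_x (u x * \1_K x * f x))%R.
Proof.
move=> mD KD f0; rewrite Rintegral_mkcond; apply: eq_Rintegral => x _.
rewrite patchE indicE; have [xK|xK] := boolP (x \in K).
  by rewrite mem_set ?mulr1//; apply: KD; exact: set_mem.
rewrite f0; last by move=> Kx; move/negP: xK; apply; exact: mem_set.
by rewrite !mulr0; case: ifP.
Qed.

Lemma integrable_indic_support (D : set 'rV[R]_n) u f K : measurable D ->
  K `<=` D -> (forall x, ~ K x -> f x = 0) ->
  mu.-integrable setT (fun x => (u x * \1_K x * f x)%:E) ->
  mu.-integrable D (fun x => (u x * f x)%:E).
Proof.
move=> mD KD f0 H; rewrite integrable_mkcond//; move: H; congr (mu.-integrable _ _).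
apply/funext => x; rewrite patchE indicE; have [xK|xK] := boolP (x \in K).
  by rewrite mem_set ?mulr1//; apply: KD; exact: set_mem.
rewrite f0; last by move=> Kx; move/negP: xK; apply; exact: mem_set.
by rewrite !mulr0; case: ifP.
Qed.

Lemma loc_integrable_mul u f K (C : R) : loc_integrable Omega u -> compact K ->
  K `<=` Omega -> measurable_fun [set: 'rV[R]_n] f -> (forall x, `|f x| <= C) ->
  (forall x, ~ K x -> f x = 0) ->
  mu.-integrable Omega (fun x => (u x * f x)%:E).
Proof.
move=> lu cK KO mf fC f0.
apply: (integrable_indic_support (K := K)) => //; first exact: open_rV_measurable.
apply: (integrable_bounded_mul (C := C)) => //.
exact: loc_integrable_indic.
Qed.

Lemma loc_integrable_test u f : loc_integrable Omega u -> C1c Omega f ->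
  mu.-integrable Omega (fun x => (u x * f x)%:E).
Proof.
move=> lu fc; have [C C0 [fC pC]] := C1c_bounds fc.
case: (fc) => f1 [K [cK KO f0]].
by apply: (loc_integrable_mul lu cK KO _ fC f0); exact: C1_measurable.
Qed.

Lemma loc_integrable_test_partial u f i : loc_integrable Omega u -> C1c Omega f ->
  mu.-integrable Omega (fun x => (u x * partial i f x)%:E).
Proof.
move=> lu fc; have [C C0 [fC pC]] := C1c_bounds fc.
case: (fc) => f1 [K [cK KO f0]].
apply: (loc_integrable_mul lu cK KO _ (pC i)).
  exact: C1_partial_measurable.
by move=> x; exact: C1c_partial0 f0.
Qed.

(* Countably many balls, whose doubles stay inside, cover an open set. *)
Lemma open_ball_cover : exists (B : nat -> option ('rV[R]_n * R)),
  (forall k c r, B k = Some (c, r) -> 0 < r /\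
     forall y, `|c - y| <= 2 * r -> Omega y) /\
  (forall x, Omega x -> exists k c r, B k = Some (c, r) /\ `|c - x| < r).
Proof.
pose P (t : 'rV[rat]_n * rat) := `[< 0 < (ratr t.2 : R) /\
  forall y, `|map_mx ratr t.1 - y| <= 2 * (ratr t.2 : R) -> Omega y >].
exists (fun k => if unpickle k is Some t then
  if P t then Some (map_mx ratr t.1, ratr t.2) else None else None); split.
  move=> k c r; case: (unpickle k) => // t; rewrite /P; case: asboolP => // Pt.
  by case=> <- <-.
move=> x Ox; have /nbhs_ballP[e /= e0 eO] := open_nbhs_nbhs (conj oO Ox).
have [q /andP[q0 qe]] : exists q : rat, 0 < (ratr q : R) < e / 3.
  have : 0 < e / 3 by lra.
  by move=> /rat_in_itvoo[q]; rewrite in_itv/= => qe; exists q.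
have [c xc] := rV_rat_approx x q0.
exists (pickle (c, q)), (map_mx ratr c), (ratr q); rewrite pickleK.
have -> : P (c, q).
  apply/asboolP; split => //= y yc; apply: eO; rewrite -ball_normE /=.
  have := ler_normD (x - map_mx ratr c) (map_mx ratr c - y).
  rewrite addrA subrK; move: (`|x - y|) (`|x - _|) (`|_ - y|) xc yc.
  move=> a b d; lra.
by rewrite distrC.
Qed.

(** Countably many balls suffice, so the exceptional null sets of the local statements have a null
    union. *)
Lemma ae_open_cover (P : 'rV[R]_n -> Prop) :
  (forall (c : 'rV[R]_n) r, 0 < r -> (forall y, `|c - y| <= 2 * r -> Omega y) ->
    {ae mu, forall x, `|c - x| < r -> P x}) ->
  {ae mu, forall x, Omega x -> P x}.
Proof.
move=> H; have [B [B1 B2]] := open_ball_cover.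
have : {ae mu, forall x, forall k, forall c r, B k = Some (c, r) -> `|c - x| < r -> P x}.
  apply: ae_foralln => k; case E : (B k) => [[c r]|]; last by apply: aeW.
  have [r0 cO] := B1 _ _ _ E.
  by move: (H c r r0 cO); apply: filterS => x Hx _ _ [<- <-].
apply: filterS => x Hx /B2[k [c [r [Bk cx]]]]; exact: Hx Bk cx.
Qed.

(** Integrability on compact sets yields measurability on each ball of the countable cover, hence on
    their union. *)
Lemma loc_integrable_measurable u : loc_integrable Omega u ->
  measurable_fun Omega u.
Proof.
move=> lu; have [B [B1 B2]] := open_ball_cover.
pose F k : set 'rV[R]_n := if B k is Some (c, r) then ball c r else set0.
have mF k : measurable (F k).
  rewrite /F; case E : (B k) => [[c r]|] //; have [r0 _] := B1 _ _ _ E.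
  exact: measurable_rV_ball.
have -> : Omega = \bigcup_k F k.
  apply/seteqP; split => x.
    move=> /B2[k [c [r [Bk cx]]]]; exists k => //; rewrite /F Bk.
    by rewrite -ball_normE.
  move=> [k _]; rewrite /F; case E : (B k) => [[c r]|] //.
  have [r0 cO] := B1 _ _ _ E; rewrite -ball_normE /= => cx; apply: cO.
  by rewrite mulr_natl mulr2n ler_wpDr ?ltW.
apply/measurable_fun_bigcup => // k; rewrite /F.
case E : (B k) => [[c r]|]; last exact: measurable_fun_set0.
have [r0 cO] := B1 _ _ _ E.
have cK : compact (thickening [set c] (2 * r)) by apply: thickening_compact; exact: compact_set1.
have KO : thickening [set c] (2 * r) `<=` Omega.
  move=> y /thickeningP[|z ->]; first by rewrite mulr_ge0// ltW.
  by rewrite distrC; exact: cO.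
have /integrableP[/measurable_EFinP mu_ _] := lu _ cK KO.
apply: measurable_funS mu_; first exact: compact_rV_measurable.
move=> y; rewrite -ball_normE /= => cy; apply: (in_thickening (y := c)) => //.
by rewrite distrC; apply/ltW/(lt_trans cy); rewrite mulr_natl mulr2n ltrDl.
Qed.

(* u 1_K is mollified at scales below the distance of the ball to the
   complement of the compact K; all mollifications vanish there. *)
Lemma fundamental_lemma u : loc_integrable Omega u ->
  (forall f, C1c Omega f -> (\int[mu]_(x in Omega) (u x * f x))%R = 0) ->
  {ae mu, forall x, Omega x -> u x = 0}.
Proof.
move=> lu H; apply: ae_open_cover => c r r0 cO.
set K := thickening [set c] (2 * r).
have cK : compact K by apply: thickening_compact; exact: compact_set1.
have KO : K `<=` Omega.
  move=> y /thickeningP[|z ->]; first by rewrite mulr_ge0// ltW.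
  by rewrite distrC; exact: cO.
have inK y : `|c - y| <= 2 * r -> K y.
  by move=> cy; apply: (in_thickening (y := c)) => //; rewrite distrC.
set B := ball c r; have mB : measurable B by exact: measurable_rV_ball.
pose U x := u x * \1_K x.
have iU : mu.-integrable setT (EFin \o U) by exact: loc_integrable_indic.
have mU : measurable_fun [set: 'rV[R]_n] U.
  by apply/measurable_EFinP; exact: measurable_int iU.
have U1 : (\int[mu]_x (`|U x| `^ 1)%:E < +oo)%E.
  by under eq_integral do rewrite powRr1//; have /integrableP[_] := iU.
have conv0 s x : 0 < s < r -> B x -> convolution U (mollifier s) x = 0.
  move=> /andP[s0 sr]; rewrite /B -ball_normE /= => cx.
  have [g kg] := @mollifier_C11 R n s s0.
  have kr := C11_reflect x kg.
  (* For [x] in the ball of radius [r] and [s < r], the kernel [y -> mollifier s (x - y)] is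
     supported in [K], the closed ball of radius [2 r], so it is an admissible test function. *)
  have z y : ~ K y -> mollifier s (x - y) = 0.
    move=> Ky; apply: mollifier_eq0 => //; rewrite leNgt; apply/negP => xy.
    apply: Ky; apply: inK; have := ler_normD (c - x) (x - y); rewrite addrA subrK.
    move: (`|c - y|) (`|c - x|) (`|x - y|) cx xy => a1 a2 a3; lra.
  have := H (fun y => mollifier s (x - y)).
  rewrite (Rintegral_indic_support u (open_rV_measurable oO) KO)//; apply.
  split; first exact: C11_C1 kr.
  by exists K.
have I0 : (\int[mu]_(x in B) `|(U x)%:E| = 0)%E.
  apply/eqP; rewrite eq_le integral_ge0// andbT.
  apply/lee_addgt0Pr => e e0; rewrite add0e.
  have [d d0 Hd] := conv_mollifier_Lq (lexx 1) iU U1 e0.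
  pose s := Num.min (d / 2) (r / 2).
  have s0 : 0 < s by rewrite lt_min !divr_gt0.
  have sd : s < d by rewrite gt_min; apply/orP; left; lra.
  have sr : s < r by rewrite gt_min; apply/orP; right; lra.
  have /Hd : 0 < s < d by rewrite s0.
  apply: le_trans.
  have [g kg] := @mollifier_C11 R n s s0.
  have mc : measurable_fun [set: 'rV[R]_n] (convolution U (mollifier s)).
    by apply: continuous_rV_measurable; exact: C11_continuous (conv_C11 iU kg).
  apply: (@le_trans _ _ (\int[mu]_(x in B) (`|convolution U (mollifier s) x - U x| `^ 1)%:E)%E).
    rewrite le_eqVlt; apply/orP; left; apply/eqP; apply: eq_integral => x /set_mem Bx.
    by rewrite conv0 ?s0// sub0r normrN powRr1.
  apply: ge0_subset_integral => //.
  apply/measurable_EFinP; apply: measurable_powR_norm; exact: measurable_funB.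
have mUB : measurable_fun B (fun x => (U x)%:E).
  by apply/measurable_EFinP; exact: measurable_funTS.
have /(ae_eq_integral_abs mu mB mUB) := I0.
apply: filterS => x Hx cx.
have Bx : B x by rewrite /B -ball_normE.
have := Hx Bx; rewrite /U indicE mem_set ?mulr1; first by case.
by apply: inK; rewrite mulr_natl mulr2n ler_wpDr ?ltW.
Qed.

End test_functions.

(** * Weak gradients *)

Section almost_everywhere.
Context d (T : measurableType d) (R : realType).
Variables (mu : {measure set T -> \bar R}) (D : set T).
Hypothesis mD : measurable D.

Lemma ae_forall_ord n (P : 'I_n -> T -> Prop) :
  (forall i, {ae mu, forall x, P i x}) -> {ae mu, forall x, forall i, P i x}.
Proof.
move=> H; have : {ae mu, forall x, forall k : nat, forall i : 'I_n, i = k :> nat -> P i x}.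
  apply: ae_foralln => k; have [kn|kn] := ltnP k n.
    move: (H (Ordinal kn)); apply: filterS => x Px i ik.
    by rewrite (_ : i = Ordinal kn)//; exact/val_inj.
  by apply: aeW => x i ik; move: (ltn_ord i); rewrite ik ltnNge kn.
by apply: filterS => x Px i; exact: Px.
Qed.

Lemma Rintegral_ae_eq (f g : T -> R) : measurable_fun D f -> measurable_fun D g ->
  {ae mu, forall x, D x -> f x = g x} ->
  (\int[mu]_(x in D) f x = \int[mu]_(x in D) g x)%R.
Proof.
move=> mf mg fg; rewrite /Rintegral; congr fine; apply: ae_eq_integral => //.
- exact/measurable_EFinP.
- exact/measurable_EFinP.
- by move: fg; apply: filterS => x fg Dx; rewrite fg.
Qed.

Lemma ge0_integral_ae_eq (f g : T -> R) : measurable_fun D f -> measurable_fun D g ->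
  {ae mu, forall x, D x -> f x = g x} ->
  (\int[mu]_(x in D) (f x)%:E = \int[mu]_(x in D) (g x)%:E)%E.
Proof.
move=> mf mg fg; apply: ae_eq_integral => //.
- exact/measurable_EFinP.
- exact/measurable_EFinP.
- by move: fg; apply: filterS => x fg Dx; rewrite fg.
Qed.

End almost_everywhere.

Section weak_gradients.
Variables (R : realType) (n : nat) (Omega : set 'rV[R]_n).
Hypothesis oO : open Omega.
Local Notation mu := (lebesgue_rV R n).
Implicit Types (f u v w : 'rV[R]_n -> R) (G H : 'rV[R]_n -> 'rV[R]_n) (K : set 'rV[R]_n).

Let mO : measurable Omega := open_rV_measurable oO.

Lemma loc_integrable_lin (a : R) u v : loc_integrable Omega u ->
  loc_integrable Omega v -> loc_integrable Omega (fun x => a * u x + v x).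
Proof.
move=> lu lv K cK KO; have mK := compact_rV_measurable cK.
apply: integrable_addr => //; last exact: lv.
by apply: integrable_scalel => //; exact: lu.
Qed.

Lemma is_weak_grad_lin (a : R) u v G H : is_weak_grad Omega u G ->
  is_weak_grad Omega v H ->
  is_weak_grad Omega (fun x => a * u x + v x) (fun x => a *: G x + H x).
Proof.
move=> [lu lG uG] [lv lH vH]; split; first exact: loc_integrable_lin.
  move=> i; have := loc_integrable_lin a (lG i) (lH i).
  by congr loc_integrable; apply/funext => x; rewrite !mxE.
move=> f fc i.
have E1 : (\int[mu]_(x in Omega) ((a * u x + v x) * partial i f x))%R =
  a * (\int[mu]_(x in Omega) (u x * partial i f x))%R +
  (\int[mu]_(x in Omega) (v x * partial i f x))%R.
  rewrite -RintegralZl//; last exact: (loc_integrable_test_partial oO).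
  rewrite -RintegralD//.
  - by apply: eq_Rintegral => x _; ring.
  - by apply: integrable_scalel => //; exact: (loc_integrable_test_partial oO).
  - exact: (loc_integrable_test_partial oO).
have E2 : (\int[mu]_(x in Omega) ((a *: G x + H x) ord0 i * f x))%R =
  a * (\int[mu]_(x in Omega) (G x ord0 i * f x))%R +
  (\int[mu]_(x in Omega) (H x ord0 i * f x))%R.
  rewrite -RintegralZl//; last exact: (loc_integrable_test oO (lG i)).
  rewrite -RintegralD//.
  - by apply: eq_Rintegral => x _; rewrite !mxE; ring.
  - by apply: integrable_scalel => //; exact: (loc_integrable_test oO (lG i)).
  - exact: (loc_integrable_test oO (lH i)).
by rewrite E1 E2 uG// vH//; ring.
Qed.

(** Both gradients have the same pairings with test functions, so the fundamental lemma applies to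
    each coordinate of their difference. Two functions [u] and [v] appear because almost everywhere
    equal functions are not identified. *)
Lemma weak_grad_unique u v G H : is_weak_grad Omega u G ->
  is_weak_grad Omega v H -> ae_eq_on Omega u v ->
  {ae mu, forall x, Omega x -> G x = H x}.
Proof.
move=> [lu lG uG] [lv lH vH] uv.
have : {ae mu, forall x, forall i, Omega x -> (-1) * G x ord0 i + H x ord0 i = 0}.
  apply: ae_forall_ord => i; apply: (fundamental_lemma oO).
    exact: loc_integrable_lin (lG i) (lH i).
  move=> f fc.
  transitivity ((-1) * (\int[mu]_(x in Omega) (G x ord0 i * f x))%R +
    (\int[mu]_(x in Omega) (H x ord0 i * f x))%R).
    rewrite -RintegralZl//; last exact: (loc_integrable_test oO (lG i)).
    rewrite -RintegralD//.
    - by apply: eq_Rintegral => x _; ring.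
    - by apply: integrable_scalel => //; exact: (loc_integrable_test oO (lG i)).
    - exact: (loc_integrable_test oO (lH i)).
  apply/eqP; rewrite mulN1r addrC subr_eq0; apply/eqP/oppr_inj.
  rewrite -vH// -uG//; apply/esym; apply: Rintegral_ae_eq => //.
  - by apply/measurable_EFinP; exact: measurable_int (loc_integrable_test_partial oO i lu fc).
  - by apply/measurable_EFinP; exact: measurable_int (loc_integrable_test_partial oO i lv fc).
  - by move: uv; apply: filterS => x uv Ox; rewrite uv.
apply: filterS => x Hx Ox; apply/rowP => i; have := Hx i Ox; lra.
Qed.

Lemma wgradP u : weakly_differentiable Omega u -> is_weak_grad Omega u (wgrad Omega u).
Proof. by move=> [G uG]; exact: (@xgetPex _ (fun=> 0) [set G | is_weak_grad Omega u G]) (ex_intro _ G uG). Qed.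

Lemma wgradE u G : is_weak_grad Omega u G ->
  {ae mu, forall x, Omega x -> wgrad Omega u x = G x}.
Proof.
move=> uG; apply: (weak_grad_unique (u := u) (v := u)) => //.
  by apply: wgradP; exists G.
by apply: aeW.
Qed.

Lemma wgrad_lin (a : R) u v : weakly_differentiable Omega u ->
  weakly_differentiable Omega v ->
  {ae mu, forall x, Omega x -> wgrad Omega (fun x => a * u x + v x) x =
    a *: wgrad Omega u x + wgrad Omega v x}.
Proof.
by move=> /wgradP du /wgradP dv; apply: wgradE; exact: is_weak_grad_lin.
Qed.

Lemma wgrad_coord_measurable u i : weakly_differentiable Omega u ->
  measurable_fun Omega (fun x => wgrad Omega u x ord0 i).
Proof. by move=> /wgradP[_ lG _]; exact: loc_integrable_measurable. Qed.

(** Test functions supported in the open set [Omega] minus [K] do not see [u]; the fundamental lemma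
    is applied on that smaller open set. *)
Lemma weak_grad_local u G K : is_weak_grad Omega u G -> compact K ->
  K `<=` Omega -> ae_eq_on Omega u (fun x => u x * \1_K x) ->
  {ae mu, forall x, Omega x -> ~ K x -> G x = 0}.
Proof.
move=> [lu lG uG] cK KO uK.
have clK : closed K := compact_closed (@norm_hausdorff _ _) cK.
have oU : open (Omega `\` K).
  by rewrite setDE; apply: openI => //; exact: closed_openC.
suff : {ae mu, forall x, forall i, (Omega `\` K) x -> G x ord0 i = 0}.
  by apply: filterS => x Hx Ox Kx; apply/rowP => i; rewrite Hx// mxE.
apply: ae_forall_ord => i; apply: (fundamental_lemma oU).
  by move=> L cL LU; apply: lG => // x /LU[].
move=> f fc; have [f1 [L [cL LU f0]]] := fc.
have LO : L `<=` Omega by move=> x /LU[].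
have fcO : C1c Omega f by split => //; exists L.
have mU := open_rV_measurable oU.
rewrite (Rintegral_indic_support _ mU LU)//.
rewrite -(Rintegral_indic_support _ mO LO)//.
apply: oppr_inj; rewrite -uG// oppr0.
rewrite (_ : 0 = (\int[mu]_(x in Omega) 0)%R); last first.
  by rewrite /Rintegral integral0.
apply: Rintegral_ae_eq => //.
  by apply/measurable_EFinP; exact: measurable_int (loc_integrable_test_partial oO i lu fcO).
move: uK; apply: filterS => x uK Ox.
have [Kx|Kx] := pselect (K x).
  rewrite (C1c_partial0 (K := L)) ?mulr0//.
  by move=> /LU[].
by rewrite uK// indicE memNset// mulr0 mul0r.
Qed.

Lemma C1c_integrable f : C1c Omega f -> mu.-integrable setT (EFin \o f) /\
  forall i, mu.-integrable setT (EFin \o partial i f).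
Proof.
move=> fc; have [C C0 [fC pC]] := C1c_bounds fc.
case: (fc) => f1 [K [cK KO f0]].
have [M M0 KM] := compact_in_ball cK.
have z x : M <= `|x| -> ~ K x by move=> xM /KM; rewrite ltNge xM.
split=> [|i].
  apply: (integrable_bounded_support M0 (C1_measurable f1) fC) => x /z; exact: f0.
apply: (integrable_bounded_support M0 (C1_partial_measurable i f1) (pC i)) => x /z.
exact: C1c_partial0 cK f0.
Qed.

(** Integration by parts: the derivative of the product [f g] integrates to 0 over the whole space
    by [integral_line_derivative], and the Leibniz rule splits it. *)
Lemma C1c_weak_grad f : C1c Omega f -> is_weak_grad Omega f (classical_grad f).
Proof.
move=> fc; have [ifT ipT] := C1c_integrable fc; split.
- by move=> K cK KO; apply: integrableS ifT => //; exact: compact_rV_measurable.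
- move=> i K cK KO; have := integrableS measurableT (compact_rV_measurable cK) (@subsetT _ K) (ipT i).
  by congr (mu.-integrable _ _); apply/funext => x; rewrite /= mxE.
move=> g gc i.
have [C C0 [fC pC]] := C1c_bounds fc; have [D D0 [gD pD]] := C1c_bounds gc.
case: (fc) => f1 [K [cK KO f0]]; case: (gc) => g1 [L [cL LO g0]].
have [M M0 KM] := compact_in_ball cK.
have EP : partial i (fun x => f x * g x) = (fun x => f x * partial i g x + g x * partial i f x).
  by apply/funext => x; exact: partialM.
have I0 : (\int[mu]_x partial i (fun x => (f x * g x)%R) x)%R = 0.
  apply: (integral_line_derivative (M := M) (K := C * D + D * C)) => //.
  - by apply: measurable_funM; exact: C1_measurable.
  - rewrite -/(partial i _) EP; apply: measurable_funD; apply: measurable_funM;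
      (exact: C1_measurable || exact: C1_partial_measurable).
  - move=> x xM; rewrite f0 ?mul0r// => /KM; by rewrite ltNge xM.
  - by exists (C * D) => x; rewrite normrM ler_pM.
  - by move=> x; apply: (@derivableM _ _ f g); exact: C1_derivable.
  - move=> x; rewrite -/(partial i _ x) EP; apply: le_trans (ler_normD _ _) _.
    by rewrite !normrM lerD// ler_pM.
have i1 : mu.-integrable setT (EFin \o (fun x => f x * partial i g x)).
  by apply: (integrable_bounded_mul (C := D)) => //; exact: C1_partial_measurable.
have i2 : mu.-integrable setT (EFin \o (fun x => partial i f x * g x)).
  by apply: (integrable_bounded_mul (C := D)) => //; exact: C1_measurable.
have T (F h : 'rV[R]_n -> R) (J : set 'rV[R]_n) : J `<=` Omega -> (forall x, ~ J x -> h x = 0) ->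
    (\int[mu]_(x in Omega) (F x * h x))%R = (\int[mu]_x (F x * h x))%R.
  move=> JO h0; rewrite Rintegral_mkcond; apply: eq_Rintegral => x _; rewrite patchE.
  case: ifPn => // /negP xO; rewrite h0 ?mulr0// => /JO Ox; apply: xO; exact: mem_set.
rewrite (T _ _ L)//; last by move=> x; exact: C1c_partial0 cL g0.
under [in RHS]eq_Rintegral do rewrite mxE.
rewrite (T _ _ L)//; apply/eqP; rewrite -addr_eq0; apply/eqP.
rewrite -RintegralD// -[RHS]I0; apply: eq_Rintegral => x _; rewrite EP; ring.
Qed.

(** A test function and its partial derivatives are bounded by some [C], so L^1 errors [e] move each
    side of the defining identity by at most [C e]. The approximant may depend on the coordinate. *)
Lemma is_weak_grad_L1_limit u G :
  mu.-integrable Omega (EFin \o u) ->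
  (forall i, mu.-integrable Omega (fun x => (G x ord0 i)%:E)) ->
  (forall i (e : R), 0 < e -> exists v H, [/\ is_weak_grad Omega v H,
    mu.-integrable Omega (EFin \o v),
    mu.-integrable Omega (fun x => (H x ord0 i)%:E),
    (\int[mu]_(x in Omega) `|u x - v x|%:E <= e%:E)%E &
    (\int[mu]_(x in Omega) `|G x ord0 i - H x ord0 i|%:E <= e%:E)%E]) ->
  is_weak_grad Omega u G.
Proof.
move=> iu iG A; split.
- by move=> K cK KO; apply: integrableS iu => //; exact: compact_rV_measurable.
- by move=> i K cK KO; apply: integrableS (iG i) => //; exact: compact_rV_measurable.
move=> f fc i; have [C C0 [fC pC]] := C1c_bounds fc.
case: (fc) => f1 [K [cK KO f0]].
have mf : measurable_fun Omega f by apply: measurable_funTS; exact: C1_measurable.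
have mp : measurable_fun Omega (partial i f).
  by apply: measurable_funTS; exact: C1_partial_measurable.
have key (U V F : 'rV[R]_n -> R) (e : R) : mu.-integrable Omega (EFin \o U) ->
    mu.-integrable Omega (EFin \o V) -> measurable_fun Omega F ->
    (forall x, `|F x| <= C) ->
    (\int[mu]_(x in Omega) `|U x - V x|%:E <= e%:E)%E ->
    `|(\int[mu]_(x in Omega) (U x * F x))%R - (\int[mu]_(x in Omega) (V x * F x))%R| <= C * e.
  move=> iU iV mF FC Ue.
  have mU : measurable_fun Omega U by apply/measurable_EFinP; exact: measurable_int iU.
  have mV : measurable_fun Omega V by apply/measurable_EFinP; exact: measurable_int iV.
  have bF (W : 'rV[R]_n -> R) : mu.-integrable Omega (EFin \o W) ->
      mu.-integrable Omega (EFin \o (fun x => W x * F x)).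
    move=> iW; have mW : measurable_fun Omega W by apply/measurable_EFinP; exact: measurable_int iW.
    apply: (@le_integrable _ _ _ mu Omega mO _ (fun x => (C * W x)%:E)).
    - by apply/measurable_EFinP; exact: measurable_funM.
    - move=> x _; rewrite /= lee_fin !normrM mulrC ler_wpM2r//.
      exact: le_trans (FC x) (ler_norm _).
    - exact: integrable_scalel.
  have iUV : mu.-integrable Omega (EFin \o (fun x => U x - V x)) by exact: integrable_subr.
  rewrite -RintegralB//; [|exact: bF|exact: bF].
  have i3 : mu.-integrable Omega (EFin \o (fun x => U x * F x - V x * F x)).
    by apply: integrable_subr => //; exact: bF.
  apply: le_trans (le_normr_Rintegral mO i3) _.
  rewrite -lee_fin /Rintegral fineK; last first.
    by apply: integrable_fin_num => //; exact: (integrable_norm i3).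
  apply: (@le_trans _ _ (C%:E * \int[mu]_(x in Omega) `|U x - V x|%:E)%E).
    apply: integral_leZ => //.
    - apply: measurableT_comp => //; apply: measurable_funB; exact: measurable_funM.
    - by apply: measurableT_comp => //; exact: measurable_funB.
    - by move=> x _; rewrite -mulrBl normrM mulrC ler_wpM2r.
  by rewrite EFinM; apply: lee_wpmul2l.
apply/eqP; rewrite -subr_eq0 opprK -normr_eq0; apply/eqP/le_anti/andP; split => //.
apply/ler_addgt0Pr => e e0; rewrite add0r.
(* Two errors of [C] times this quantity add up to at most [e]; [C + 1] avoids dividing by 0. *)
have e1 : 0 < e / (2 * (C + 1)) by rewrite divr_gt0// mulr_gt0// ltr_wpDl.
have [v [H [[lv lH vH] iv iH Iu IG]]] := A i _ e1.
have B1 := key _ _ _ _ iu iv mp (pC i) Iu.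
have B2 := key _ _ _ _ (iG i) iH mf fC IG.
have := vH f fc i.
move: B1 B2; set a := Rintegral _ _ _; set b := Rintegral _ _ _; set a' := Rintegral _ _ _.
set b' := Rintegral _ _ _ => B1 B2 E.
have -> : a + a' = (a - b) + (a' - b') by rewrite E; ring.
apply: le_trans (ler_normD _ _) _; apply: le_trans (lerD B1 B2) _.
have -> : C * (e / (2 * (C + 1))) + C * (e / (2 * (C + 1))) = e * (C / (C + 1)).
  by field; rewrite gt_eqF// ltr_wpDl.
rewrite ler_piMr ?(ltW e0)// ler_pdivrMr ?ltr_wpDl// mul1r; lra.
Qed.

End weak_gradients.

(** * Poincare inequality and approximation by test functions *)

Section powR_derivative.
Variable R : realType.

(** The last factor [t] makes the value 0 at [t = 0], whatever the convention for [0^(q-2)]. *)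
Definition dpowR (q t : R) := q * `|t| `^ (q - 2) * t.

Lemma dpowR_norm (q t : R) : 1 < q -> `|dpowR q t| = q * `|t| `^ (q - 1).
Proof.
move=> q1; have q0 : 0 < q by lra.
rewrite /dpowR !normrM [`|q|]gtr0_norm// [`|_ `^ _|]ger0_norm ?powR_ge0// -mulrA.
congr (_ * _); have [->|t0] := eqVneq t 0.
  by rewrite normr0 mulr0 powR0// gt_eqF// subr_gt0.
have -> : q - 1 = (q - 2) + 1 by ring.
by rewrite [RHS]powRD; [rewrite powRr1|rewrite normr_eq0 t0 implybT].
Qed.

(** Positive points use the derivative of a real power and negative ones the evenness of [|t|^q]; at
    0 the difference quotient has absolute value [|h|^(q-1)], which tends to 0 because [q > 1]. *)
Lemma is_derive_powR_norm (q t : R) : 1 < q ->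
  is_derive t 1 (fun s => `|s| `^ q) (dpowR q t).
Proof.
move=> q1; have q0 : 0 < q by lra.
have pos (s : R) : 0 < s -> is_derive s 1 (fun s => `|s| `^ q) (dpowR q s).
  move=> s0; have H := is_derive1_powR q s0.
  have E : {near s, (fun s => s `^ q) =1 (fun s => `|s| `^ q)}.
    have : \forall x \near s, 0 < x by exact: lt_nbhsr.
    by apply: filterS => x x0; rewrite gtr0_norm.
  have -> : dpowR q s = q * s `^ (q - 1).
    rewrite /dpowR gtr0_norm// -mulrA; congr (_ * _).
    have -> : q - 1 = (q - 2) + 1 by ring.
    by rewrite [RHS]powRD ?(powRr1 (ltW s0))// (gt_eqF s0) implybT.
  split; first by apply: near_eq_derivable E _; case: H.
  by rewrite -(near_eq_derive _ E); case: H.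
have [t0|t0|<-] := ltgtP 0 t; first exact: pos.
  have H : is_derive (- t) 1 (fun s => `|s| `^ q) (dpowR q (- t)).
    by apply: pos; rewrite oppr_gt0.
  have -> : (fun s : R => `|s| `^ q) = (fun s => `|s| `^ q) \o (-%R).
    by apply/funext => s /=; rewrite normrN.
  have H2 : is_derive t 1 (-%R : R -> R) (-1) by exact: is_deriveN.
  apply: is_derive_eq.
  by rewrite /dpowR normrN; ring.
rewrite /dpowR mulr0.
have Hc : (fun h : R^o => h^-1 *: (((fun s : R^o => `|s| `^ q : R^o) \o shift (0 : R^o))
    (h *: (1 : R^o)) - (`|0 : R| `^ q : R^o))) @ 0^' --> (0 : R^o).
  apply/cvgrPdist_le => e e0; near=> h.
  have h0 : h != 0 by near: h; exact: nbhs_dnbhs_neq.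
  rewrite sub0r normrN /= addr0 normr0 powR0 ?gt_eqF// subr0 [h *: 1]mulr1.
  rewrite normrM normfV [`|_ `^ _|]ger0_norm ?powR_ge0//.
  rewrite -mulr_powRB1// mulKf ?normr_eq0//.
  have -> : e = (e `^ (q - 1)^-1) `^ (q - 1).
    by rewrite -powRrM mulVf ?powRr1 ?ltW// gt_eqF// subr_gt0.
  apply: ge0_ler_powR; rewrite ?nnegrE ?powR_ge0 ?subr_ge0 ?(ltW q1)//.
  by near: h; apply: dnbhs0_le; exact: powR_gt0.
by split; [apply/cvg_ex; exists 0|exact: cvg_lim Hc].
Unshelve. all: by end_near. Qed.

End powR_derivative.

(** * Poincare's inequality for test functions *)

Section poincare.
Variables (R : realType) (n : nat) (Omega : set 'rV[R]_n.+1).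
Hypothesis oO : open Omega.
Local Notation mu := (lebesgue_rV R n.+1).
Local Notation e0 := (delta_mx ord0 ord0 : 'rV[R]_n.+1).
Implicit Types (f : 'rV[R]_n.+1 -> R).

Let mO : measurable Omega := open_rV_measurable oO.

Lemma is_derive_comp_scalar f (g : R -> R) (dg : R) x v : differentiable f x ->
  is_derive (f x) 1 g dg -> is_derive x v (g \o f) (dg * 'D_v f x).
Proof.
move=> df [dg1 dgE].
have dG : differentiable g (f x) by exact/derivable1_diffP.
have dC := differentiable_comp df dG.
split; first exact: diff_derivable.
rewrite deriveE// diff_comp//= deriveE// diff1E//= derive1E dgE.
by rewrite /GRing.scale/= mulrC.
Qed.

Lemma is_derive_coord0 x : is_derive x e0 (fun y : 'rV[R]_n.+1 => y ord0 ord0) 1.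
Proof.
have E : \forall h \near (0 : R)^', h^-1 *: (((fun y : 'rV[R]_n.+1 => y ord0 ord0 : R)
    \o shift x) (h *: e0) - x ord0 ord0) = 1.
  near=> h; have h0 : h != 0 by near: h; exact: nbhs_dnbhs_neq.
  by rewrite /= !mxE eqxx mulr1 addrK /GRing.scale/= mulVf.
split; first exact: is_cvg_near_cst E.
by apply: lim_near_cst => //; exact: E.
Unshelve. all: by end_near. Qed.

(** Twice the constant [N] found in [C1c_poincare], that is [2 M^q (l^(1-q))^q] with
    [l = 1 / (2 q)]. The factor 2 comes from absorbing half of the integral of [|f|^q]. *)
Definition poincare_cst (M q : R) : R :=
  2 * ((M `^ q) * ((2 * q)^-1 `^ (1 - q)) `^ q).

(* The divergence of x_0 |f|^q e_0 integrates to 0. *)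
Lemma C1c_poincare (M q : R) f : 1 < q -> 0 < M ->
  (forall x, Omega x -> `|x| < M) -> C1c Omega f ->
  (\int[mu]_(x in Omega) (`|f x| `^ q)%:E <= (poincare_cst M q)%:E *
   \int[mu]_(x in Omega) (`|partial ord0 f x| `^ q)%:E)%E.
Proof.
move=> q1 M0 OM fc; have q0 : 0 < q by lra.
have [C C0 [fC pC]] := C1c_bounds fc; case: (fc) => f1 [K [cK KO f0]].
have fM x : M <= `|x| -> f x = 0.
  by move=> xM; apply: f0 => /KO/OM; rewrite ltNge xM.
have pM x : M <= `|x| -> partial ord0 f x = 0.
  by move=> xM; apply: (C1c_partial0 _ cK f0) => /KO/OM; rewrite ltNge xM.
have mf := C1_measurable f1; have mp := C1_partial_measurable ord0 f1.
(* [a + b] is the derivative of [F = x_0 |f|^q] along the first axis: [a] comes from differentiating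
   [x_0], [b] from differentiating the power. *)
pose a (x : 'rV[R]_n.+1) := `|f x| `^ q; pose b (x : 'rV[R]_n.+1) := x ord0 ord0 * (dpowR q (f x) * partial ord0 f x).
pose F (x : 'rV[R]_n.+1) := x ord0 ord0 * a x.
have dF x : is_derive x e0 F (a x + b x).
  have H1 := is_derive_coord0 x.
  have H2 := is_derive_comp_scalar e0 (f1.1 x) (is_derive_powR_norm (f x) q1).
  apply: (is_derive_eq (is_deriveM H1 H2)).
  by rewrite /GRing.scale/= mulr1 addrC; congr (_ + _).
have a_ge0 x : 0 <= a x by exact: powR_ge0.
have aC x : a x <= C `^ q.
  by apply: ge0_ler_powR; rewrite ?nnegrE ?(ltW q0).
have aM x : M <= `|x| -> a x = 0.
  by move=> xM; rewrite /a fM// normr0 powR0// gt_eqF.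
have bM x : M <= `|x| -> b x = 0 by move=> xM; rewrite /b pM// !mulr0.
have bb x : `|b x| <= q * M * `|f x| `^ (q - 1) * `|partial ord0 f x|.
  have [xM|xM] := leP M `|x|.
    by rewrite bM// normr0 !mulr_ge0 ?powR_ge0 ?(ltW q0) ?(ltW M0).
  rewrite /b normrM [`|dpowR _ _ * _|]normrM dpowR_norm//.
  rewrite [q * M]mulrC -!mulrA ler_wpM2r//.
    by rewrite !mulr_ge0 ?powR_ge0 ?(ltW q0).
  exact: le_trans (coord_norm_le _ _) (ltW xM).
have bC x : `|b x| <= q * M * C `^ (q - 1) * C.
  apply: le_trans (bb x) _; apply: ler_pM => //.
    by rewrite !mulr_ge0 ?powR_ge0 ?(ltW q0) ?(ltW M0).
  rewrite ler_wpM2l ?mulr_ge0 ?(ltW q0) ?(ltW M0)//.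
  by apply: ge0_ler_powR; rewrite ?nnegrE ?subr_ge0 ?(ltW q1).
have ma : measurable_fun [set: 'rV[R]_n.+1] a by exact: measurable_powR_norm.
have mc : measurable_fun [set: 'rV[R]_n.+1] (fun x : 'rV[R]_n.+1 => x ord0 ord0).
  exact: measurable_coord.
have mb : measurable_fun [set: 'rV[R]_n.+1] b.
  apply: measurable_funM => //; apply: measurable_funM => //.
  apply: measurable_funM => //; apply: measurable_funM => //.
  exact: measurable_powR_norm.
have mF : measurable_fun [set: 'rV[R]_n.+1] F by exact: measurable_funM.
have ia : mu.-integrable setT (EFin \o a).
  apply: (integrable_bounded_support M0 ma (C := C `^ q)) aM => x.
  by rewrite ger0_norm.
have ib : mu.-integrable setT (EFin \o b).
  exact: (integrable_bounded_support M0 mb bC) bM.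
have DE : 'D_e0 F = (fun x => a x + b x) by apply/funext => x; have [] := dF x.
have I0 : (\int[mu]_x (a x + b x))%R = 0.
  have := @integral_line_derivative R n.+1 F e0 M (C `^ q + q * M * C `^ (q - 1) * C) M0 mF.
  rewrite DE; apply.
  - exact: measurable_funD.
  - by move=> x /aM; rewrite /F => ->; rewrite mulr0.
  - exists (M * C `^ q) => x; have [xM|xM] := leP M `|x|.
      by rewrite /F aM// mulr0 normr0 mulr_ge0 ?powR_ge0 ?(ltW M0).
    rewrite normrM; apply: ler_pM => //; last by rewrite ger0_norm.
    by apply: le_trans (coord_norm_le _ _) (ltW xM).
  - by move=> x; have [] := dF x.
  - move=> x; apply: (@le_trans _ _ `|a x + b x|).
      by have [_ <-] := dF x; exact: lexx.
    by apply: le_trans (ler_normD _ _) _; rewrite lerD// ger0_norm.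
(* Young's inequality is applied to [l |f|] and [l^(1-q) M |partial f|], whose weights cancel in the
   product. Then [(q - 1) l^q <= (q - 1) l <= 1/2], so half of the integral of [|f|^q] survives on
   the left. *)
pose l : R := (2 * q)^-1.
have l0 : 0 < l by rewrite invr_gt0 mulr_gt0.
have l1 : l <= 1 by rewrite invf_le1 ?mulr_gt0//; lra.
pose N : R := M `^ q * (l `^ (1 - q)) `^ q.
have N0 : 0 <= N by rewrite mulr_ge0 ?powR_ge0.
have young x : - b x <= 2^-1 * a x + N * `|partial ord0 f x| `^ q.
  apply: (@le_trans _ _ (q * M * `|f x| `^ (q - 1) * `|partial ord0 f x|)).
    by apply: le_trans (bb x); rewrite -normrN ler_norm.
  have H := @young_powR R (l * `|f x|) (M * `|partial ord0 f x| * l `^ (1 - q)) q.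
  have {}H := H (mulr_ge0 (ltW l0) (normr_ge0 _))
    (mulr_ge0 (mulr_ge0 (ltW M0) (normr_ge0 _)) (powR_ge0 _ _)) (ltW q1).
  have E : q * (l * `|f x|) `^ (q - 1) * (M * `|partial ord0 f x| * l `^ (1 - q)) =
      q * M * `|f x| `^ (q - 1) * `|partial ord0 f x|.
    rewrite powRM ?(ltW l0)//.
    have -> : l `^ (1 - q) = (l `^ (q - 1))^-1 by rewrite -powRN opprB.
    by field; rewrite gt_eqF// powR_gt0.
  rewrite -E; apply: le_trans H _; apply: lerD; last first.
    rewrite powRM ?powR_ge0 ?mulr_ge0 ?(ltW M0)// powRM ?(ltW M0)//.
    by rewrite /N mulrAC.
  rewrite powRM ?(ltW l0)// mulrA ler_wpM2r//.
  apply: (@le_trans _ _ ((q - 1) * l)).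
    rewrite ler_wpM2l ?subr_ge0 ?(ltW q1)//.
    have := powR_le_lin (ltW l0) l1 (ltW q1); by rewrite powR1 mul1r.
  by rewrite /l ler_pdivrMr ?mulr_gt0//; lra.
have mpq : measurable_fun [set: 'rV[R]_n.+1] (fun x => `|partial ord0 f x| `^ q).
  exact: measurable_powR_norm.
have ip : mu.-integrable setT (EFin \o (fun x => `|partial ord0 f x| `^ q)).
  apply: (integrable_bounded_support M0 mpq (C := C `^ q)).
    by move=> x; rewrite ger0_norm ?powR_ge0//; apply: ge0_ler_powR; rewrite ?nnegrE ?(ltW q0).
  by move=> x /pM ->; rewrite normr0 powR0// gt_eqF.
set A := (\int[mu]_x a x)%R; set P := (\int[mu]_x (`|partial ord0 f x| `^ q))%R.
have AP : A <= 2 * N * P.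
  have H1 : A + (\int[mu]_x b x)%R = 0 by rewrite /A -RintegralD.
  have H2 : - (\int[mu]_x b x)%R <= 2^-1 * A + N * P.
    rewrite -mulN1r -RintegralZl// /A /P -!RintegralZl// -RintegralD//; last 2 first.
    - exact: integrable_scalel.
    - exact: integrable_scalel.
    apply: le_Rintegral => //.
    - exact: integrable_scalel.
    - by apply: integrable_addr => //; exact: integrable_scalel.
    - by move=> x _; rewrite mulN1r; exact: young.
  lra.
have T (g : 'rV[R]_n.+1 -> R) : (forall x, ~ K x -> g x = 0) -> mu.-integrable setT (EFin \o g) ->
    (\int[mu]_(x in Omega) (g x)%:E = (\int[mu]_x g x)%R%:E)%E.
  move=> g0 ig; rewrite /Rintegral fineK; last exact: integrable_fin_num.
  rewrite [LHS]integral_mkcond; apply: eq_integral => x _; rewrite patchE.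
  case: ifPn => // /negP xO; rewrite g0// => /KO Ox; apply: xO; exact: mem_set.
rewrite (T a)//; last by move=> x Kx; rewrite /a f0// normr0 powR0// gt_eqF.
rewrite (T (fun x => `|partial ord0 f x| `^ q))//; last first.
  by move=> x Kx; rewrite (C1c_partial0 _ cK f0 Kx) normr0 powR0// gt_eqF.
Qed.

End poincare.

(** * Approximation by test functions *)

Section sobolev_approximation.
Variables (R : realType) (n : nat) (Omega : set 'rV[R]_n).
Hypothesis oO : open Omega.
Local Notation mu := (lebesgue_rV R n).
Implicit Types (f u v : 'rV[R]_n -> R) (G : 'rV[R]_n -> 'rV[R]_n).

Let mO : measurable Omega := open_rV_measurable oO.

(** The reciprocal of [1] plus the sum of the [1 / d i] is a positive lower bound that also makes
    sense for an empty family. *)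
Lemma ord_min_pos m (d : 'I_m -> R) : (forall i, 0 < d i) ->
  exists2 r, 0 < r & forall i, r <= d i.
Proof.
move=> d0; have S0 : 0 <= \sum_i (d i)^-1 by rewrite sumr_ge0// => i _; rewrite invr_ge0 ltW.
exists (1 + \sum_i (d i)^-1)^-1; first by rewrite invr_gt0; lra.
move=> i; rewrite -[leRHS]invrK lef_pV2 ?posrE ?invr_gt0//; last by lra.
rewrite (bigD1 i)//= addrCA lerDl addr_ge0// sumr_ge0// => j _.
by rewrite invr_ge0 ltW.
Qed.

(** For [x] within [r] of [K], the kernel [y -> mollifier r (x - y)] is supported within [2 r < d]
    of [K], hence is a test function in [Omega], and the definition of the weak gradient moves the
    derivative from the kernel to [u]. For every other [x] both sides vanish. *)
Lemma weak_grad_mollification u G (K : set 'rV[R]_n) (d r : R) :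
  is_weak_grad Omega u G -> compact K -> K `<=` Omega ->
  (forall x y, K x -> `|x - y| < d -> Omega y) ->
  ae_eq_on Omega u (fun x => u x * \1_K x) -> 0 < r -> 2 * r < d ->
  let U := fun x => u x * \1_K x in
  C1c Omega (convolution U (mollifier r)) /\
  forall i, partial i (convolution U (mollifier r)) =
    convolution (fun x => G x ord0 i * \1_K x) (mollifier r).
Proof.
move=> uG cK KO Kd uK r0 rd U; have [lu lG uGf] := uG.
have iU : mu.-integrable setT (EFin \o U) by exact: loc_integrable_indic lu cK KO.
have [g kg] := @mollifier_C11 R n r r0.
have UC := conv_C11 iU kg.
have far x : ~ thickening K r x -> forall y, K y -> r < `|x - y|.
  by move=> Kx y Ky; rewrite ltNge; apply/negP => xy; apply: Kx; exact: in_thickening xy.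
have zero (V : 'rV[R]_n -> R) (k : 'rV[R]_n -> R) x :
    (forall z, r < `|z| -> k z = 0) -> ~ thickening K r x ->
    convolution (fun x => V x * \1_K x) k x = 0.
  move=> k0 /far fx; rewrite /convolution (_ : 0 = (\int[mu]_y 0)%R); last first.
    by rewrite /Rintegral integral0.
  apply: eq_Rintegral => y _; rewrite indicE.
  have [/set_mem Ky|] := boolP (y \in K); last by rewrite mulr0 mul0r.
  by rewrite k0 ?mulr0//; exact: fx.
have m0 (z : 'rV[R]_n) : r < `|z| -> mollifier r z = 0 by move=> zr; rewrite mollifier_eq0// ltW.
split.
  split; first exact: C11_C1 UC.
  exists (thickening K r); split; first exact: thickening_compact.
    move=> x /thickeningP[|y Ky xy]; first exact: ltW.
    by apply: (Kd y) => //; rewrite distrC; apply: le_lt_trans xy _; lra.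
  by move=> x; exact: zero.
move=> i; rewrite (C11_partial i UC); apply/funext => x.
have g0 z : r < `|z| -> g i z = 0.
  move=> zr; rewrite -(C11_partial i kg).
  have cB : compact (thickening [set (0 : 'rV[R]_n)] r).
    by apply: thickening_compact; exact: compact_set1.
  apply: (C1c_partial0 _ cB).
    move=> y yr; apply: m0; rewrite ltNge; apply/negP => yr'; apply: yr.
    by apply: (in_thickening (y := 0)) => //; rewrite subr0.
  by move=> /thickeningP[|y -> ]; [exact: ltW|rewrite subr0 leNgt zr].
have [Tx|Tx] := pselect (thickening K r x); last by rewrite !zero.
have [y0 Ky0 xy0] := thickeningP (ltW r0) Tx.
pose B := thickening [set x] r.
have cB : compact B by apply: thickening_compact; exact: compact_set1.
have BO : B `<=` Omega.
  move=> y /thickeningP[|z -> yx]; first exact: ltW.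
  apply: (Kd y0) => //; have := ler_normD (y0 - x) (x - y); rewrite addrA subrK.
  rewrite distrC in xy0; rewrite distrC in yx.
  move: (`|y0 - y|) (`|y0 - x|) (`|x - y|) xy0 yx => a1 a2 a3; lra.
pose psi y := mollifier r (x - y).
have kr := C11_reflect x kg.
have psi0 y : ~ B y -> psi y = 0.
  move=> By; apply: m0; rewrite ltNge; apply/negP => xy; apply: By.
  by apply: (in_thickening (y := x)) => //; rewrite distrC.
have psic : C1c Omega psi by split; [exact: C11_C1 kr|exists B].
have [C C0 [psiC ppsiC]] := C1c_bounds psic.
have key (V F : 'rV[R]_n -> R) : loc_integrable Omega V ->
    {ae mu, forall x, Omega x -> V x = V x * \1_K x} ->
    measurable_fun [set: 'rV[R]_n] F -> mu.-integrable Omega (fun y => (V y * F y)%:E) ->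
    (\int[mu]_(y in Omega) (V y * F y))%R = (\int[mu]_y (V y * \1_K y * F y))%R.
  move=> lV VK mF iVF.
  have E : (\int[mu]_(y in Omega) (V y * \1_K y * F y))%R = (\int[mu]_y (V y * \1_K y * F y))%R.
    rewrite Rintegral_mkcond; apply: eq_Rintegral => y _; rewrite patchE.
    case: ifPn => // /negP yO; rewrite indicE memNset ?mulr0 ?mul0r//.
    by move=> /KO Oy; apply: yO; exact: mem_set.
  rewrite -E; apply: Rintegral_ae_eq => //.
  - by apply/measurable_EFinP; exact: measurable_int iVF.
  - apply: measurable_funM; last exact: measurable_funTS.
    apply: measurable_funM; first exact: loc_integrable_measurable.
    by apply: measurable_indic; exact: compact_rV_measurable.
  - by move: VK; apply: filterS => y VK Oy; rewrite {1}VK.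
have := uGf psi psic i.
rewrite (key u)//; [|exact: C1_partial_measurable psic.1|exact: (loc_integrable_test_partial oO)].
rewrite (key (fun y => G y ord0 i))//; last 3 first.
- have := weak_grad_local oO uG cK KO uK; apply: filterS => y Gy Oy.
  have [Ky|Ky] := pselect (K y); first by rewrite indicE mem_set// mulr1.
  by rewrite Gy// mxE mul0r.
- exact: C1_measurable psic.1.
- exact: (loc_integrable_test oO (lG i) psic).
rewrite (C11_partial i kr) => H; apply: oppr_inj; rewrite -[RHS]H /convolution.
rewrite -mulN1r -RintegralZl//; last first.
  apply: (integrable_bounded_mul (C := C)) => //.
    by apply: measurable_reflect; exact: continuous_rV_measurable (C11_grad_continuous (i := i) kg).
  by move=> y; have := ppsiC i y; rewrite (C11_partial i kr) normrN.
by apply: eq_Rintegral => y _; rewrite mulN1r mulrN.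
Qed.

(** Closeness to C^1_c(Omega) in the W^{1,q} sense, the defining property of the space
    W_0^{1,q}(Omega), with errors measured coordinate by coordinate. *)
Definition W0_approximable (q : R) u := forall e : R, 0 < e -> exists f,
  [/\ C1c Omega f, (\int[mu]_(x in Omega) (`|f x - u x| `^ q)%:E <= e%:E)%E &
  forall i, (\int[mu]_(x in Omega)
    (`|partial i f x - wgrad Omega u x ord0 i| `^ q)%:E <= e%:E)%E].

Lemma compactly_supported_W0 (q : R) u : 1 <= q -> weakly_differentiable Omega u ->
  compactly_supported Omega u ->
  (\int[mu]_(x in Omega) (`|u x| `^ q)%:E < +oo)%E ->
  (forall i, \int[mu]_(x in Omega) (`|wgrad Omega u x ord0 i| `^ q)%:E < +oo)%E ->
  W0_approximable q u.
Proof.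
move=> q1 /wgradP uG [K [cK KO uK]] uq Gq e e0; have q0 : 0 < q by lra.
set G := wgrad Omega u in uG Gq *; have [lu lG _] := uG.
have [d d0 Kd] := compact_open_thick cK oO KO.
pose U x := u x * \1_K x; pose V i x := G x ord0 i * \1_K x.
have iU : mu.-integrable setT (EFin \o U) by exact: loc_integrable_indic lu cK KO.
have iV i : mu.-integrable setT (EFin \o V i) by exact: loc_integrable_indic (lG i) cK KO.
have mK := compact_rV_measurable cK.
have fin (w : 'rV[R]_n -> R) : measurable_fun Omega w ->
    (\int[mu]_(x in Omega) (`|w x| `^ q)%:E < +oo)%E ->
    (\int[mu]_x (`|w x * \1_K x| `^ q)%:E < +oo)%E.
  move=> mw; apply: le_lt_trans.
  have -> : (\int[mu]_x (`|w x * \1_K x| `^ q)%:E = \int[mu]_(x in K) (`|w x| `^ q)%:E)%E.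
    rewrite [RHS]integral_mkcond; apply: eq_integral => x _; rewrite patchE indicE.
    by case: (x \in K); rewrite ?mulr1// mulr0 normr0 powR0// gt_eqF.
  apply: ge0_subset_integral => //.
  by apply/measurable_EFinP; apply: measurable_powR_normr => //; exact: measurable_cst.
have Uq := fin u (loc_integrable_measurable oO lu) uq.
have Vq i := fin _ (loc_integrable_measurable oO (lG i)) (Gq i).
have [r1 r10 H1] := conv_mollifier_Lq q1 iU Uq e0.
have [r2 r2P] := choice (fun i => let: ex_intro2 r r0 H := conv_mollifier_Lq q1 (iV i) (Vq i) e0 in
  ex_intro (fun r => 0 < r /\ _) r (conj r0 H)).
have [r3 r30 r3P] := ord_min_pos (fun i => (r2P i).1).
(* One radius for everything: [d / 3] keeps [2 r < d], [r1] serves [u], and [r3] serves all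
   coordinates of the gradient. *)
pose r := Num.min (d / 3) (Num.min (r1 / 2) (r3 / 2)).
have r0 : 0 < r by rewrite !lt_min !divr_gt0.
have rd : r <= d / 3 by rewrite /r ge_min lexx.
have rr1 : r <= r1 / 2 by rewrite /r !ge_min lexx orbT.
have rr3 : r <= r3 / 2 by rewrite /r !ge_min lexx !orbT.
have [|fc fp] := weak_grad_mollification uG cK KO Kd uK r0; first lra.
have [g kg] := @mollifier_C11 R n r r0.
have mconv (W : 'rV[R]_n -> R) : mu.-integrable setT (EFin \o W) ->
    measurable_fun [set: 'rV[R]_n] (convolution W (mollifier r)).
  by move=> iW; apply: continuous_rV_measurable; exact: C11_continuous (conv_C11 iW kg).
have key (w : 'rV[R]_n -> R) : loc_integrable Omega w ->
   {ae mu, forall x, Omega x -> w x = w x * \1_K x} ->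
   (\int[mu]_x (`|convolution (fun x => w x * \1_K x) (mollifier r) x - w x * \1_K x| `^ q)%:E <= e%:E)%E ->
   (\int[mu]_(x in Omega) (`|convolution (fun x => w x * \1_K x) (mollifier r) x - w x| `^ q)%:E <= e%:E)%E.
  move=> lw wK; apply: le_trans.
  have iw : mu.-integrable setT (EFin \o (fun x => w x * \1_K x)).
    exact: loc_integrable_indic lw cK KO.
  have mw1 : measurable_fun [set: 'rV[R]_n] (fun x => w x * \1_K x).
    by apply/measurable_EFinP; exact: measurable_int iw.
  have mw := loc_integrable_measurable oO lw.
  have mc := mconv _ iw.
  have mD : measurable_fun [set: 'rV[R]_n] (fun x =>
      `|convolution (fun x => w x * \1_K x) (mollifier r) x - w x * \1_K x| `^ q).
    by apply: measurable_powR_norm; exact: measurable_funB.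
  apply: (@le_trans _ _ (\int[mu]_(x in Omega)
    (`|convolution (fun x => w x * \1_K x) (mollifier r) x - w x * \1_K x| `^ q)%:E)%E).
    rewrite le_eqVlt; apply/orP; left; apply/eqP; apply: ge0_integral_ae_eq => //.
    - apply: measurable_powR_normr => //.
      by apply: measurable_funB => //; exact: measurable_funTS.
    - exact: measurable_funTS.
    - by move: wK; apply: filterS => x wK Ox; congr (`|_ - _| `^ _); rewrite -wK.
  by apply: ge0_subset_integral => //; exact/measurable_EFinP.
exists (convolution U (mollifier r)); split => //.
  by apply: key => //; apply: H1; rewrite r0/=; lra.
move=> i; rewrite fp; apply: (key (fun x => G x ord0 i)) => //.
  have := weak_grad_local oO uG cK KO uK; apply: filterS => y Gy Oy.
  have [Ky|Ky] := pselect (K y); first by rewrite indicE mem_set// mulr1.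
  by rewrite Gy// mxE mul0r.
by apply: (r2P i).2; rewrite r0/=; have := r3P i; lra.
Qed.

End sobolev_approximation.

Section poincare_approximable.
Variables (R : realType) (n : nat) (Omega : set 'rV[R]_n.+1).
Hypothesis oO : open Omega.
Local Notation mu := (lebesgue_rV R n.+1).

Let mO : measurable Omega := open_rV_measurable oO.

(** The inequality for test functions passes to the limit through two quasi-triangle inequalities,
    one for the function and one for its derivative; each contributes a factor [2^q]. *)
Lemma W0_poincare (M q : R) u : 1 < q -> 0 < M ->
  (forall x, Omega x -> `|x| < M) -> weakly_differentiable Omega u ->
  W0_approximable Omega q u ->
  (\int[mu]_(x in Omega) (`|wgrad Omega u x ord0 ord0| `^ q)%:E < +oo)%E ->
  (\int[mu]_(x in Omega) (`|u x| `^ q)%:E <=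
    (2 `^ q * (poincare_cst M q * 2 `^ q))%:E *
    \int[mu]_(x in Omega) (`|wgrad Omega u x ord0 ord0| `^ q)%:E)%E.
Proof.
move=> q1 M0 OM du ua Gfin; have q0 : 0 < q by lra.
have [lu _ _] := wgradP du.
have mu' : measurable_fun Omega u by exact: loc_integrable_measurable.
have mG := wgrad_coord_measurable oO ord0 du.
set G := (\int[mu]_(x in Omega) (`|wgrad Omega u x ord0 ord0| `^ q)%:E)%E in Gfin *.
have G0 : (0 <= G)%E by apply: integral_ge0 => x _; rewrite lee_fin powR_ge0.
have [g Gg] : exists g, G = g%:E by exists (fine G); rewrite fineK// ge0_fin_numE.
rewrite Gg -EFinM; rewrite Gg lee_fin in G0.
set A := 2 `^ q; have A0 : 0 <= A by exact: powR_ge0.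
set P := poincare_cst M q.
have P0 : 0 <= P by rewrite mulr_ge0// mulr_ge0 ?powR_ge0.
apply/lee_addgt0Pr => e e0.
(* [c] is the factor multiplying the approximation error [d] in the final estimate, so
   [d = e / (c + 1)] is small enough. *)
pose c := A + A * (P * A); have c0 : 0 <= c by rewrite addr_ge0// mulr_ge0// mulr_ge0.
have c1 : 0 < c + 1 by lra.
have [f [fc fu fG]] := ua (e / (c + 1)) (divr_gt0 e0 c1).
set d := e / (c + 1) in fu fG.
have mf : measurable_fun Omega f by apply: measurable_funTS; exact: C1_measurable fc.1.
have mpf : measurable_fun Omega (partial ord0 f).
  by apply: measurable_funTS; exact: C1_partial_measurable fc.1.
have split_le (v w : 'rV[R]_n.+1 -> R) : measurable_fun Omega v -> measurable_fun Omega w ->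
   (\int[mu]_(x in Omega) (`|w x| `^ q)%:E <= A%:E *
     (\int[mu]_(x in Omega) (`|v x| `^ q)%:E +
      \int[mu]_(x in Omega) (`|v x - w x| `^ q)%:E))%E.
  move=> mv mw; have H := integral_powR_normD mu mO (ltW q0) mv (measurable_funB mw mv).
  have E1 : (\int[mu]_(x in Omega) (`|v x + (w \- v) x| `^ q)%:E =
      \int[mu]_(x in Omega) (`|w x| `^ q)%:E)%E.
    by apply: eq_integral => x _; rewrite /= addrC subrK.
  have E2 : (\int[mu]_(x in Omega) (`|(w \- v) x| `^ q)%:E =
      \int[mu]_(x in Omega) (`|v x - w x| `^ q)%:E)%E.
    by apply: eq_integral => x _; rewrite distrC.
  by rewrite E1 E2 in H; exact: H.
have I1 := split_le _ _ mf mu'.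
have I2 : (\int[mu]_(x in Omega) (`|partial ord0 f x| `^ q)%:E <= (A * (g + d))%:E)%E.
  have := split_le _ _ mG mpf; rewrite -/G Gg => I2; apply: le_trans I2 _; rewrite EFinM EFinD.
  apply: lee_wpmul2l; first by rewrite lee_fin.
  apply: leeD2l; rewrite (_ : (\int[mu]_(x in Omega) _)%E = (\int[mu]_(x in Omega)
    (`|partial ord0 f x - wgrad Omega u x ord0 ord0| `^ q)%:E)%E); first exact: fG.
  by apply: eq_integral => x _; rewrite distrC.
have I3 : (\int[mu]_(x in Omega) (`|f x| `^ q)%:E <= (P * (A * (g + d)))%:E)%E.
  have H := C1c_poincare q1 M0 OM fc; apply: le_trans H _.
  by rewrite (EFinM P); apply: lee_wpmul2l; first by rewrite lee_fin.
apply: le_trans I1 _; apply: (@le_trans _ _ (A%:E * ((P * (A * (g + d)))%:E + d%:E))%E).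
  by apply: lee_wpmul2l; [rewrite lee_fin|exact: leeD].
rewrite -!EFinD -EFinM lee_fin.
have -> : A * (P * (A * (g + d)) + d) = A * (P * A) * g + c * d by rewrite /c; ring.
rewrite lerD2l /d mulrCA ler_piMr ?(ltW e0)// ler_pdivrMr// mul1r; lra.
Qed.

End poincare_approximable.

(** * Uniform convexity of powers of the Euclidean norm *)

Section euclidean_norm.
Variables (R : realType) (n : nat).
Implicit Types (v w : 'rV[R]_n) (a : R).

Lemma dotvC v w : dotv v w = dotv w v.
Proof. by apply: eq_bigr => i _; rewrite mulrC. Qed.

Lemma dotvDr v w u : dotv v (w + u) = dotv v w + dotv v u.
Proof. by rewrite -big_split; apply: eq_bigr => i _; rewrite mxE mulrDr. Qed.

Lemma dotvZr a v w : dotv v (a *: w) = a * dotv v w.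
Proof. by rewrite mulr_sumr; apply: eq_bigr => i _; rewrite mxE mulrCA. Qed.

Lemma dotvBr v w u : dotv v (w - u) = dotv v w - dotv v u.
Proof. by rewrite dotvDr -scaleN1r dotvZr mulN1r. Qed.

Lemma dotvDl v w u : dotv (w + u) v = dotv w v + dotv u v.
Proof. by rewrite !(dotvC _ v) dotvDr. Qed.

Lemma dotvZl a v w : dotv (a *: w) v = a * dotv w v.
Proof. by rewrite !(dotvC _ v) dotvZr. Qed.

Lemma dotv0r v : dotv v 0 = 0.
Proof. by rewrite -(scale0r 0) dotvZr mul0r. Qed.

Lemma enorm_ge0 v : 0 <= enorm v.
Proof. exact: sqrtr_ge0. Qed.

Lemma sqr_enorm v : enorm v ^+ 2 = dotv v v.
Proof.
rewrite sqr_sqrtr; first by apply: eq_bigr => i _; rewrite expr2.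
by apply: sumr_ge0 => i _; exact: sqr_ge0.
Qed.

Lemma enorm0 : enorm (0 : 'rV[R]_n) = 0.
Proof. by apply/eqP; rewrite -sqrf_eq0 sqr_enorm dotv0r. Qed.

Lemma enormZ a v : enorm (a *: v) = `|a| * enorm v.
Proof.
apply/eqP; rewrite -(@eqrXn2 _ 2) ?enorm_ge0 ?mulr_ge0 ?enorm_ge0//.
by rewrite exprMn !sqr_enorm dotvZl dotvZr real_normK ?num_real// expr2 mulrA.
Qed.

Lemma enormN v : enorm (- v) = enorm v.
Proof. by rewrite -scaleN1r enormZ normrN1 mul1r. Qed.

Lemma coord_enorm v i : `|v ord0 i| <= enorm v.
Proof.
rewrite -(@ler_pXn2r _ 2 isT) ?nnegrE ?enorm_ge0// sqr_enorm real_normK ?num_real//.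
rewrite /dotv (bigD1 i)//= -expr2 lerDl.
by apply: sumr_ge0 => j _; rewrite -expr2 sqr_ge0.
Qed.

Lemma enorm_le_sum v : enorm v <= \sum_i `|v ord0 i|.
Proof.
rewrite -(@ler_pXn2r _ 2 isT) ?nnegrE ?enorm_ge0//; last by apply: sumr_ge0.
rewrite sqr_enorm [leRHS]expr2 mulr_suml; apply: ler_sum => i _.
apply: (@le_trans _ _ (`|v ord0 i| * `|v ord0 i|)); first by rewrite -normrM ler_norm.
by apply: ler_wpM2l => //; rewrite (bigD1 i)//= lerDl sumr_ge0.
Qed.

Lemma enorm_eq0 v : enorm v = 0 -> v = 0.
Proof.
move=> v0; apply/rowP => i; rewrite mxE; apply/eqP.
by rewrite -normr_le0 -v0 coord_enorm.
Qed.

Lemma dotv_le v w : dotv v w <= enorm v * enorm w.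
Proof.
have [/enorm_eq0->|v0] := eqVneq (enorm v) 0.
  by rewrite dotvC dotv0r mulr_ge0 ?enorm_ge0.
have [/enorm_eq0->|w0] := eqVneq (enorm w) 0.
  by rewrite dotv0r mulr_ge0 ?enorm_ge0.
have vp : 0 < enorm v by rewrite lt_def v0 enorm_ge0.
have wp : 0 < enorm w by rewrite lt_def w0 enorm_ge0.
have := sqr_ge0 (enorm (enorm w *: v - enorm v *: w)).
rewrite sqr_enorm dotvBr !(dotvC (_ - _)) !dotvBr !dotvZl !dotvZr -!sqr_enorm (dotvC w v).
have -> : enorm w * (enorm w * enorm v ^+ 2) - enorm w * (enorm v * dotv v w) -
   (enorm v * (enorm w * dotv v w) - enorm v * (enorm v * enorm w ^+ 2)) =
   2 * (enorm v * enorm w) * (enorm v * enorm w - dotv v w) by ring.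
by rewrite pmulr_rge0 ?subr_ge0// !mulr_gt0.
Qed.

Lemma normr_dotv_le v w : `|dotv v w| <= enorm v * enorm w.
Proof.
rewrite ler_norml dotv_le andbT lerNl -mulN1r -dotvZl scaleN1r.
by rewrite -[enorm v]enormN; exact: dotv_le.
Qed.

Lemma enormD v w : enorm (v + w) <= enorm v + enorm w.
Proof.
rewrite -(@ler_pXn2r _ 2 isT) ?nnegrE ?addr_ge0 ?enorm_ge0//.
rewrite sqr_enorm dotvDr !(dotvC (_ + _)) !dotvDr -!sqr_enorm (dotvC w v).
have := dotv_le v w; lra.
Qed.

Lemma measurable_enorm d (T : measurableType d) (D : set T) (G : T -> 'rV[R]_n) :
  measurable D -> (forall i, measurable_fun D (fun x => G x ord0 i)) ->
  measurable_fun D (fun x => enorm (G x)).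
Proof.
move=> mD mG; apply: (@measurableT_comp _ _ _ _ _ _ (@Num.sqrt R)) => //.
  exact: continuous_measurable_fun (@sqrt_continuous R).
by apply: measurable_sum => i; apply: measurable_funX; exact: mG.
Qed.

Lemma measurable_dotv d (T : measurableType d) (D : set T) (G H : T -> 'rV[R]_n) :
  measurable D -> (forall i, measurable_fun D (fun x => G x ord0 i)) ->
  (forall i, measurable_fun D (fun x => H x ord0 i)) ->
  measurable_fun D (fun x => dotv (G x) (H x)).
Proof.
by move=> mD mG mH; apply: measurable_sum => i; apply: measurable_funM.
Qed.

Lemma powRB2M (c q : R) : 0 <= c -> q != 0 -> c `^ (q - 2) * c ^+ 2 = c `^ q.
Proof.
move=> c0 q0; rewrite -powR_mulrn// -powRD ?subrK//.
by rewrite (negbTE q0).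
Qed.

Lemma powRB2M1 (c q : R) : 0 <= c -> q != 1 -> c `^ (q - 2) * c = c `^ (q - 1).
Proof.
move=> c0 q1; rewrite -[X in _ * X = _]powRr1// -powRD.
  by congr (_ `^ _); ring.
by rewrite (_ : q - 2 + 1 = q - 1) ?subr_eq0 ?(negbTE q1)//; ring.
Qed.

(** The tangent inequality of [|.|^q / q] at [v]: Cauchy-Schwarz reduces it to the lengths of [v]
    and [w], where it is [young_powR]. *)
Lemma powR_enorm_convex (q : R) v w : 1 < q ->
  enorm v `^ q / q + enorm v `^ (q - 2) * dotv v (w - v) <= enorm w `^ q / q.
Proof.
move=> q1; have q0 : 0 < q by lra.
have A := enorm_ge0 v; have B := enorm_ge0 w.
have := young_powR A B (ltW q1); have CS := dotv_le v w.
rewrite dotvBr -sqr_enorm mulrBr (powRB2M A (lt0r_neq0 q0)) => Y.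
have : enorm v `^ (q - 2) * dotv v w <= enorm v `^ (q - 1) * enorm w.
  apply: le_trans (ler_wpM2l (powR_ge0 _ _) CS) _.
  by rewrite mulrA powRB2M1 ?gt_eqF.
move: Y; set X := _ `^ (q - 1) * _; rewrite -mulrA -/X => Y Z.
rewrite -(ler_pM2l q0) mulrDr mulrBr.
have -> : q * (enorm v `^ q / q) = enorm v `^ q by field; rewrite gt_eqF.
have -> : q * (enorm w `^ q / q) = enorm w `^ q by field; rewrite gt_eqF.
have := ler_wpM2l (ltW q0) Z; rewrite mulrBl mul1r in Y; lra.
Qed.

End euclidean_norm.

(** * Uniform convexity *)

Section uniform_convexity.
Variable R : realType.

(** Write [t^s = t t^(s-1)] and use that [t^(s-1)] is nondecreasing. *)
Lemma powR_superadd (s a b : R) : 1 <= s -> 0 <= a -> 0 <= b ->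
  a `^ s + b `^ s <= (a + b) `^ s.
Proof.
move=> s1 a0 b0; have s0 : 0 < s by lra.
rewrite -(mulr_powRB1 a0 s0) -(mulr_powRB1 b0 s0) -(mulr_powRB1 (addr_ge0 a0 b0) s0).
rewrite mulrDl; apply: lerD; apply: ler_wpM2l => //; apply: ge0_ler_powR;
  rewrite ?nnegrE ?subr_ge0 ?addr_ge0 ?lerDl ?lerDr//.
Qed.

Lemma powR_subadd (s a b : R) : 0 < s -> s <= 1 -> 0 <= a -> 0 <= b ->
  (a + b) `^ s <= a `^ s + b `^ s.
Proof.
move=> s0 s1 a0 b0.
have H := @powR_superadd s^-1 (a `^ s) (b `^ s).
rewrite -!powRrM mulfV ?gt_eqF// !powRr1// in H.
have {}H := H (_ : 1 <= s^-1) (powR_ge0 _ _) (powR_ge0 _ _).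
have {}H : a + b <= (a `^ s + b `^ s) `^ s^-1 by apply: H; rewrite invf_ge1.
have := @ge0_ler_powR R s (ltW s0) (a + b) ((a `^ s + b `^ s) `^ s^-1).
rewrite !nnegrE addr_ge0// powR_ge0 => /(_ isT isT H).
by rewrite -powRrM mulVf ?gt_eqF// powRr1// addr_ge0 ?powR_ge0.
Qed.

Lemma powR_midpoint (s a b : R) : 1 <= s -> 0 <= a -> 0 <= b ->
  ((a + b) / 2) `^ s <= (a `^ s + b `^ s) / 2.
Proof.
move=> s1 a0 b0; have s0 : 0 < s by lra.
have [c0|c0] := eqVneq ((a + b) / 2) 0.
  by rewrite c0 powR0 ?gt_eqF// divr_ge0// addr_ge0 ?powR_ge0.
have cp : 0 <= (a + b) / 2 by rewrite divr_ge0// addr_ge0.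
have Ya := young_powR cp a0 s1; have Yb := young_powR cp b0 s1.
have E := mulr_powRB1 cp s0.
move: Ya Yb E; move: (_ `^ (s - 1)) (_ `^ s) (a `^ s) (b `^ s) => X Y A B Ya Yb E.
have : s * X * a + s * X * b = 2 * s * Y by rewrite -E; field.
lra.
Qed.

Lemma powR_anti (s a b : R) : s <= 0 -> 0 < a -> a <= b -> b `^ s <= a `^ s.
Proof.
move=> s0 a0 ab; have b0 := lt_le_trans a0 ab.
rewrite -[s]opprK !(powRN _ (- s)) lef_pV2 ?posrE ?powR_gt0//.
by apply: ge0_ler_powR; rewrite ?nnegrE ?oppr_ge0 ?(ltW a0) ?(ltW b0).
Qed.

Section quadratic.
Local Open Scope convex_scope.
Variables (s al be ga e M : R).
Hypotheses (s_half : 1 <= 2 * s) (s1 : s <= 1) (e0 : 0 < e) (ga0 : 0 <= ga).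
(** Intended for [Q t = |x + t y|^2] and [s = q / 2], where [Q_cs] is Cauchy-Schwarz. The shift by
    [e > 0] keeps the base of the power away from 0, where it need not be differentiable. *)
Let Q t := al + 2 * be * t + ga * t ^+ 2.
Hypothesis Q_ge0 : forall t, 0 <= Q t.
Hypothesis Q_cs : forall t, (be + ga * t) ^+ 2 <= ga * Q t.
Hypothesis Q_le : forall t : R, `|t| <= 1 -> Q t <= M.

Let P t := e + Q t.
(** [k] is a lower bound on [[-1, 1]] for the second derivative of [P^s], so subtracting a parabola
    of that curvature leaves the convex function [f]. Its convexity between -1 and 1, read at 0,
    yields the gap [k / 2]. *)
Let k := 2 * (s * (2 * s - 1) * ga * (e + M) `^ (s - 1)).
Let f : R -> R := fun t => P t `^ s - k / 2 * t ^+ 2.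
Let df : R -> R := fun t => s * P t `^ (s - 1) * (2 * (be + ga * t)) - k * t.

Let P_gt0 t : 0 < P t.
Proof. by rewrite ltr_wpDr. Qed.

Let dP (t : R) : is_derive t 1 P (2 * (be + ga * t)).
Proof.
apply: is_derive_eq; rewrite /GRing.scale/=; ring.
Qed.

Let dPs (r t : R) : is_derive t 1 (fun t => P t `^ r) (r * P t `^ (r - 1) * (2 * (be + ga * t))).
Proof. exact: (is_derive1_comp (is_derive1_powR r (P_gt0 t)) (dP t)). Qed.

Let fE (t : R) : is_derive t 1 f (df t).
Proof.
have H := dPs s t.
by apply: is_derive_eq; rewrite /GRing.scale/= /df; field.
Qed.

Let dfE (t : R) : is_derive t 1 df (s * ((s - 1) * P t `^ (s - 2) * (2 * (be + ga * t)) ^+ 2 +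
   P t `^ (s - 1) * (2 * ga)) - k).
Proof.
have H := dPs (s - 1) t.
apply: is_derive_eq; rewrite /GRing.scale/= (_ : s - 1 - 1 = s - 2); ring.
Qed.

(** The first summand is nonpositive as [s <= 1]. By [Q_cs] its modulus, without the outer factor
    [s], is at most [4 (1 - s) ga P^(s-1)]; the positive term [2 ga P^(s-1)] then leaves
    [2 (2 s - 1) ga P^(s-1)], and [P <= e + M] concludes since the exponent is nonpositive. *)
Let ddf_ge0 (t : R) : `|t| <= 1 -> 0 <= s * ((s - 1) * P t `^ (s - 2) * (2 * (be + ga * t)) ^+ 2 +
   P t `^ (s - 1) * (2 * ga)) - k.
Proof.
move=> t1; have s0 : 0 < s by move: s_half; lra.
have P0 := P_gt0 t; rewrite subr_ge0.
have E1 : P t `^ (s - 1) = P t `^ (s - 2) * P t.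
  have -> : s - 1 = (s - 2) + 1 by ring.
  by rewrite powRD ?powRr1 ?(ltW P0)// (gt_eqF P0) implybT.
have A : (2 * (be + ga * t)) ^+ 2 <= 4 * ga * P t.
  have H : (be + ga * t) ^+ 2 <= ga * P t.
    by apply: le_trans (Q_cs t) _; rewrite ler_wpM2l// lerDr ltW.
  have -> : (2 * (be + ga * t)) ^+ 2 = 4 * (be + ga * t) ^+ 2 by ring.
  by rewrite -mulrA ler_wpM2l.
have B : (e + M) `^ (s - 1) <= P t `^ (s - 1).
  by apply: powR_anti => //; [rewrite subr_le0|rewrite lerD2l Q_le].
have D : (1 - s) * P t `^ (s - 2) * (2 * (be + ga * t)) ^+ 2 <=
    (1 - s) * P t `^ (s - 2) * (4 * ga * P t).
  by apply: ler_wpM2l A; rewrite mulr_ge0 ?powR_ge0 ?subr_ge0.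
have F : (2 * s - 1) * ga * (e + M) `^ (s - 1) <= (2 * s - 1) * ga * P t `^ (s - 1).
  by apply: ler_wpM2l B; rewrite mulr_ge0 ?subr_ge0.
have -> : k = s * ((2 * s - 1) * ga * (e + M) `^ (s - 1) * 2) by rewrite /k; ring.
rewrite ler_pM2l//.
move: D F; rewrite E1; move: (P t `^ (s - 2)) ((2 * (be + ga * t)) ^+ 2) ((e + M) `^ (s - 1)).
move=> X Y Z D F; lra.
Qed.

(* (P^s)'' >= 2 s (2 s - 1) ga P^(s-1) for the quadratic P >= e. *)
Lemma powR_quadratic_convex :
  (e + al) `^ s + s * (2 * s - 1) * ga * (e + M) `^ (s - 1) <=
  ((e + (al + 2 * be + ga)) `^ s + (e + (al - 2 * be + ga)) `^ s) / 2.
Proof.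
have D1 : 'D_1 f = df by apply/funext => t; have [] := fE t.
have cf (t : R) : {for t, continuous f}.
  by apply: differentiable_continuous; apply/derivable1_diffP; have [] := fE t.
have h0 : (0 : R) <= 2^-1 by rewrite invr_ge0.
have h1 : (2^-1 : R) <= 1 by rewrite invf_le1// ler1n.
have H : f ((-1 : R^o) <| Itv01 h0 h1 |> (1 : R^o)) <=
    ((f (-1) : R^o) <| Itv01 h0 h1 |> (f 1 : R^o)).
  apply: (@second_derivative_convex R f (-1) 1).
  - move=> x /andP[x1 x2]; rewrite D1.
    have [_ ->] := dfE x; apply: ddf_ge0.
    by rewrite ler_norml !ltW.
  - exact/cvg_at_left_filter/cf.
  - exact/cvg_at_right_filter/cf.
  - by move=> x _; have [] := fE x.
  - by move=> x _; rewrite D1; have [] := dfE x.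
  - lra.
move: H; rewrite !convRE /= /unstable.onem.
have -> : 2^-1 * -1 + (1 - 2^-1) * 1 = 0 :> R by field.
have -> : f 0 = (e + al) `^ s.
  rewrite /f /P /Q; have -> : e + (al + 2 * be * 0 + ga * 0 ^+ 2) = e + al by ring.
  by rewrite expr0n mulr0 subr0.
have -> : f 1 = (e + (al + 2 * be + ga)) `^ s - k / 2.
  rewrite /f /P /Q; have -> : e + (al + 2 * be * 1 + ga * 1 ^+ 2) = e + (al + 2 * be + ga) by ring.
  by rewrite expr1n mulr1.
have -> : f (-1) = (e + (al - 2 * be + ga)) `^ s - k / 2.
  rewrite /f /P /Q.
  have -> : e + (al + 2 * be * -1 + ga * (-1) ^+ 2) = e + (al - 2 * be + ga) by ring.
  by rewrite sqrrN expr1n mulr1.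
have -> : s * (2 * s - 1) * ga * (e + M) `^ (s - 1) = k / 2 by rewrite /k; field.
move: (_ `^ s) (_ `^ s) (_ `^ s) => X Y Z; lra.
Qed.

End quadratic.

(** [powR_quadratic_convex] for [e + |x + t y|^2] with [s = q / 2], after which [e] is removed by
    subadditivity of the power [q / 2]. In the constant, [s (2 s - 1) >= (q - 1) / 2], and a further
    factor 1/2 pays for replacing [e + N^2] by [N^2]. *)
Lemma enorm_gap n (q : R) (x y : 'rV[R]_n) : 1 < q -> q <= 2 -> 0 < enorm y ->
  enorm x `^ q + (q - 1) / 4 * enorm y ^+ 2 * (enorm x + enorm y) `^ (q - 2) <=
  (enorm (x + y) `^ q + enorm (x - y) `^ q) / 2.
Proof.
move=> q1 q2 y0; set N := enorm x + enorm y.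
have x0 := enorm_ge0 x; have N0 : 0 < N by rewrite /N; lra.
have dq (v : 'rV[R]_n) : dotv v v `^ (q / 2) = enorm v `^ q.
  by rewrite -sqr_enorm -powR_mulrn ?enorm_ge0// -powRrM; congr (_ `^ _); field.
have QE t : dotv x x + 2 * dotv x y * t + dotv y y * t ^+ 2 = dotv (x + t *: y) (x + t *: y).
  by rewrite dotvDr !dotvDl !dotvZr !dotvZl (dotvC y x); ring.
apply/ler_addgt0Pr => d d0.
(* The first bound gives [e + N^2 <= 2 N^2]; the second gives [e^(q/2) <= d], the arbitrary error of
   this argument. *)
pose e := Num.min (N ^+ 2) (d `^ (q / 2)^-1).
have e0 : 0 < e by rewrite lt_min exprn_gt0// powR_gt0.
have eN : e <= N ^+ 2 by rewrite ge_min lexx.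
have ed : e `^ (q / 2) <= d.
  apply: (@le_trans _ _ ((d `^ (q / 2)^-1) `^ (q / 2))).
    apply: ge0_ler_powR; rewrite ?nnegrE ?(ltW e0) ?powR_ge0 ?ge_min ?lexx ?orbT//.
    by rewrite divr_ge0//; lra.
  by rewrite -powRrM mulVf ?powRr1 ?(ltW d0)// gt_eqF// divr_gt0//; lra.
have := @powR_quadratic_convex (q / 2) (dotv x x) (dotv x y) (dotv y y) e (N ^+ 2) _ _ e0 _ _ _ _.
have -> : dotv x x + 2 * dotv x y + dotv y y = dotv (x + y) (x + y).
  by rewrite dotvDr !dotvDl (dotvC y x); ring.
have -> : dotv x x - 2 * dotv x y + dotv y y = dotv (x - y) (x - y).
  by rewrite dotvBr !(dotvC (_ - _)) !dotvBr (dotvC y x); ring.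
move=> H.
have {H} H : (e + dotv x x) `^ (q / 2) +
  q / 2 * (2 * (q / 2) - 1) * dotv y y * (e + N ^+ 2) `^ (q / 2 - 1) <=
  ((e + dotv (x + y) (x + y)) `^ (q / 2) + (e + dotv (x - y) (x - y)) `^ (q / 2)) / 2.
  apply: H.
  - lra.
  - lra.
  - by rewrite -sqr_enorm sqr_ge0.
  - by move=> t; rewrite QE -sqr_enorm sqr_ge0.
  - move=> t; rewrite QE -!sqr_enorm -exprMn.
    rewrite (_ : dotv x y + _ = dotv y (x + t *: y)); last first.
      by rewrite dotvDr dotvZr (dotvC y x) -sqr_enorm mulrC.
    rewrite -[leLHS]real_normK ?num_real// ler_pXn2r ?nnegrE ?mulr_ge0 ?enorm_ge0//.
    exact: normr_dotv_le.
  - move=> t t1; rewrite QE -sqr_enorm ler_pXn2r ?nnegrE ?enorm_ge0 ?(ltW N0)//.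
    apply: le_trans (enormD _ _) _; rewrite lerD2l enormZ.
    by rewrite ler_piMl ?enorm_ge0.
have s1 : 0 < q / 2 by lra.
have s2 : q / 2 <= 1 by lra.
have B (v : 'rV[R]_n) : (e + dotv v v) `^ (q / 2) <= d + enorm v `^ q.
  apply: le_trans (powR_subadd s1 s2 (ltW e0) _) _; first by rewrite -sqr_enorm sqr_ge0.
  by rewrite dq lerD2r.
have C : enorm x `^ q <= (e + dotv x x) `^ (q / 2).
  rewrite -dq; apply: ge0_ler_powR; rewrite ?nnegrE ?lerDr ?(ltW s1) ?(ltW e0)//.
    by rewrite -sqr_enorm sqr_ge0.
  by rewrite -sqr_enorm addr_ge0 ?sqr_ge0 ?(ltW e0).
have D : 2^-1 * N `^ (q - 2) <= (e + N ^+ 2) `^ (q / 2 - 1).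
  apply: (@le_trans _ _ ((2 * N ^+ 2) `^ (q / 2 - 1))).
    rewrite powRM ?sqr_ge0// -powR_mulrn ?(ltW N0)// -powRrM.
    have -> : 2%:R * (q / 2 - 1) = q - 2 :> R by field.
    apply: ler_wpM2r; first exact: powR_ge0.
    have E : 2^-1 = 2 `^ (-1) :> R by rewrite powR_inv1.
    rewrite [leLHS]E; by apply: ler_powR; [rewrite ler1n|lra].
  apply: powR_anti; first lra.
    by rewrite ltr_wpDr ?sqr_ge0.
  by rewrite mulr_natl mulr2n lerD2r.
have F : (q - 1) / 4 * enorm y ^+ 2 * N `^ (q - 2) <=
   q / 2 * (2 * (q / 2) - 1) * dotv y y * (e + N ^+ 2) `^ (q / 2 - 1).
  rewrite -sqr_enorm.
  have Y0 : 0 <= enorm y ^+ 2 by exact: sqr_ge0.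
  have Z0 : 0 <= N `^ (q - 2) by exact: powR_ge0.
  apply: (@le_trans _ _ ((q - 1) / 2 * enorm y ^+ 2 * (2^-1 * N `^ (q - 2)))); first lra.
  apply: ler_pM; rewrite ?mulr_ge0//; try lra.
  by apply: ler_wpM2r => //; nra.
apply: le_trans (lerD C F) _; apply: le_trans H _.
apply: (@le_trans _ _ ((d + enorm (x + y) `^ q + (d + enorm (x - y) `^ q)) / 2)).
  by apply: ler_wpM2r; [rewrite invr_ge0|exact: lerD].
by rewrite le_eqVlt; apply/orP; left; apply/eqP; field.
Qed.

(* For q <= 2 the gap controls |a - b|^q except where |a - b| is small compared
   with |a| + |b|. *)
Lemma powR_enorm_uniform_convex n (q eps : R) : 1 < q -> 0 < eps ->
  exists2 C : R, 0 < C & forall (r : R) (a b : 'rV[R]_n), q <= r ->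
    enorm (2^-1 *: (a - b)) `^ r <= eps * (enorm a `^ r + enorm b `^ r) +
      C * ((enorm a `^ r + enorm b `^ r) / 2 - enorm (2^-1 *: (a + b)) `^ r).
Proof.
(* [d] is the threshold for the ratio of [|y|] to [|x| + |y|]. The 4 matches
   [(|a| + |b|)^r <= 4 (|a|^r + |b|^r)] for [r <= 2], so that below the threshold the [eps] term
   alone suffices. *)
move=> q1 eps0; pose d := Num.min 1 (eps / 4).
have d0 : 0 < d by rewrite lt_min ltr01 divr_gt0.
have d1 : d <= 1 by rewrite ge_min lexx.
have de : d * 4 <= eps by rewrite -ler_pdivlMr// ge_min lexx orbT.
pose c := (q - 1) / 4 * d; have c0 : 0 < c by rewrite mulr_gt0// divr_gt0// subr_gt0.
(* The summand 1 serves [r >= 2], the summand [1 / c] the case [r < 2] above the threshold. Neither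
   depends on [r]. *)
exists (c^-1 + 1) => [|r a b qr]; first by rewrite addr_gt0// invr_gt0.
set x := 2^-1 *: (a + b); set y := 2^-1 *: (a - b).
have r1 : 1 < r by exact: lt_le_trans qr.
have r0 : 0 < r by lra.
have rN1 : -1 <= r - 2 by lra.
have h2 : `|2^-1 : R| = 2^-1 by rewrite ger0_norm// invr_ge0.
have xle : enorm x <= (enorm a + enorm b) / 2.
  by rewrite /x enormZ h2 mulrC ler_wpM2r ?invr_ge0// enormD.
have yle : enorm y <= (enorm a + enorm b) / 2.
  rewrite /y enormZ h2 mulrC ler_wpM2r ?invr_ge0//.
  by apply: le_trans (enormD _ _) _; rewrite enormN.
have a0 := enorm_ge0 a; have b0 := enorm_ge0 b.
have x0 := enorm_ge0 x; have y0 := enorm_ge0 y.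
have ab0 : 0 <= (enorm a + enorm b) / 2 by rewrite divr_ge0// addr_ge0.
have Ar := powR_ge0 (enorm a) r; have Br := powR_ge0 (enorm b) r.
have gap0 : 0 <= (enorm a `^ r + enorm b `^ r) / 2 - enorm x `^ r.
  rewrite subr_ge0; apply: le_trans (powR_midpoint (ltW r1) a0 b0).
  by apply: ge0_ler_powR; rewrite ?nnegrE ?(ltW r0).
set gap := _ - enorm x `^ r in gap0 *.
have ci : 0 < c^-1 by rewrite invr_gt0.
have E0 : 0 <= eps * (enorm a `^ r + enorm b `^ r) by rewrite mulr_ge0 ?(ltW eps0)// addr_ge0.
(* For [r >= 2], superadditivity of [t^(r/2)], the parallelogram law and midpoint convexity give
   Clarkson's inequality with constant 1. *)
have [r2|r2] := leP 2 r.
  suff H : enorm y `^ r <= gap.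
    apply: le_trans H _; rewrite mulrDl mul1r addrA lerDr.
    exact: addr_ge0 E0 (mulr_ge0 (ltW ci) gap0).
  have s1 : 1 <= r / 2 by lra.
  have sq (v : 'rV[R]_n) : enorm v `^ r = (enorm v ^+ 2) `^ (r / 2).
    by rewrite -powR_mulrn ?enorm_ge0// -powRrM; congr (_ `^ _); field.
  have par : enorm y ^+ 2 + enorm x ^+ 2 = (enorm a ^+ 2 + enorm b ^+ 2) / 2.
    rewrite /x /y !enormZ h2 !exprMn !sqr_enorm dotvBr dotvDr !(dotvC (a - b)) !(dotvC (a + b)).
    by rewrite !dotvBr !dotvDr (dotvC b a); field.
  rewrite /gap lerBrDr !sq; apply: le_trans (powR_superadd s1 _ _) _; rewrite ?sqr_ge0//.
  by rewrite par; apply: powR_midpoint; rewrite ?sqr_ge0.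
have ax : a = x + y.
  by apply/rowP => i; rewrite !mxE; field.
have bx : b = x - y.
  by apply/rowP => i; rewrite !mxE; field.
have [yd|yd] := leP (enorm y) (d * (enorm x + enorm y)).
  have H : enorm y `^ r <= eps * (enorm a `^ r + enorm b `^ r).
    apply: (@le_trans _ _ ((d * (enorm a + enorm b)) `^ r)).
      apply: ge0_ler_powR; rewrite ?nnegrE ?(ltW r0) ?mulr_ge0 ?addr_ge0 ?(ltW d0)//.
      by apply: le_trans yd _; rewrite ler_wpM2l ?(ltW d0)//; lra.
    rewrite powRM ?addr_ge0 ?(ltW d0)//.
    have D1 : d `^ r <= d.
      by have := powR_le_lin (ltW d0) d1 (ltW r1); rewrite powR1 mul1r.
    have D2 : (enorm a + enorm b) `^ r <= 4 * (enorm a `^ r + enorm b `^ r).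
      apply: le_trans (powR_add_le a0 b0 (ltW r0)) _; rewrite ler_wpM2r ?addr_ge0//.
      have -> : 4 = 2 `^ 2%:R :> R by rewrite powR_mulrn//; ring.
      by apply: ler_powR; [rewrite ler1n|exact: ltW].
    apply: le_trans (ler_pM (powR_ge0 _ _) (powR_ge0 _ _) D1 D2) _.
    by rewrite mulrA ler_wpM2r ?addr_ge0.
  by apply: le_trans H _; rewrite lerDl mulr_ge0// addr_ge0// ltW.
have yp : 0 < enorm y by apply: le_lt_trans yd; rewrite mulr_ge0 ?addr_ge0 ?(ltW d0).
have H := enorm_gap x r1 (ltW r2) yp; rewrite -ax -bx in H.
suff K : c * enorm y `^ r <= gap.
  have Kc : enorm y `^ r <= c^-1 * gap by rewrite mulrC ler_pdivlMr// mulrC.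
  apply: le_trans Kc _; rewrite mulrDl mul1r addrCA lerDl.
  exact: addr_ge0 E0 gap0.
apply: (@le_trans _ _ ((r - 1) / 4 * enorm y ^+ 2 * (enorm x + enorm y) `^ (r - 2))); last first.
  by rewrite /gap lerBrDr addrC.
have L : d * enorm y `^ (r - 2) <= (enorm x + enorm y) `^ (r - 2).
  apply: (@le_trans _ _ ((d^-1 * enorm y) `^ (r - 2))); last first.
    apply: powR_anti; [by rewrite subr_le0 ltW|exact: ltr_wpDl x0 yp|].
    by rewrite ler_pdivlMl// ltW.
  rewrite powRM ?invr_ge0 ?(ltW d0)//; apply: ler_wpM2r; first exact: powR_ge0.
  have E : d = d^-1 `^ (-1) by rewrite powR_inv1 ?invrK// invr_ge0 ltW.
  by rewrite [leLHS]E; apply: ler_powR; [rewrite invf_ge1|].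
have -> : c * enorm y `^ r = (q - 1) / 4 * enorm y ^+ 2 * (d * enorm y `^ (r - 2)).
  by rewrite -(powRB2M y0 (lt0r_neq0 r0)) /c; ring.
apply: ler_pM => //.
- by rewrite mulr_ge0 ?sqr_ge0// divr_ge0// subr_ge0 ltW.
- by rewrite mulr_ge0 ?powR_ge0 ?ltW.
- by rewrite ler_wpM2r ?sqr_ge0// ler_wpM2r ?invr_ge0// lerB.
Qed.

End uniform_convexity.

(** * Variable exponents *)

Section variable_powers.
Variable R : realType.

Lemma le_powR2 (r : R) : 1 <= r -> r <= 2 `^ r.
Proof.
move=> r1; have := @young_powR R 1 2 r ler01 (ler0n _ _) r1.
rewrite !powR1; lra.
Qed.

(** Below the threshold 2 the constant suffices; above it [t^(r-q) >= 2^(r-q) >= r / 2^q], since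
    [r <= 2^r]. A threshold above 1 is what lets the power beat the division by [r] uniformly in
    [r]. *)
Lemma powR_le_variable (q r t : R) : 1 <= q -> q <= r -> 0 <= t ->
  t `^ q <= 2 `^ q + 2 `^ q * (t `^ r / r).
Proof.
move=> q1 qr t0; have r1 : 1 <= r by exact: le_trans qr.
have r0 : 0 < r by lra.
have q0 : 0 <= q by lra.
have rhs0 : 0 <= t `^ r / r by rewrite divr_ge0 ?powR_ge0 ?ltW.
have [t2|t2] := leP t 2.
  apply: (@le_trans _ _ (2 `^ q)); last by rewrite lerDl mulr_ge0 ?powR_ge0.
  by apply: ge0_ler_powR; rewrite ?nnegrE.
apply: (@le_trans _ _ (2 `^ q * (t `^ r / r))); last by rewrite lerDr powR_ge0.
have tp : 0 < t by lra.
rewrite mulrA ler_pdivlMr//.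
have -> : t `^ r = t `^ (r - q) * t `^ q.
  by rewrite -powRD ?subrK// (gt_eqF tp) implybT.
rewrite mulrC mulrA ler_wpM2r ?powR_ge0//.
apply: le_trans (le_powR2 r1) _.
have -> : 2 `^ r = 2 `^ q * 2 `^ (r - q) :> R.
  by rewrite -powRD ?[q + _]addrC ?subrK// pnatr_eq0 implybT.
rewrite ler_wpM2l ?powR_ge0//; apply: ge0_ler_powR; rewrite ?nnegrE ?subr_ge0 ?(ltW tp)//.
exact: ltW.
Qed.

Lemma cvg_powR0 (t : nat -> R) (r q : R) : 0 < r -> 0 < q -> (forall k, 0 <= t k) ->
  (fun k => t k `^ r / r) @ \oo --> 0 -> (fun k => t k `^ q) @ \oo --> 0.
Proof.
move=> r0 q0 t0 tr; apply/cvgrPdist_le => e e0.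
pose d := (e `^ q^-1) `^ r / r.
have d0 : 0 < d by rewrite divr_gt0// !powR_gt0.
move/cvgrPdist_le : tr => /(_ d d0); apply: filterS => k.
rewrite !sub0r !normrN ger0_norm ?divr_ge0 ?powR_ge0 ?(ltW r0)// ger0_norm ?powR_ge0//.
rewrite /d ler_pM2r ?invr_gt0// => H.
have {}H : t k <= e `^ q^-1.
  rewrite leNgt; apply/negP => lt.
  have := gt0_ltr_powR r0 (_ : e `^ q^-1 \in Num.nneg) (_ : t k \in Num.nneg) lt.
  by rewrite !nnegrE powR_ge0 t0 ltNge H => /(_ isT isT).
have -> : e = (e `^ q^-1) `^ q by rewrite -powRrM mulVf ?gt_eqF// powRr1 ?ltW.
by apply: ge0_ler_powR; rewrite ?nnegrE ?powR_ge0// ltW.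
Qed.

End variable_powers.

Lemma measurable_inv_pos d (T : measurableType d) (R : realType) (D : set T) (p : T -> R) :
  measurable D -> measurable_fun D p -> (forall x, D x -> 0 < p x) ->
  measurable_fun D (fun x => (p x)^-1).
Proof.
move=> mD mp p0; apply: (eq_measurable_fun (fun x => p x `^ (-1))).
  by move=> x /set_mem Dx; rewrite powR_inv1// ltW// p0.
by apply: measurable_powR2 => //; exact: measurable_cst.
Qed.

Section variable_exponent_integrals.
Context d (T : measurableType d) (R : realType).
Variables (mu : {measure set T -> \bar R}) (D : set T).
Hypothesis mD : measurable D.
Hypothesis muD : (mu D < +oo)%E.
Implicit Types (f t p : T -> R).

Lemma integrable_cst_fin (c : R) : mu.-integrable D (fun=> c%:E).
Proof.
apply/integrableP; split; first exact: measurable_cst.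
rewrite (eq_integral (fun=> `|c|%:E)) => [|x _]; last by [].
by rewrite integral_cst// lte_mul_pinfty ?lee_fin.
Qed.

(** The pointwise bound [powR_le_variable] has a constant term that does not become small, so the
    argument is indirect: counterexamples with energies at most [2^-k] would have a common
    integrable majorant and tend to 0 almost everywhere by [fast_dominated], contradicting dominated
    convergence. *)
Lemma small_powR_variable (q : R) p (e : R) : 1 <= q -> measurable_fun D p ->
  (forall x, D x -> q <= p x) -> 0 < e ->
  exists2 h : R, 0 < h & forall t, measurable_fun D t -> (forall x, D x -> 0 <= t x) ->
    (\int[mu]_(x in D) (t x `^ p x / p x)%:E <= h%:E)%E ->
    (\int[mu]_(x in D) (t x `^ q)%:E <= e%:E)%E.
Proof.
move=> q1 mp qp e0; have q0 : 0 < q by lra.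
apply: contrapT => H.
have {}H k : exists t, [/\ measurable_fun D t, forall x, D x -> 0 <= t x,
    (\int[mu]_(x in D) (t x `^ p x / p x)%:E <= (2^-1 ^+ k)%:E)%E &
    (e%:E < \int[mu]_(x in D) (t x `^ q)%:E)%E].
  apply: contrapT => Hk; apply: H; exists (2^-1 ^+ k).
    by rewrite exprn_gt0// invr_gt0.
  move=> t mt t0 It; rewrite leNgt; apply/negP => et.
  by apply: Hk; exists t.
have [t Ht] := choice H.
have p0 x : D x -> 0 < p x by move=> /qp; lra.
have mt k : measurable_fun D (t k) by have [] := Ht k.
have t0 k x : D x -> 0 <= t k x by have [_ + _ _] := Ht k; apply.
have mf k : measurable_fun D (fun x => t k x `^ p x / p x).
  apply: measurable_funM; first exact: measurable_powR2.
  exact: measurable_inv_pos.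
have [g [ig fg _ f0]] := fast_dominated mD mf
  (fun k x Dx => divr_ge0 (powR_ge0 _ _) (ltW (p0 x Dx))) (fun k => let: And4 _ _ h _ := Ht k in h).
have mq k : measurable_fun D (fun x => t k x `^ q).
  by apply: measurable_powR2 => //; exact: measurable_cst.
have := @dominated_integral0 _ T R mu D mD (fun k x => t k x `^ q)
   (fun x => ((2 `^ q)%:E + (2 `^ q)%:E * g x)%E) mq (fun k x _ => powR_ge0 _ _).
have ig' : mu.-integrable D (fun x => ((2 `^ q)%:E + (2 `^ q)%:E * g x)%E).
  by apply: integrableD => //; [exact: integrable_cst_fin|exact: integrableZl].
move=> /(_ ig') H0.
have {}H0 : (fun k => \int[mu]_(x in D) (t k x `^ q)%:E)%E @ \oo --> 0%E.
  apply: H0.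
    apply: aeW => x Dx k.
    apply: (@le_trans _ _ ((2 `^ q + 2 `^ q * (t k x `^ p x / p x))%:E)).
      by rewrite lee_fin powR_le_variable ?qp ?t0.
    rewrite EFinD EFinM; apply: leeD2l; apply: lee_wpmul2l; last exact: fg.
    by rewrite lee_fin powR_ge0.
  move: f0; apply: filterS => x f0 Dx.
  by apply: (cvg_powR0 (p0 x Dx) q0) (f0 Dx) => k; exact: t0.
have [N _ /(_ N (leqnn N))] := cvge0_lt H0 e0.
by have [_ _ _ /lt_trans h] := Ht N => /h; rewrite ltxx.
Qed.

Lemma integral_le_comb (f g h k : T -> R) (c e : R) : 0 <= c -> 0 <= e ->
  measurable_fun D f -> measurable_fun D g ->
  measurable_fun D h -> measurable_fun D k ->
  (forall x, D x -> 0 <= f x) -> (forall x, D x -> 0 <= g x) ->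
  (forall x, D x -> 0 <= h x) -> (forall x, D x -> 0 <= k x) ->
  (forall x, D x -> f x + c * g x <= e * (h x + k x)) ->
  (\int[mu]_(x in D) (f x)%:E + c%:E * \int[mu]_(x in D) (g x)%:E <=
   e%:E * (\int[mu]_(x in D) (h x)%:E + \int[mu]_(x in D) (k x)%:E))%E.
Proof.
move=> c0 e0 mf mg mh mk f0 g0 h0 k0 H.
move/measurable_EFinP : mf => mf; move/measurable_EFinP : mg => mg.
move/measurable_EFinP : mh => mh; move/measurable_EFinP : mk => mk.
rewrite -ge0_integralZl//.
rewrite -ge0_integralD//; last 2 first.
- by move=> x Dx; rewrite -EFinM lee_fin mulr_ge0// g0.
- exact: measurable_funeM.
rewrite -ge0_integralD// -ge0_integralZl//; last 2 first.
- exact: emeasurable_funD.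
- by move=> x Dx; rewrite -EFinD lee_fin addr_ge0 ?h0 ?k0.
apply: ge0_le_integral => //.
- by move=> x Dx; rewrite -EFinM -EFinD lee_fin addr_ge0 ?mulr_ge0 ?f0 ?g0.
- by apply: emeasurable_funD => //; exact: measurable_funeM.
- by apply: measurable_funeM; exact: emeasurable_funD.

Qed.

(** The pointwise inequality is divided by [p x] and integrated. The midpoint term stays on the left
    with a plus sign, so the inequality is meaningful for infinite energies. *)
Lemma integral_enorm_uniform_convex n (q eps : R) : 1 < q -> 0 < eps ->
  exists2 C : R, 0 < C & forall p (a b : T -> 'rV[R]_n), measurable_fun D p ->
    (forall x, D x -> q <= p x) ->
    (forall i, measurable_fun D (fun x => a x ord0 i)) ->
    (forall i, measurable_fun D (fun x => b x ord0 i)) ->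
    (\int[mu]_(x in D) (enorm (2^-1 *: (a x - b x)) `^ p x / p x)%:E +
      C%:E * \int[mu]_(x in D) (enorm (2^-1 *: (a x + b x)) `^ p x / p x)%:E <=
     (eps + C / 2)%:E * (\int[mu]_(x in D) (enorm (a x) `^ p x / p x)%:E +
       \int[mu]_(x in D) (enorm (b x) `^ p x / p x)%:E))%E.
Proof.
move=> q1 eps0; have [C C0 HC] := powR_enorm_uniform_convex n q1 eps0.
exists C => // p a b mp qp ma mb.
have p0 x : D x -> 0 < p x by move=> /qp; lra.
have M (c : T -> 'rV[R]_n) : (forall i, measurable_fun D (fun x => c x ord0 i)) ->
    measurable_fun D (fun x => enorm (c x) `^ p x / p x).
  move=> mc; apply: measurable_funM; last exact: measurable_inv_pos.
  by apply: measurable_powR2 => //; exact: measurable_enorm.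
have N (c : T -> 'rV[R]_n) x : D x -> 0 <= enorm (c x) `^ p x / p x.
  by move=> Dx; rewrite divr_ge0 ?powR_ge0 ?(ltW (p0 x Dx)).
have mB : forall i, measurable_fun D (fun x => (2^-1 *: (a x - b x)) ord0 i).
  move=> i; under eq_fun do rewrite !mxE.
  by apply: measurable_funM => //; apply: measurable_funB.
have mA : forall i, measurable_fun D (fun x => (2^-1 *: (a x + b x)) ord0 i).
  move=> i; under eq_fun do rewrite !mxE.
  by apply: measurable_funM => //; apply: measurable_funD.
have c0 : 0 <= eps + C / 2 by rewrite addr_ge0 ?divr_ge0 ?ltW.
apply: integral_le_comb (ltW C0) c0 (M _ mB) (M _ mA) (M _ ma) (M _ mb)
  (N _) (N _) (N _) (N _) _ => x Dx.
have px := p0 x Dx; have := HC (p x) (a x) (b x) (qp x Dx).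
move: (enorm _ `^ _) (enorm _ `^ _) (enorm _ `^ _) (enorm _ `^ _) => X Y Z W {M N mA mB} H.
have {}H : W + C * X <= (eps + C / 2) * (Z + Y) by lra.
rewrite -(ler_pM2r px).
have -> : (W / p x + C * (X / p x)) * p x = W + C * X by field; rewrite gt_eqF.
have -> : (eps + C / 2) * (Z / p x + Y / p x) * p x = (eps + C / 2) * (Z + Y).
  by field; rewrite gt_eqF.
exact: H.
Qed.

End variable_exponent_integrals.

(** * Variable exponent Lebesgue spaces *)

Section variable_lebesgue.
Variables (R : realType) (n : nat) (Omega : set 'rV[R]_n).
Local Notation mu := (lebesgue_rV R n).
Hypothesis mO : measurable Omega.
Implicit Types (f g u v r : 'rV[R]_n -> R).

Lemma Lvar_lin r (a : R) u v : measurable_fun Omega r ->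
  (forall x, Omega x -> 1 <= r x) -> Lvar Omega r u -> Lvar Omega r v ->
  Lvar Omega r (fun x => a * u x + v x).
Proof.
move=> mr r1 [mfu [l1 l10 I1]] [mfv [l2 l20 I2]].
have mw : measurable_fun Omega (fun x => a * u x + v x).
  by apply: measurable_funD => //; exact: measurable_funM.
split; first exact: mw.
have a1 : 0 < `|a| + 1 by rewrite ltr_wpDl.
(* The final factor 1/2 makes [|l (a u + v)|] at most the mean of [|l1 u|] and [|l2 v|], to which
   midpoint convexity of the power applies. *)
pose l := Num.min (l1 / (`|a| + 1)) l2 / 2.
have l0 : 0 < l by rewrite divr_gt0// lt_min l20 divr_gt0.
have la : l * `|a| <= l1 / 2.
  have h : l <= l1 / (`|a| + 1) / 2 by rewrite ler_wpM2r ?invr_ge0// ge_min lexx.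
  apply: le_trans (ler_wpM2r (normr_ge0 a) h) _; rewrite mulrAC ler_wpM2r ?invr_ge0//.
  by rewrite -mulrA ler_piMr ?(ltW l10)// mulrC ler_pdivrMr// mul1r lerDl.
have lb : l <= l2 / 2 by rewrite ler_wpM2r ?invr_ge0// ge_min lexx orbT.
clearbody l; exists l; first exact: l0.
have M f (c : R) : measurable_fun Omega f -> measurable_fun Omega (fun x => `|c * f x| `^ r x).
  by move=> mf; apply: measurable_powR_normr => //; exact: measurable_funM.
apply: le_lt_trans (lte_add_pinfty I1 I2).
apply: (integral_leD mu mO (M _ l1 mfu) (M _ l2 mfv) (M _ l mw)).
- by move=> x _; exact: powR_ge0.
- by move=> x _; exact: powR_ge0.
- by move=> x _; exact: powR_ge0.
move=> x Ox; apply: (@le_trans _ _ ((`|l1 * u x| `^ r x + `|l2 * v x| `^ r x) / 2)).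
  apply: le_trans (powR_midpoint (r1 x Ox) (normr_ge0 _) (normr_ge0 _)).
  have rx0 : 0 <= r x by exact: le_trans ler01 (r1 x Ox).
  apply: ge0_ler_powR; rewrite ?nnegrE ?divr_ge0 ?addr_ge0//.
  rewrite mulrDr; apply: (le_trans (ler_normD _ _)).
  rewrite mulrA !normrM (gtr0_norm l0) (gtr0_norm l10) (gtr0_norm l20) mulrDl.
  by rewrite [l1 * _ / _]mulrAC [l2 * _ / _]mulrAC; apply: lerD; apply: ler_wpM2r.
by rewrite ler_pdivrMr// ler_peMr ?addr_ge0 ?powR_ge0// ler1n.
Qed.

Lemma Lvar_ae r f g : measurable_fun Omega r -> measurable_fun Omega g -> ae_eq_on Omega f g ->
  Lvar Omega r f -> Lvar Omega r g.
Proof.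
move=> mr mg fg [mf [l l0 I]]; split; first exact: mg.
exists l; first exact: l0.
have <- : (\int[mu]_(x in Omega) (`|l * f x| `^ r x)%:E =
   \int[mu]_(x in Omega) (`|l * g x| `^ r x)%:E)%E; last exact: I.
apply: ge0_integral_ae_eq => //.
- by apply: measurable_powR_normr => //; exact: measurable_funM.
- by apply: measurable_powR_normr => //; exact: measurable_funM.
- by move: fg; apply: filterS => x fg Ox; rewrite fg.
Qed.

Lemma Lvar_cstP (q : R) u : 0 <= q -> Lvar Omega (fun=> q) u <->
  measurable_fun Omega u /\ (\int[mu]_(x in Omega) (`|u x| `^ q)%:E < +oo)%E.
Proof.
move=> q0; split=> [[mfu [l l0 I]]|[mfu I]]; last first.
  split; first exact: mfu.
  by exists 1; [exact: ltr01|under eq_integral do rewrite mul1r; exact: I].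
split; first exact: mfu.
have c0 : 0 <= l^-1 `^ q by exact: powR_ge0.
apply: (@le_lt_trans _ _ ((l^-1 `^ q)%:E * \int[mu]_(x in Omega) (`|l * u x| `^ q)%:E)%E).
  apply: integral_leZ => //.
  - by apply: measurable_powR_normr.
  - by apply: measurable_powR_normr => //; exact: measurable_funM.
  - move=> x _; rewrite -powRM ?invr_ge0 ?(ltW l0)//.
    by rewrite normrM (gtr0_norm l0) mulKf// gt_eqF.
by apply: lte_mul_pinfty => //; rewrite lee_fin.
Qed.

Lemma Lvar_integral_powR r (q : R) u : (mu Omega < +oo)%E -> measurable_fun Omega r -> 1 <= q ->
  (forall x, Omega x -> q <= r x) -> Lvar Omega r u ->
  (\int[mu]_(x in Omega) (`|u x| `^ q)%:E < +oo)%E.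
Proof.
move=> Ofin mr q1 qr [mfu [l l0 I]]; have q0 : 0 <= q by exact: le_trans q1.
suff L : Lvar Omega (fun=> q) u by have [] := (Lvar_cstP u q0).1 L.
split; first exact: mfu.
exists l; first exact: l0.
have ml : measurable_fun Omega (fun x => l * u x) by exact: measurable_funM.
apply: (@le_lt_trans _ _ (\int[mu]_(x in Omega) (2 `^ q)%:E +
   \int[mu]_(x in Omega) (2 `^ q * `|l * u x| `^ r x)%:E)%E).
  apply: integral_leD => //.
  - by apply: measurable_funM => //; exact: measurable_powR_normr.
  - exact: measurable_powR_normr.
  move=> x Ox; apply: le_trans (powR_le_variable q1 (qr x Ox) (normr_ge0 _)) _.
  rewrite lerD2l ler_wpM2l ?powR_ge0//.
  have rx := le_trans q1 (qr x Ox).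
  by rewrite ler_pdivrMr ?(lt_le_trans ltr01)// ler_peMr ?powR_ge0.
apply: lte_add_pinfty.
  by rewrite integral_cst// lte_mul_pinfty ?lee_fin ?powR_ge0.
under eq_integral do rewrite EFinM.
rewrite ge0_integralZl//; last first.
  by apply/measurable_EFinP; exact: measurable_powR_normr.
by apply: lte_mul_pinfty => //; rewrite lee_fin powR_ge0.
Qed.

End variable_lebesgue.

(** The last clause is recorded because the real [inf] is a lower bound only for sets that are
    bounded below. *)
Definition admissible_exponent (R : realType) (n : nat) (Omega : set 'rV[R]_n)
    (p : 'rV[R]_n -> R) :=
  [/\ open Omega, (lebesgue_rV R n Omega < +oo)%E, measurable_fun Omega p,
      1 < exp_inf Omega p & forall x, Omega x -> exp_inf Omega p <= p x].

(** * Variable exponent Sobolev spaces *)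

Section variable_sobolev.
Variables (R : realType) (n : nat) (Omega : set 'rV[R]_n) (p : 'rV[R]_n -> R).
Local Notation mu := (lebesgue_rV R n).
Local Notation q := (exp_inf Omega p).
Local Notation W := (WOmega Omega p).
Hypothesis H : admissible_exponent Omega p.
Implicit Types (f g u v w : 'rV[R]_n -> R) (A B : 'rV[R]_n -> 'rV[R]_n).

Let oO : open Omega. Proof. by case: H. Qed.
Let Ofin : (mu Omega < +oo)%E. Proof. by case: H. Qed.
Let mp : measurable_fun Omega p. Proof. by case: H. Qed.
Let q1 : 1 < q. Proof. by case: H. Qed.
Let qp x : Omega x -> q <= p x. Proof. by case: H => _ _ _ _; exact. Qed.
Let mO : measurable Omega. Proof. exact: open_rV_measurable. Qed.
Let q0 : 0 < q. Proof. exact: lt_trans q1. Qed.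
Let p1 x : Omega x -> 1 < p x. Proof. by move=> /qp; exact: lt_le_trans. Qed.
Let p0 x : Omega x -> 0 < p x. Proof. by move=> /p1; exact: lt_trans. Qed.

(** Stated for vector fields, so that it applies to combinations of gradients and to limits of
    gradients not yet known to be gradients. *)
Definition field_energy A := (\int[mu]_(x in Omega) (enorm (A x) `^ p x / p x)%:E)%E.

Definition measurable_field A := forall i, measurable_fun Omega (fun x => A x ord0 i).

Lemma measurable_fieldZ (a : R) A : measurable_field A -> measurable_field (fun x => a *: A x).
Proof. by move=> mA i; under eq_fun do rewrite mxE; exact: measurable_funM. Qed.

Lemma measurable_fieldD A B : measurable_field A -> measurable_field B ->
  measurable_field (fun x => A x + B x).
Proof. by move=> mA mB i; under eq_fun do rewrite mxE; exact: measurable_funD. Qed.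

Lemma measurable_fieldB A B : measurable_field A -> measurable_field B ->
  measurable_field (fun x => A x - B x).
Proof. by move=> mA mB i; under eq_fun do rewrite !mxE; exact: measurable_funB. Qed.

Lemma measurable_energy A : measurable_field A ->
  measurable_fun Omega (fun x => enorm (A x) `^ p x / p x).
Proof.
move=> mA; apply: measurable_funM; last exact: measurable_inv_pos.
by apply: measurable_powR2 => //; exact: measurable_enorm.
Qed.

Lemma energy_density_ge0 A x : Omega x -> 0 <= enorm (A x) `^ p x / p x.
Proof. by move=> Ox; rewrite divr_ge0 ?powR_ge0 ?ltW ?p0. Qed.

Lemma field_energy_ae A B : measurable_field A -> measurable_field B ->
  {ae mu, forall x, Omega x -> A x = B x} -> field_energy A = field_energy B.
Proof.
move=> mA mB AB; apply: ge0_integral_ae_eq => //; [exact: measurable_energy|exact: measurable_energy|].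
by move: AB; apply: filterS => x AB Ox; rewrite AB.
Qed.

Lemma field_energyN A : field_energy (fun x => - A x) = field_energy A.
Proof. by apply: eq_integral => x _; rewrite enormN. Qed.

Lemma field_energy_shrink (t : R) A : `|t| <= 1 -> measurable_field A ->
  (field_energy (fun x => t *: A x) <= field_energy A)%E.
Proof.
move=> t1 mA; apply: (integral_le mu mO (measurable_energy (measurable_fieldZ t mA)) (measurable_energy mA)).
  by move=> x Ox; exact: (energy_density_ge0 (fun x => t *: A x)).
move=> x Ox; rewrite ler_pM2r ?invr_gt0 ?p0//.
apply: ge0_ler_powR; rewrite ?nnegrE ?enorm_ge0 ?(ltW (p0 Ox))//.
by rewrite enormZ ler_piMl ?enorm_ge0.
Qed.

Lemma WOmega_measurable u : W u -> measurable_fun Omega u.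
Proof. by move=> [[]]. Qed.

Lemma WOmega_integral u : W u -> (\int[mu]_(x in Omega) (`|u x| `^ q)%:E < +oo)%E.
Proof. by move=> [/(Lvar_cstP mO u (ltW q0))[]]. Qed.

Lemma WOmega_wd u : W u -> weakly_differentiable Omega u.
Proof. by move=> []. Qed.

Lemma WOmega_grad_measurable u : W u -> measurable_field (wgrad Omega u).
Proof. by move=> [_ du _] i; exact: wgrad_coord_measurable. Qed.

Lemma WOmega_grad_integral u i : W u ->
  (\int[mu]_(x in Omega) (`|wgrad Omega u x ord0 i| `^ q)%:E < +oo)%E.
Proof. by move=> [_ _ Lu]; exact: (Lvar_integral_powR mO Ofin mp (ltW q1) qp (Lu i)). Qed.

(** [WOmega] refers to the chosen representative [wgrad]; almost everywhere uniqueness allows any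
    weak gradient to be used instead. *)
Lemma WOmega_intro u G : measurable_fun Omega u ->
  (\int[mu]_(x in Omega) (`|u x| `^ q)%:E < +oo)%E -> is_weak_grad Omega u G ->
  (forall i, Lvar Omega p (fun x => G x ord0 i)) -> W u.
Proof.
move=> mfu Iu uG LG; have du : weakly_differentiable Omega u by exists G.
split; [by apply/(Lvar_cstP mO u (ltW q0)); split|exact: du|move=> i].
 apply: (Lvar_ae mO mp _ _ (LG i)); first exact: wgrad_coord_measurable.
by move: (wgradE oO uG); apply: filterS => x E Ox; rewrite E.
Qed.

Lemma WOmega_lin (a : R) u v : W u -> W v -> W (fun x => a * u x + v x).
Proof.
move=> [Lu du Gu] [Lv dv Gv].
have L : Lvar Omega (fun=> q) (fun x => a * u x + v x).
  by apply: (Lvar_lin mO a _ _ Lu Lv) => [|x _]; [exact: measurable_cst|exact: ltW].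
apply: (WOmega_intro _ _ (is_weak_grad_lin oO a (wgradP du) (wgradP dv))).
- by case: L.
- by have [] := (Lvar_cstP mO _ (ltW q0)).1 L.
move=> i; under eq_fun do rewrite !mxE.
by apply: (Lvar_lin mO a mp _ (Gu i) (Gv i)) => x Ox; exact: ltW (p1 Ox).
Qed.

Lemma WOmega0 : W (fun=> 0).
Proof.
have z : is_weak_grad Omega (fun=> 0 : R) (fun=> 0).
  have c : C1c Omega (fun=> 0 : R).
    split; last by exists set0; split => //; exact: compact0.
    split=> [x|i x]; first exact: differentiable_cst.
    rewrite (_ : partial i _ = fun=> 0); first exact: cst_continuous.
    by apply/funext => y; rewrite /partial derive_cst.
  have := C1c_weak_grad c; congr is_weak_grad; apply/funext => x.
  by apply/rowP => i; rewrite !mxE /partial derive_cst.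
have I0 (e : 'rV[R]_n -> R) : (forall x, Omega x -> 0 < e x) ->
    (\int[mu]_(x in Omega) (`|1 * (0 : R)| `^ e x)%:E = 0)%E.
  move=> e0; rewrite (eq_integral (fun=> 0%E)) ?integral0// => x /set_mem Ox.
  by rewrite mulr0 normr0 powR0// gt_eqF ?e0.
apply: (WOmega_intro _ _ z) => //.
  by have := I0 (fun=> q) (fun _ _ => q0); under eq_integral do rewrite mulr0; move=> ->.
move=> i; under eq_fun do rewrite mxE; split=> //; exists 1 => //.
by rewrite I0.
Qed.

Lemma WOmegaZ (a : R) u : W u -> W (fun x => a * u x).
Proof. by move=> Wu; have := WOmega_lin a Wu WOmega0; under eq_fun do rewrite addr0. Qed.

Lemma WOmegaD u v : W u -> W v -> W (u \+ v).
Proof. by move=> Wu Wv; have := WOmega_lin 1 Wu Wv; under eq_fun do rewrite mul1r. Qed.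

Lemma WOmegaB u v : W u -> W v -> W (u \- v).
Proof.
move=> Wu Wv; have := WOmega_lin (-1) Wv Wu.
by congr (W _); apply/funext => x /=; rewrite mulN1r addrC.
Qed.

Lemma wgradB u v : W u -> W v ->
  {ae mu, forall x, Omega x -> wgrad Omega (u \- v) x = wgrad Omega u x - wgrad Omega v x}.
Proof.
move=> [_ du _] [_ dv _]; have := wgrad_lin oO (-1) dv du.
rewrite (_ : (fun x => -1 * v x + u x) = u \- v); last first.
  by apply/funext => x /=; rewrite mulN1r addrC.
by apply: filterS => x E Ox; rewrite E// scaleN1r addrC.
Qed.

Lemma wgradZ (a : R) u : W u ->
  {ae mu, forall x, Omega x -> wgrad Omega (fun x => a * u x) x = a *: wgrad Omega u x}.
Proof.
move=> [_ du _]; have [_ d0 _] := WOmega0.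
have H1 := wgrad_lin oO (a - 1) du du.
move: H1; apply: filterS => x.
rewrite (_ : (fun x => (a - 1) * u x + u x) = (fun x => a * u x)); last first.
  by apply/funext => y; ring.
by move=> E Ox; rewrite E// scalerBl scale1r subrK.
Qed.

Lemma grad_energyB u v : W u -> W v ->
  grad_energy Omega p (u \- v) = field_energy (fun x => wgrad Omega u x - wgrad Omega v x).
Proof.
move=> Wu Wv; apply: field_energy_ae (wgradB Wu Wv).
  by apply: WOmega_grad_measurable; exact: WOmegaB.
by apply: measurable_fieldB; exact: WOmega_grad_measurable.
Qed.

Lemma grad_energyZ (a : R) u : W u ->
  grad_energy Omega p (fun x => a * u x) = field_energy (fun x => a *: wgrad Omega u x).
Proof.
move=> Wu; apply: field_energy_ae (wgradZ a Wu).
  by apply: WOmega_grad_measurable; exact: WOmegaZ.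
by apply: measurable_fieldZ; exact: WOmega_grad_measurable.
Qed.

Lemma grad_energy_ge0 u : (0 <= grad_energy Omega p u)%E.
Proof. by apply: integral_ge0 => x Ox; rewrite lee_fin energy_density_ge0. Qed.

Lemma rho_shrink (t : R) u : `|t| <= 1 -> W u ->
  (rho Omega p (fun x => t * u x)%R <= rho Omega p u)%E.
Proof.
move=> t1 Wu; apply: leeD.
  have mfu := WOmega_measurable Wu.
  apply: integral_le => //.
  - by apply: measurable_powR_normr => //; exact: measurable_funM.
  - exact: measurable_powR_normr.
  move=> x _; apply: ge0_ler_powR; rewrite ?nnegrE ?(ltW q0)//.
  by rewrite normrM ler_piMl.
rewrite (grad_energyZ t Wu).
exact: field_energy_shrink t1 (WOmega_grad_measurable Wu).
Qed.

End variable_sobolev.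

(** * The modular topology *)

Section modular_topology.
Variables (R : realType) (n : nat) (Omega : set 'rV[R]_n) (p : 'rV[R]_n -> R).
Local Notation W := (WOmega Omega p).
Local Notation rho := (rho Omega p).
Hypothesis H : admissible_exponent Omega p.
Implicit Types (u v w : 'rV[R]_n -> R) (S P : set ('rV[R]_n -> R)).
Local Notation closure := (modular_closure Omega p).

Definition fast_closed P := forall (v_ : nat -> 'rV[R]_n -> R) v,
  (forall k, W (v_ k)) -> (forall k, P (v_ k)) -> W v ->
  (forall k, (rho (v_ k \- v)%R <= (2^-1 ^+ k)%:E)%E) -> P v.

(** The complement of [P] in the Sobolev space is modular-open: a point without a modular ball in
    the complement would be a limit, at rate [2^-k], of points of [P]. *)
Lemma modular_closure_sub S P : S `<=` P -> fast_closed P -> closure S `<=` P.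
Proof.
move=> SP cP u [Wu Hu]; apply: contrapT => nPu.
have oA : modular_open Omega p [set v | W v /\ ~ P v].
  split=> [v []//|v [Wv nPv]]; apply: contrapT => He; apply: nPv.
  have Hk (k : nat) : exists w, [/\ W w, (rho (w \- v)%R <= (2^-1 ^+ k)%:E)%E & P w].
    apply: contrapT => Hk; apply: He; exists (2^-1 ^+ k).
      by rewrite exprn_gt0// invr_gt0.
    move=> w Ww rw; split; first exact: Ww.
    by move=> Pw; apply: Hk; exists w; split; [exact: Ww|exact: ltW rw|exact: Pw].
  have [w Hw] := choice Hk.
  have Ww k : W (w k) by case: (Hw k).
  have Pw k : P (w k) by case: (Hw k).
  have rw k : (rho (w k \- v)%R <= (2^-1 ^+ k)%:E)%E by case: (Hw k).
  exact: cP Ww Pw Wv rw.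
by have [w [[_ nPw] /SP]] := Hu _ oA (conj Wu nPu).
Qed.

Lemma fast_closed_closure S : fast_closed (closure S).
Proof.
move=> v_ v Wv_ cv_ Wv rv; split; first exact: Wv.
move=> A oA Av.
have [e e0 He] := oA.2 _ Av.
move/cvgrPdist_lt : (@cvg_half_pow R) => /(_ e e0)[N _ /(_ N (leqnn N))].
rewrite sub0r normrN ger0_norm ?exprn_ge0 ?invr_ge0// => Ne.
apply: (cv_ N).2; first exact: oA.
apply: He; first exact: Wv_.
by apply: le_lt_trans (rv N) _; rewrite lte_fin.
Qed.

Lemma closure_WOmega S : closure S `<=` W.
Proof. by move=> u []. Qed.

Lemma sub_modular_closure S : S `<=` W -> S `<=` closure S.
Proof. by move=> SW u Su; split; [exact: SW|move=> A _ Au; exists u]. Qed.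

Section subspace.
Variable S : set ('rV[R]_n -> R).
Hypothesis SW : S `<=` W.
Hypothesis Ssub : vector_subspace S.

Let S_D u v : S u -> S v -> S (u \+ v).
Proof.
move=> Su Sv; have := Ssub.2 1 _ _ Su Sv.
by congr S; apply/funext => x /=; rewrite mul1r.
Qed.

Let S_Z (a : R) u : S u -> S (fun x => a * u x).
Proof.
move=> Su; have := Ssub.2 a _ _ Su Ssub.1.
by congr S; apply/funext => x /=; rewrite addr0.
Qed.

Let closed_shift w : W w -> fast_closed [set v | closure S (v \+ w)].
Proof.
move=> Ww v_ v Wv_ cv_ Wv rv.
apply: (@fast_closed_closure S (fun k => v_ k \+ w)).
- by move=> k; exact: (WOmegaD H (Wv_ k) Ww).
- exact: cv_.
- exact: (WOmegaD H Wv Ww).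
move=> k; rewrite (_ : (v_ k \+ w) \- (v \+ w) = v_ k \- v); first exact: rv.
by apply/funext => x /=; ring.
Qed.

(** Two passes, first with one summand in [S], then with it in the closure. Each pass uses only that
    translations leave the modular of differences unchanged, as joint continuity of addition is not
    at hand. *)
Lemma modular_closureD u v : closure S u -> closure S v -> closure S (u \+ v).
Proof.
have step w : S w -> closure S `<=` [set v | closure S (v \+ w)].
  move=> Sw; apply: modular_closure_sub; last exact: (closed_shift (SW Sw)).
  by move=> v' Sv; apply: (sub_modular_closure SW); exact: S_D.
move=> cu cv; suff : closure S `<=` [set w | closure S (w \+ v)] by exact.
apply: modular_closure_sub; last exact: (closed_shift (closure_WOmega cv)).
move=> w Sw /=; have := step _ Sw _ cv.
by rewrite /= (_ : v \+ w = w \+ v)//; apply/funext => x /=; rewrite addrC.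
Qed.

Let closure_shrink (t : R) u : `|t| <= 1 -> closure S u -> closure S (fun x => t * u x).
Proof.
move=> t1; suff : closure S `<=` [set v | closure S (fun x => t * v x)] by exact.
apply: modular_closure_sub => [v Sv|v_ v Wv_ cv_ Wv rv].
  by apply: (sub_modular_closure SW); exact: S_Z.
apply: (@fast_closed_closure S (fun k x => t * v_ k x)).
- by move=> k; exact: (WOmegaZ H t (Wv_ k)).
- exact: cv_.
- exact: (WOmegaZ H t Wv).
move=> k; apply: le_trans (rv k).
rewrite (_ : _ \- _ = (fun x => t * (v_ k \- v) x)); last first.
  by apply/funext => x /=; rewrite mulrBr.
have E := rho_shrink H t1 (WOmegaB H (Wv_ k) Wv); exact: E.
Qed.

Let closure_nat (m : nat) u : closure S u -> closure S (fun x => m%:R * u x).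
Proof.
move=> cu; elim: m => [|m IH].
  apply: (sub_modular_closure SW).
  by have := Ssub.1; congr S; apply/funext => x; rewrite mul0r.
have := modular_closureD cu IH; congr (closure S _).
by apply/funext => x /=; rewrite -[in RHS]natr1 mulrDl mul1r addrC.
Qed.

(** [a = m (a / m)] for a natural number [m > |a|]: the contraction does not increase the modular,
    and multiplication by [m] is an [m]-fold sum. *)
Lemma modular_closureZ (a : R) u : closure S u -> closure S (fun x => a * u x).
Proof.
move=> cu; have am := archi_boundP (normr_ge0 a); set m := Num.bound `|a| in am.
have m0 : 0 < m%:R :> R by exact: le_lt_trans am.
have t1 : `|a / m%:R| <= 1.
  by rewrite normrM normfV (ger0_norm (ltW m0)) ler_pdivrMr// mul1r ltW.
have := closure_nat m (closure_shrink t1 cu); congr (closure S _).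
by apply/funext => x /=; rewrite mulrA mulrCA mulfV ?mulr1// gt_eqF.
Qed.

Lemma modular_closureB u v : closure S u -> closure S v -> closure S (u \- v).
Proof.
move=> cu cv; have := modular_closureD cu (modular_closureZ (-1) cv).
by congr (closure S _); apply/funext => x /=; rewrite mulN1r.
Qed.

Lemma modular_closure0 : closure S (fun=> 0).
Proof. by apply: (sub_modular_closure SW); exact: Ssub.1. Qed.

End subspace.

End modular_topology.

Lemma exists_half_pow_le (R : realType) (e : R) : 0 < e -> exists k : nat, 2^-1 ^+ k <= e.
Proof.
move=> e0; move/cvgrPdist_lt : (@cvg_half_pow R) => /(_ e e0)[N _ /(_ N (leqnn N))].
by rewrite sub0r normrN ger0_norm ?exprn_ge0 ?invr_ge0// => /ltW; exists N.
Qed.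

(** * The closure of [S] consists of W_0^{1,q} functions *)

Section sobolev_closure.
Variables (R : realType) (n : nat) (Omega : set 'rV[R]_n) (p : 'rV[R]_n -> R).
Local Notation mu := (lebesgue_rV R n).
Local Notation q := (exp_inf Omega p).
Local Notation W := (WOmega Omega p).
Hypothesis H : admissible_exponent Omega p.
Implicit Types (f u v w : 'rV[R]_n -> R) (A B : 'rV[R]_n -> 'rV[R]_n).

Let oO : open Omega. Proof. by case: H. Qed.
Let Ofin : (mu Omega < +oo)%E. Proof. by case: H. Qed.
Let mp : measurable_fun Omega p. Proof. by case: H. Qed.
Let q1 : 1 < q. Proof. by case: H. Qed.
Let qp x : Omega x -> q <= p x. Proof. by case: H => _ _ _ _; exact. Qed.
Let mO : measurable Omega. Proof. exact: open_rV_measurable. Qed.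
Let q0 : 0 < q. Proof. exact: lt_trans q1. Qed.

Lemma small_field_Lq (e : R) : 0 < e -> exists2 h : R, 0 < h & forall A,
  measurable_field Omega A -> (field_energy Omega p A <= h%:E)%E ->
  (\int[mu]_(x in Omega) (enorm (A x) `^ q)%:E <= e%:E)%E.
Proof.
move=> e0; have [h h0 Hh] := small_powR_variable mO Ofin (ltW q1) mp qp e0.
exists h => [//|A mA EA]; apply: Hh; last exact: EA.
- exact: measurable_enorm.
- by move=> x _; exact: enorm_ge0.
Qed.

(** In place of Hoelder's inequality, [small_powR_variable] is reused with the exponent 1 and the
    constant exponent [q]. *)
Lemma small_L1 (e : R) : 0 < e -> exists2 h : R, 0 < h & forall f,
  measurable_fun Omega f -> (\int[mu]_(x in Omega) (`|f x| `^ q)%:E <= h%:E)%E ->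
  (\int[mu]_(x in Omega) `|f x|%:E <= e%:E)%E.
Proof.
move=> e0.
have [h h0 Hh] := @small_powR_variable _ _ R mu Omega mO Ofin 1 (fun=> q) e (lexx 1)
  (measurable_cst q) (fun _ _ => ltW q1) e0.
exists h => [//|f mf If].
have mn : measurable_fun Omega (fun x => `|f x|) by exact: measurableT_comp.
have := Hh (fun x => `|f x|) mn (fun _ _ => normr_ge0 _).
have -> : (\int[mu]_(x in Omega) (`|f x| `^ 1)%:E = \int[mu]_(x in Omega) `|f x|%:E)%E.
  by apply: eq_integral => x _; rewrite powRr1.
apply; apply: le_trans If; apply: (integral_le mu mO).
- by apply: measurable_funM => //; exact: measurable_powR_normr.
- exact: measurable_powR_normr.
- by move=> x _; rewrite divr_ge0 ?powR_ge0// ltW.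
- by move=> x _; rewrite ler_pdivrMr// ler_peMr ?powR_ge0 ?ltW.
Qed.

Lemma field_coord_Lq A i : measurable_field Omega A ->
  (\int[mu]_(x in Omega) (`|A x ord0 i| `^ q)%:E <=
   \int[mu]_(x in Omega) (enorm (A x) `^ q)%:E)%E.
Proof.
move=> mA; apply: (integral_le mu mO).
- exact: measurable_powR_normr.
- by apply: measurable_powR2 => //; exact: measurable_enorm.
- by move=> x _; exact: powR_ge0.
- move=> x _; apply: ge0_ler_powR; rewrite ?nnegrE ?enorm_ge0 ?(ltW q0)//.
  exact: coord_enorm.
Qed.

Lemma Lq_triangle f u v (e1 e2 : R) : measurable_fun Omega f ->
  measurable_fun Omega u -> measurable_fun Omega v ->
  (\int[mu]_(x in Omega) (`|f x - u x| `^ q)%:E <= e1%:E)%E ->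
  (\int[mu]_(x in Omega) (`|u x - v x| `^ q)%:E <= e2%:E)%E ->
  (\int[mu]_(x in Omega) (`|f x - v x| `^ q)%:E <= (2 `^ q * (e1 + e2))%:E)%E.
Proof.
move=> mf mfu mv I1 I2.
have mfu' := measurable_funB mf mfu; have muv := measurable_funB mfu mv.
have := integral_powR_normD mu mO (ltW q0) mfu' muv.
have E : (\int[mu]_(x in Omega) (`|(f \- u) x + (u \- v) x| `^ q)%:E =
    \int[mu]_(x in Omega) (`|f x - v x| `^ q)%:E)%E.
  by apply: eq_integral => x _ /=; rewrite addrA subrK.
rewrite E => I; apply: le_trans I _; rewrite EFinM EFinD.
by apply: lee_wpmul2l; [rewrite lee_fin powR_ge0|exact: leeD].
Qed.

(** The modular controls the L^q distance directly and that of the gradients through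
    [small_field_Lq], so a test function close to a late [v_ k] is close to [v]. With two errors
    [d], the quasi-triangle inequality gives [2^q (d + d) = e]. *)
Lemma fast_closed_W0 : fast_closed Omega p (W0_approximable Omega q).
Proof.
move=> v_ v Wv_ av_ Wv rv e e0.
pose d := e / (2 * 2 `^ q).
have c0 : 0 < 2 `^ q :> R by exact: powR_gt0.
have d0 : 0 < d by rewrite divr_gt0// mulr_gt0.
have dE : 2 `^ q * (d + d) = e by rewrite /d; field; rewrite gt_eqF.
have [h h0 Hh] := small_field_Lq d0.
have hd : 0 < Num.min h d by rewrite lt_min h0.
have [k kd] := exists_half_pow_le hd.
have kh : 2^-1 ^+ k <= h by apply: le_trans kd _; rewrite ge_min lexx.
have {}kd : 2^-1 ^+ k <= d by apply: le_trans kd _; rewrite ge_min lexx orbT.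
have WB := WOmegaB H (Wv_ k) Wv.
have I1 : (\int[mu]_(x in Omega) (`|v_ k x - v x| `^ q)%:E <= d%:E)%E.
  apply: (@le_trans _ _ (rho Omega p (v_ k \- v)%R)).
    by rewrite /rho leeDl//; exact: (grad_energy_ge0 H).
  by apply: le_trans (rv k) _; rewrite lee_fin.
have mGk := WOmega_grad_measurable H (Wv_ k); have mG := WOmega_grad_measurable H Wv.
have I2 : (\int[mu]_(x in Omega) (enorm (wgrad Omega (v_ k) x - wgrad Omega v x) `^ q)%:E <= d%:E)%E.
  apply: Hh; first exact: (measurable_fieldB mGk mG).
  rewrite -(grad_energyB H (Wv_ k) Wv).
  apply: (@le_trans _ _ (rho Omega p (v_ k \- v)%R)).
    by rewrite /rho leeDr//; apply: integral_ge0 => x _; rewrite lee_fin powR_ge0.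
  by apply: le_trans (rv k) _; rewrite lee_fin.
have [f [fc fv fG]] := av_ k d d0.
have mf : measurable_fun Omega f by apply: measurable_funTS; exact: C1_measurable fc.1.
exists f; split; first exact: fc.
  have := Lq_triangle mf (WOmega_measurable (Wv_ k)) (WOmega_measurable Wv) fv I1.
  by rewrite dE.
move=> i.
have mpf : measurable_fun Omega (partial i f).
  by apply: measurable_funTS; exact: C1_partial_measurable fc.1.
have I3 : (\int[mu]_(x in Omega)
   (`|wgrad Omega (v_ k) x ord0 i - wgrad Omega v x ord0 i| `^ q)%:E <= d%:E)%E.
  apply: le_trans I2; have := field_coord_Lq i (measurable_fieldB mGk mG).
  by under [X in (X <= _ -> _)%E]eq_integral do rewrite !mxE.
have := Lq_triangle mpf (mGk i) (mG i) (fG i) I3.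
by rewrite dE.
Qed.

Lemma modular_closure_W0 (S : set ('rV[R]_n -> R)) : S `<=` W ->
  (forall u, S u -> compactly_supported Omega u) ->
  modular_closure Omega p S `<=` W0_approximable Omega q.
Proof.
move=> SW Scs; apply: modular_closure_sub; last exact: fast_closed_W0.
move=> u Su; have Wu := SW _ Su; apply: compactly_supported_W0 (ltW q1) _ _ _ _.
- exact: oO.
- exact: WOmega_wd Wu.
- exact: Scs.
- exact: (WOmega_integral H Wu).
- by move=> i; exact: (WOmega_grad_integral H i Wu).
Qed.

End sobolev_closure.

(** * The minimization problem *)

Section dirichlet_minimization.
Variables (R : realType) (n : nat) (Omega : set 'rV[R]_n.+1) (p : 'rV[R]_n.+1 -> R).
Variables (S : set ('rV[R]_n.+1 -> R)) (phi : 'rV[R]_n.+1 -> R).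
Local Notation mu := (lebesgue_rV R n.+1).
Local Notation q := (exp_inf Omega p).
Local Notation W := (WOmega Omega p).
Local Notation cl := (modular_closure Omega p S).
Local Notation wgrad := (wgrad Omega).
Local Notation F := (dirichlet_integral Omega p phi).
Hypothesis H : admissible_exponent Omega p.
Hypothesis Obnd : exists2 M : R, 0 < M & forall x, Omega x -> `|x| < M.
Hypothesis SW : S `<=` W.
Hypothesis Ssub : vector_subspace S.
Hypothesis Scs : forall u, S u -> compactly_supported Omega u.
Hypothesis phiW : W phi.
Hypothesis phi_fin : (grad_energy Omega p phi < +oo)%E.
Implicit Types (f u v w : 'rV[R]_n.+1 -> R).

Let oO : open Omega. Proof. by case: H. Qed.
Let mp : measurable_fun Omega p. Proof. by case: H. Qed.
Let q1 : 1 < q. Proof. by case: H. Qed.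
Let qp x : Omega x -> q <= p x. Proof. by case: H => _ _ _ _; exact. Qed.
Let mO : measurable Omega. Proof. exact: open_rV_measurable. Qed.
Let q0 : 0 < q. Proof. exact: lt_trans q1. Qed.
Let clW u : cl u -> W u. Proof. exact: closure_WOmega. Qed.
Let mG u : W u -> measurable_field Omega (wgrad u).
Proof. by move=> Wu; exact: (WOmega_grad_measurable H Wu). Qed.

(** Energy controls the gradient in L^q because the measure is finite, and Poincare's inequality,
    valid for every element of the closure, then controls the function. *)
Lemma closure_small (e : R) : 0 < e -> exists2 h : R, 0 < h & forall d, cl d ->
  (grad_energy Omega p d <= h%:E)%E ->
  (\int[mu]_(x in Omega) (`|d x| `^ q)%:E <= e%:E)%E /\
  (\int[mu]_(x in Omega) (enorm (wgrad d x) `^ q)%:E <= e%:E)%E.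
Proof.
move=> e0; have [M M0 OM] := Obnd.
pose C := 2 `^ q * (poincare_cst M q * 2 `^ q).
have C0 : 0 <= C.
  by rewrite /C !mulr_ge0 ?powR_ge0// /poincare_cst !mulr_ge0 ?powR_ge0.
have C1 : 0 < C + 1 by rewrite ltr_wpDl.
have [h h0 Hh] := small_field_Lq H (divr_gt0 e0 C1).
exists h => [//|d cd Ed]; have Wd := clW cd.
have I1 := Hh _ (mG Wd) Ed.
have de : e / (C + 1) <= e by rewrite ler_pdivrMr// ler_peMr ?(ltW e0)// lerDr.
split; last by apply: (le_trans I1); rewrite lee_fin.
have ap : W0_approximable Omega q d by exact: (modular_closure_W0 H SW Scs cd).
have P := W0_poincare oO q1 M0 OM (WOmega_wd Wd) ap (WOmega_grad_integral H ord0 Wd).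
apply: (le_trans P).
apply: (@le_trans _ _ (C%:E * (e / (C + 1))%:E)%E).
  apply: lee_wpmul2l; first by rewrite lee_fin.
  exact: (le_trans (field_coord_Lq H ord0 (mG Wd)) I1).
rewrite -EFinM lee_fin mulrCA ler_piMr ?(ltW e0)// ler_pdivrMr// mul1r lerDl//.
Qed.

Let halfdiff u v := fun x => 2^-1 * (u \- v) x.

Lemma halfdiff_energy u v : W u -> W v -> grad_energy Omega p (halfdiff u v) =
  field_energy Omega p (fun x => 2^-1 *: (wgrad u x - wgrad v x)).
Proof.
move=> Wu Wv; rewrite (grad_energyZ H 2^-1 (WOmegaB H Wu Wv)).
apply: (field_energy_ae H).
- exact: (measurable_fieldZ 2^-1 (mG (WOmegaB H Wu Wv))).
- exact: (measurable_fieldZ 2^-1 (measurable_fieldB (mG Wu) (mG Wv))).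
- by move: (wgradB H Wu Wv); apply: filterS => x E Ox; rewrite E.
Qed.

Lemma dirichletE u : W u ->
  F u = field_energy Omega p (fun x => wgrad u x - wgrad phi x).
Proof. by move=> Wu; exact: (grad_energyB H Wu phiW). Qed.

Lemma dirichlet_midpoint u v : W u -> W v ->
  F (fun x => 2^-1 * (u \+ v) x) =
  field_energy Omega p (fun x => 2^-1 *: ((wgrad u x - wgrad phi x) + (wgrad v x - wgrad phi x))).
Proof.
move=> Wu Wv; have Wuv := WOmegaD H Wu Wv; have Wh := WOmegaZ H 2^-1 Wuv.
rewrite (dirichletE Wh); apply: (field_energy_ae H).
- exact: (measurable_fieldB (mG Wh) (mG phiW)).
- exact: (measurable_fieldZ 2^-1 (measurable_fieldD (measurable_fieldB (mG Wu) (mG phiW))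
    (measurable_fieldB (mG Wv) (mG phiW)))).
have E1 := wgradZ H 2^-1 Wuv.
have E2 := wgrad_lin oO 1 (WOmega_wd Wu) (WOmega_wd Wv).
move: E1 E2; apply: filterS2 => x E1 E2 Ox.
rewrite E1// (_ : u \+ v = (fun x => 1 * u x + v x)); last first.
  by apply/funext => y /=; rewrite mul1r.
by rewrite E2// scale1r; apply/rowP => i; rewrite !mxE; field.
Qed.

(** The midpoint of [u] and [v] is in the closure, so its energy is at least [m]; uniform convexity
    then bounds the energy of the half difference by [2 eps (m + t) + C t]. The choices of [eps] and
    [t] make each term at most [h / 2]. *)
Lemma dirichlet_gap (m h : R) : 0 <= m -> (forall u, cl u -> (m%:E <= F u)%E) -> 0 < h ->
  exists2 t : R, 0 < t & forall u v, cl u -> cl v ->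
    (F u <= (m + t)%:E)%E -> (F v <= (m + t)%:E)%E ->
    (grad_energy Omega p (halfdiff u v) <= h%:E)%E.
Proof.
move=> m0 mF h0; pose eps := h / (4 * (m + 1)).
have m1 : 0 < m + 1 by rewrite ltr_wpDl.
have eps0 : 0 < eps by rewrite divr_gt0// mulr_gt0.
have [C C0 HC] := integral_enorm_uniform_convex mu mO n.+1 q1 eps0.
exists (Num.min 1 (h / (2 * C))).
  by rewrite lt_min ltr01 divr_gt0// mulr_gt0.
move=> u v cu cv; set t := Num.min _ _ => Fu Fv.
have t1 : t <= 1 by rewrite ge_min lexx.
have tC : C * t <= h / 2.
  apply: (@le_trans _ _ (C * (h / (2 * C)))).
    by rewrite ler_wpM2l ?(ltW C0)// ge_min lexx orbT.
  by rewrite le_eqVlt; apply/orP; left; apply/eqP; field; rewrite gt_eqF.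
have Wu := clW cu; have Wv := clW cv.
have mA := measurable_fieldB (mG Wu) (mG phiW).
have mB := measurable_fieldB (mG Wv) (mG phiW).
have I : (grad_energy Omega p (halfdiff u v) + C%:E * F (fun x => (2^-1 * (u \+ v) x)%R) <=
    (eps + C / 2)%:E * (F u + F v))%E.
  rewrite (dirichletE Wu) (dirichletE Wv) (dirichlet_midpoint Wu Wv) (halfdiff_energy Wu Wv).
  have -> : (fun x => 2^-1 *: (wgrad u x - wgrad v x)) =
      (fun x => 2^-1 *: (wgrad u x - wgrad phi x - (wgrad v x - wgrad phi x))).
    by apply/funext => x; rewrite opprB addrA subrK.
  exact: (HC p _ _ mp qp mA mB).
have cm : cl (fun x => 2^-1 * (u \+ v) x).
  exact: (modular_closureZ H SW Ssub 2^-1 (modular_closureD H SW Ssub cu cv)).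
have Fm := mF _ cm.
move: I; set E := grad_energy _ _ _ => I.
have {}I : (E + (C * m)%:E <= ((eps + C / 2) * (m + t + (m + t)))%:E)%E.
  apply: (@le_trans _ _ (E + C%:E * F (fun x => (2^-1 * (u \+ v) x)%R))%E).
    by apply: leeD2l; rewrite EFinM; apply: lee_wpmul2l; [rewrite lee_fin ltW|exact: Fm].
  apply: (le_trans I); rewrite EFinM (EFinD (m + t)).
  apply: lee_wpmul2l; last exact: (leeD Fu Fv).
  by rewrite lee_fin addr_ge0 ?(ltW eps0) ?divr_ge0 ?(ltW C0).
have {}I : (E <= ((eps + C / 2) * (m + t + (m + t)))%:E - (C * m)%:E)%E by rewrite leeBrDr.
apply: (le_trans I); rewrite -EFinB lee_fin.
have -> : (eps + C / 2) * (m + t + (m + t)) - C * m = 2 * eps * (m + t) + C * t by field.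
have : 2 * eps * (m + t) <= h / 2.
  apply: (@le_trans _ _ (2 * eps * (m + 1))).
    by apply: ler_wpM2l; [rewrite mulr_ge0 ?(ltW eps0)|rewrite lerD2l].
  by rewrite /eps le_eqVlt; apply/orP; left; apply/eqP; field; rewrite gt_eqF.
move: tC; move: (C * t) (2 * eps * (m + t)) => X Y; lra.
Qed.

(** The infimum is taken over the finite values of [F], so that [m] is real. The zero function
    contributes such a value, the energy of [phi]. *)
Lemma dirichlet_infimum : exists m : R, [/\ 0 <= m, forall u, cl u -> (m%:E <= F u)%E &
  forall t : R, 0 < t -> exists2 u, cl u & (F u <= (m + t)%:E)%E].
Proof.
pose E : set R := [set r | exists2 u, cl u & F u = r%:E].
have F0 u : (0 <= F u)%E by exact: (grad_energy_ge0 H).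
have E0 : lbound E 0 by move=> r [u _ Fr]; rewrite -lee_fin -Fr.
have En : nonempty E.
  have c0 := modular_closure0 SW Ssub.
  exists (fine (F (fun=> 0))); exists (fun=> 0); first exact: c0.
  rewrite fineK// ge0_fin_numE; last exact: F0.
  have -> : F (fun=> 0) = grad_energy Omega p (fun x => -1 * phi x).
    by congr grad_energy; apply/funext => x /=; rewrite sub0r mulN1r.
  rewrite (grad_energyZ H (-1) phiW).
  apply: le_lt_trans phi_fin; apply: (field_energy_shrink H _ (mG phiW)).
  by rewrite normrN1.
exists (inf E); split; first exact: lb_le_inf.
  move=> u cu; have [Foo|Ffin] := eqVneq (F u) +oo%E; first by rewrite Foo leey.
  have Fu : F u \is a fin_num by rewrite ge0_fin_numE ?lt_neqAle ?leey ?andbT//; exact: F0.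
  rewrite -(fineK Fu) lee_fin; apply: ge_inf; first by exists 0.
  by exists u => //; rewrite fineK.
move=> t t0; have [|r [u cu Fr] rt] := @inf_adherent R E t t0.
  by split=> //; exists 0.
by exists u => //; rewrite Fr lee_fin ltW.
Qed.

(** The L^1 bounds are brought back to full differences by homogeneity. The energy bound cannot be
    doubled and stays on the half difference, and the L^q bound is kept on the same half difference
    to match it in [rho]. *)
Lemma dirichlet_close (m e : R) : 0 <= m -> (forall u, cl u -> (m%:E <= F u)%E) -> 0 < e ->
  exists2 t : R, 0 < t & forall u v, cl u -> cl v ->
    (F u <= (m + t)%:E)%E -> (F v <= (m + t)%:E)%E ->
    [/\ (\int[mu]_(x in Omega) `|u x - v x|%:E <= e%:E)%E,
     forall i, (\int[mu]_(x in Omega) `|wgrad u x ord0 i - wgrad v x ord0 i|%:E <= e%:E)%E,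
     (\int[mu]_(x in Omega) (`|2^-1 * (u x - v x)| `^ q)%:E <= e%:E)%E &
     (field_energy Omega p (fun x => 2^-1 *: (wgrad u x - wgrad v x)) <= e%:E)%E].
Proof.
move=> m0 mF e0; have e2 : 0 < e / 2 by rewrite divr_gt0.
have [h1 h10 L1] := small_L1 H e2.
have k0 : 0 < Num.min h1 e by rewrite lt_min h10.
have [h2 h20 L2] := closure_small k0.
have h0 : 0 < Num.min h2 e by rewrite lt_min h20.
have [t t0 Ht] := dirichlet_gap m0 mF h0; exists t => [//|u v cu cv Fu Fv].
have {}Ht := Ht u v cu cv Fu Fv.
have Wu := clW cu; have Wv := clW cv.
have cd : cl (halfdiff u v).
  exact: (modular_closureZ H SW Ssub 2^-1 (modular_closureB H SW Ssub cu cv)).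
have Wd := clW cd.
have Ed : (grad_energy Omega p (halfdiff u v) <= h2%:E)%E.
  by apply: (le_trans Ht); rewrite lee_fin ge_min lexx.
have [I1 I2] := L2 _ cd Ed.
have mh : Num.min h1 e <= h1 by rewrite ge_min lexx.
have me : Num.min h1 e <= e by rewrite ge_min lexx orbT.
have dbl f g : measurable_fun Omega f -> (forall x, Omega x -> g x = 2 * f x) ->
    (\int[mu]_(x in Omega) (`|f x| `^ q)%:E <= h1%:E)%E ->
    (\int[mu]_(x in Omega) `|g x|%:E <= e%:E)%E.
  move=> mf gf If; have I := L1 f mf If.
  apply: (@le_trans _ _ (2%:E * \int[mu]_(x in Omega) `|f x|%:E)%E).
    apply: (integral_leZ mu mO) => //.
    - apply: measurableT_comp => //; apply: (eq_measurable_fun (fun x => 2 * f x)).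
        by move=> x /set_mem Ox; rewrite gf.
      exact: measurable_funM.
    - exact: measurableT_comp.
    - by move=> x Ox; rewrite gf// normrM ger0_norm.
  apply: (@le_trans _ _ (2%:E * (e / 2)%:E)%E).
    by apply: lee_wpmul2l => //; rewrite lee_fin.
  by rewrite -EFinM lee_fin mulrCA mulfV ?mulr1.
split.
- apply: (dbl (halfdiff u v)); first exact: (WOmega_measurable Wd).
    by move=> x _; rewrite /halfdiff/= mulrA mulfV// mul1r.
  by apply: (le_trans I1); rewrite lee_fin.
- move=> i; pose G x := 2^-1 *: (wgrad u x - wgrad v x).
  have mGd : measurable_field Omega G.
    exact: (measurable_fieldZ 2^-1 (measurable_fieldB (mG Wu) (mG Wv))).
  apply: (dbl (fun x => G x ord0 i)); first exact: mGd.
    by move=> x _; rewrite /G !mxE mulrA mulfV// mul1r.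
  apply: (le_trans (field_coord_Lq H i mGd)).
  suff -> : (\int[mu]_(x in Omega) (enorm (G x) `^ q)%:E =
    \int[mu]_(x in Omega) (enorm (wgrad (halfdiff u v) x) `^ q)%:E)%E.
    by apply: (le_trans I2); rewrite lee_fin.
  apply: ge0_integral_ae_eq => //.
  + by apply: measurable_powR2 => //; exact: measurable_enorm.
  + by apply: measurable_powR2 => //; exact: (measurable_enorm mO (mG Wd)).
  have E1 := wgradZ H 2^-1 (WOmegaB H Wu Wv); have E2 := wgradB H Wu Wv.
  by move: E1 E2; apply: filterS2 => x E1 E2 Ox; rewrite (E1 Ox) (E2 Ox).
- by apply: (le_trans I1); rewrite lee_fin.
- rewrite -(halfdiff_energy Wu Wv); apply: (le_trans Ht).
  by rewrite lee_fin ge_min lexx orbT.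
Qed.

(** Both functions meet every threshold [m + t], so [dirichlet_close] makes their L^1 distance
    smaller than any [e]. *)
Lemma minimizer_unique u v : is_minimizer F cl u -> is_minimizer F cl v -> ae_eq_on Omega u v.
Proof.
move=> [cu Fu] [cv Fv]; have [m [m0 mF mE]] := dirichlet_infimum.
have le_m w : is_minimizer F cl w -> forall t : R, 0 < t -> (F w <= (m + t)%:E)%E.
  by move=> [cw Fw] t t0; have [w' cw' Fw'] := mE t t0; exact: le_trans (Fw _ cw') Fw'.
have mf : measurable_fun Omega (fun x => u x - v x).
  by apply: measurable_funB; apply: WOmega_measurable; exact: clW.
have I0 : (\int[mu]_(x in Omega) `|(u x - v x)%:E| = 0)%E.
  apply/eqP; rewrite eq_le; apply/andP; split; last by apply: integral_ge0.
  apply/lee_addgt0Pr => e e0; rewrite add0e.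
  have [t t0 Ht] := dirichlet_close m0 mF e0.
  by have [] := Ht u v cu cv (le_m u (conj cu Fu) t t0) (le_m v (conj cv Fv) t t0).
have := (ae_eq_integral_abs mu mO (proj2 (measurable_EFinP _ _) mf)).1 I0.
by apply: filterS => x E Ox; have := E Ox => /= -[] /eqP; rewrite subr_eq0 => /eqP.
Qed.

End dirichlet_minimization.

Lemma cvg_powR_norm (R : realType) (a : nat -> R) (l r : R) : 1 < r ->
  a @ \oo --> l -> (fun k => `|a k| `^ r) @ \oo --> `|l| `^ r.
Proof.
move=> r1 al; have [D _] := is_derive_powR_norm l r1.
apply: (@continuous_cvg _ _ _ _ _ a (fun s : R => `|s| `^ r) l _ al).
by apply: differentiable_continuous; exact/derivable1_diffP.
Qed.

Lemma cvg_enorm (R : realType) (n : nat) (A_ : nat -> 'rV[R]_n) (a : 'rV[R]_n) :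
  (forall i, (fun k => A_ k ord0 i) @ \oo --> a ord0 i) ->
  (fun k => enorm (A_ k)) @ \oo --> enorm a.
Proof.
move=> H.
have S (r : seq 'I_n) : (fun k => \sum_(i <- r) A_ k ord0 i ^+ 2) @ \oo -->
    \sum_(i <- r) a ord0 i ^+ 2.
  elim: r => [|i r IH].
    by under eq_cvg do rewrite big_nil; rewrite big_nil; exact: cvg_cst.
  under eq_cvg do rewrite big_cons; rewrite big_cons; apply: cvgD; last exact: IH.
  by rewrite expr2; under eq_cvg do rewrite expr2; apply: cvgM; exact: H.
apply: (@continuous_cvg _ _ _ _ _ _ (@Num.sqrt R) _ _ (S (index_enum 'I_n))).
exact: sqrt_continuous.
Qed.

(** * Existence of a minimizer *)

Section minimizer_existence.
Variables (R : realType) (n : nat) (Omega : set 'rV[R]_n.+1) (p : 'rV[R]_n.+1 -> R).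
Variables (S : set ('rV[R]_n.+1 -> R)) (phi : 'rV[R]_n.+1 -> R).
Local Notation mu := (lebesgue_rV R n.+1).
Local Notation q := (exp_inf Omega p).
Local Notation W := (WOmega Omega p).
Local Notation cl := (modular_closure Omega p S).
Local Notation wgrad := (wgrad Omega).
Local Notation F := (dirichlet_integral Omega p phi).
Hypothesis H : admissible_exponent Omega p.
Hypothesis Obnd : exists2 M : R, 0 < M & forall x, Omega x -> `|x| < M.
Hypothesis SW : S `<=` W.
Hypothesis Ssub : vector_subspace S.
Hypothesis Scs : forall u, S u -> compactly_supported Omega u.
Hypothesis phiW : W phi.
Hypothesis phi_fin : (grad_energy Omega p phi < +oo)%E.
Implicit Types (f g u v w : 'rV[R]_n.+1 -> R).

Let oO : open Omega. Proof. by case: H. Qed.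
Let Ofin : (mu Omega < +oo)%E. Proof. by case: H. Qed.
Let mp : measurable_fun Omega p. Proof. by case: H. Qed.
Let q1 : 1 < q. Proof. by case: H. Qed.
Let qp x : Omega x -> q <= p x. Proof. by case: H => _ _ _ _; exact. Qed.
Let mO : measurable Omega. Proof. exact: open_rV_measurable. Qed.
Let q0 : 0 < q. Proof. exact: lt_trans q1. Qed.
Let p1 x : Omega x -> 1 < p x. Proof. by move=> /qp; exact: lt_le_trans. Qed.
Let clW u : cl u -> W u. Proof. exact: closure_WOmega. Qed.
Let mG u : W u -> measurable_field Omega (wgrad u).
Proof. by move=> Wu; exact: (WOmega_grad_measurable H Wu). Qed.

Lemma Lvar_integrable (r : 'rV[R]_n.+1 -> R) f : measurable_fun Omega r ->
  (forall x, Omega x -> 1 <= r x) -> Lvar Omega r f -> mu.-integrable Omega (EFin \o f).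
Proof.
move=> mr r1 Lf; have [mf _] := Lf; apply/integrableP; split; first exact/measurable_EFinP.
have := Lvar_integral_powR mO Ofin mr (lexx 1) r1 Lf.
apply: le_lt_trans; rewrite le_eqVlt; apply/orP; left; apply/eqP.
by apply: eq_integral => x _ /=; rewrite powRr1.
Qed.

Lemma WOmega_integrable u : W u -> mu.-integrable Omega (EFin \o u).
Proof.
by move=> [Lu _ _]; apply: (Lvar_integrable _ _ Lu); [exact: measurable_cst|move=> x _; exact: ltW].
Qed.

Lemma WOmega_grad_integrable u i : W u -> mu.-integrable Omega (fun x => (wgrad u x ord0 i)%:E).
Proof.
move=> [_ _ Lu]; have := Lvar_integrable mp _ (Lu i); apply => x Ox; exact: ltW (p1 Ox).
Qed.

Lemma integrable_of_near f g (c : R) : mu.-integrable Omega (EFin \o f) ->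
  measurable_fun Omega g -> (\int[mu]_(x in Omega) `|f x - g x|%:E <= c%:E)%E ->
  mu.-integrable Omega (EFin \o g).
Proof.
move=> iF mg I; have mf : measurable_fun Omega f by apply/measurable_EFinP; exact: measurable_int iF.
have iD : mu.-integrable Omega (EFin \o (fun x => f x - g x)).
  apply/integrableP; split; first by apply/measurable_EFinP; exact: measurable_funB.
  exact: le_lt_trans I (ltry _).
have := integrable_subr mO iF iD.
by congr (mu.-integrable _ _); apply/funext => x /=; rewrite opprB addrC subrK.
Qed.

(** The modular of [Lvar] has no division by [p]: the scale [1/2] compensates, as
    [2^-p <= 1 / p]. *)
Lemma half_energy_Lvar (A : 'rV[R]_n.+1 -> 'rV[R]_n.+1) i : measurable_field Omega A ->
  (field_energy Omega p (fun x => 2^-1 *: A x) < +oo)%E ->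
  Lvar Omega p (fun x => 2^-1 * A x ord0 i).
Proof.
move=> mA E; have mAi := mA i; split; first exact: measurable_funM.
exists 2^-1; first by rewrite invr_gt0.
apply: le_lt_trans E; apply: (integral_le mu mO).
- by apply: measurable_powR_normr => //; do 2 apply: measurable_funM => //.
- exact: (measurable_energy H (measurable_fieldZ 2^-1 mA)).
- by move=> x _; exact: powR_ge0.
move=> x Ox; have p1x := p1 Ox; have p0x : 0 < p x by lra.
rewrite normrM powRM// ger0_norm ?invr_ge0// [leRHS]mulrC; apply: ler_pM; rewrite ?powR_ge0//.
  have -> : 2^-1 = 2 `^ (-1) :> R by rewrite powR_inv1.
  rewrite -powRrM mulN1r powRN lef_pV2 ?posrE ?powR_gt0//.
  exact: le_powR2 (ltW p1x).
apply: ge0_ler_powR; rewrite ?nnegrE ?enorm_ge0 ?(ltW p0x)//.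
by have := coord_enorm (2^-1 *: A x) i; rewrite mxE.
Qed.

Section limit.
Variables (u_ : nat -> 'rV[R]_n.+1 -> R) (v : 'rV[R]_n.+1 -> R) (G : 'rV[R]_n.+1 -> 'rV[R]_n.+1).
Hypothesis cu : forall k, cl (u_ k).
Hypothesis close : forall k j, (k <= j)%N ->
  [/\ (\int[mu]_(x in Omega) `|u_ k x - u_ j x|%:E <= (2^-1 ^+ k)%:E)%E,
     forall i, (\int[mu]_(x in Omega)
       `|wgrad (u_ k) x ord0 i - wgrad (u_ j) x ord0 i|%:E <= (2^-1 ^+ k)%:E)%E,
     (\int[mu]_(x in Omega) (`|2^-1 * (u_ k x - u_ j x)| `^ q)%:E <= (2^-1 ^+ k)%:E)%E &
     (field_energy Omega p (fun x => 2^-1 *: (wgrad (u_ k) x - wgrad (u_ j) x)) <= (2^-1 ^+ k)%:E)%E].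
Hypothesis mv : measurable_fun Omega v.
Hypothesis mGv : measurable_field Omega G.
Hypothesis uv : {ae mu, forall x, Omega x -> u_ ^~ x @ \oo --> v x}.
Hypothesis uG : {ae mu, forall x, forall i, Omega x ->
  (fun k => wgrad (u_ k) x ord0 i) @ \oo --> G x ord0 i}.

Let Wu k : W (u_ k). Proof. exact: clW. Qed.
Let mu_ k : measurable_fun Omega (u_ k). Proof. exact: WOmega_measurable (Wu k). Qed.

Let mB f g : measurable_fun Omega f -> measurable_fun Omega g ->
  measurable_fun Omega (fun x => `|f x - g x|).
Proof. by move=> mf mg; apply: measurableT_comp => //; exact: measurable_funB. Qed.

(** Fatou's lemma in the second index [j] with [k] fixed; [limit_grad_L1], [limit_Lq] and
    [limit_energy] arise in the same way. *)
Let limit_L1 k : (\int[mu]_(x in Omega) `|u_ k x - v x|%:E <= (2^-1 ^+ k)%:E)%E.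
Proof.
apply: (fatou_bound mO (F := fun j x => `|u_ k x - u_ j x|)).
- by move=> j; exact: (mB (mu_ k) (mu_ j)).
- exact: (mB (mu_ k) mv).
- by [].
- move: uv; apply: filterS => x ux Ox; apply: cvg_norm; apply: cvgB; last exact: ux.
  exact: cvg_cst.
- by exists k => // j /= kj; have [] := close kj.
Qed.

Let limit_grad_L1 k i :
  (\int[mu]_(x in Omega) `|wgrad (u_ k) x ord0 i - G x ord0 i|%:E <= (2^-1 ^+ k)%:E)%E.
Proof.
apply: (fatou_bound mO (F := fun j x => `|wgrad (u_ k) x ord0 i - wgrad (u_ j) x ord0 i|)).
- by move=> j; exact: (mB (mG (Wu k) i) (mG (Wu j) i)).
- exact: (mB (mG (Wu k) i) (mGv i)).
- by [].
- move: uG; apply: filterS => x ux Ox; apply: cvg_norm; apply: cvgB; last exact: ux.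
  exact: cvg_cst.
- by exists k => // j /= kj; have [_ h _ _] := close kj; exact: h.
Qed.

Let limit_Lq k : (\int[mu]_(x in Omega) (`|2^-1 * (u_ k x - v x)| `^ q)%:E <= (2^-1 ^+ k)%:E)%E.
Proof.
have M w : measurable_fun Omega w -> measurable_fun Omega (fun x => `|2^-1 * (u_ k x - w x)| `^ q).
  move=> mw; apply: measurable_powR_normr => //; apply: measurable_funM => //.
  exact: measurable_funB.
apply: (fatou_bound mO (F := fun j x => `|2^-1 * (u_ k x - u_ j x)| `^ q)).
- by move=> j; exact: M.
- exact: M.
- by move=> j x _; exact: powR_ge0.
- move: uv; apply: filterS => x ux Ox; apply: cvg_powR_norm => //; apply: cvgM; first exact: cvg_cst.
  by apply: cvgB; [exact: cvg_cst|exact: ux].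
- by exists k => // j /= kj; have [_ _ h _] := close kj; exact: h.
Qed.

Let energy_cvg (A_ : nat -> 'rV[R]_n.+1) (a : 'rV[R]_n.+1) x : Omega x ->
  (forall i, (fun k => A_ k ord0 i) @ \oo --> a ord0 i) ->
  (fun k => enorm (A_ k) `^ p x / p x) @ \oo --> enorm a `^ p x / p x.
Proof.
move=> Ox Aa; apply: cvgM; last exact: cvg_cst.
have := cvg_powR_norm (p1 Ox) (cvg_enorm Aa).
by rewrite ger0_norm ?enorm_ge0//; under eq_cvg do rewrite ger0_norm ?enorm_ge0//.
Qed.

Let limit_energy k :
  (field_energy Omega p (fun x => 2^-1 *: (wgrad (u_ k) x - G x)) <= (2^-1 ^+ k)%:E)%E.
Proof.
apply: (fatou_bound mO (F := fun j x =>
  enorm (2^-1 *: (wgrad (u_ k) x - wgrad (u_ j) x)) `^ p x / p x)).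
- move=> j; apply: (measurable_energy H).
  exact: (measurable_fieldZ 2^-1 (measurable_fieldB (mG (Wu k)) (mG (Wu j)))).
- apply: (measurable_energy H).
  exact: (measurable_fieldZ 2^-1 (measurable_fieldB (mG (Wu k)) mGv)).
- move=> j x Ox.
  exact: (energy_density_ge0 H (fun x => 2^-1 *: (wgrad (u_ k) x - wgrad (u_ j) x)) Ox).
- move: uG; apply: filterS => x ux Ox; apply: energy_cvg => // i.
  rewrite !mxE; under eq_cvg do rewrite !mxE.
  by apply: cvgM; [exact: cvg_cst|apply: cvgB; [exact: cvg_cst|exact: ux]].
- by exists k => // j /= kj; have [_ _ _ h] := close kj; exact: h.
Qed.

Let limit_weak_grad : is_weak_grad Omega v G.
Proof.
have iv : mu.-integrable Omega (EFin \o v).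
  exact: integrable_of_near (WOmega_integrable (Wu 0)) mv (limit_L1 0).
have iG i : mu.-integrable Omega (fun x => (G x ord0 i)%:E).
  exact: (integrable_of_near (WOmega_grad_integrable i (Wu 0)) (mGv i) (limit_grad_L1 0 i)).
apply: (is_weak_grad_L1_limit oO iv iG) => i e e0.
have [k ke] := exists_half_pow_le e0.
exists (u_ k), (wgrad (u_ k)); split.
- exact: (wgradP (WOmega_wd (Wu k))).
- exact: (WOmega_integrable (Wu k)).
- exact: (WOmega_grad_integrable i (Wu k)).
- under eq_integral do rewrite distrC.
  by apply: (le_trans (limit_L1 k)); rewrite lee_fin.
- under eq_integral do rewrite distrC.
  by apply: (le_trans (limit_grad_L1 k i)); rewrite lee_fin.
Qed.

(** [v = u_ 0 - 2 ((u_ 0 - v) / 2)]: the half difference has finite energy, and [Lvar], unlike the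
    set of finite energy, is a vector space. *)
Let limit_W : W v.
Proof.
have m2 w : measurable_fun Omega w -> measurable_fun Omega (fun x => 2^-1 * w x).
  by move=> mw; exact: measurable_funM.
have [Lu _ LG] := Wu 0.
have Lh : Lvar Omega (fun=> q) (fun x => 2^-1 * (u_ 0 x - v x)).
  apply: (Lvar_cstP mO _ (ltW q0)).2; split; first exact: (m2 _ (measurable_funB (mu_ 0) mv)).
  exact: le_lt_trans (limit_Lq 0) (ltry _).
have Lv : Lvar Omega (fun=> q) v.
  have := Lvar_lin mO (-2) (measurable_cst q) (fun _ _ => ltW q1) Lh Lu.
  by congr Lvar; apply/funext => x; field.
apply: (WOmega_intro H mv _ limit_weak_grad).
  by have [] := (Lvar_cstP mO v (ltW q0)).1 Lv.
move=> i; have E0 := le_lt_trans (limit_energy 0) (ltry _).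
have := half_energy_Lvar i (measurable_fieldB (mG (Wu 0)) mGv) E0.
move=> Lhi; have := Lvar_lin mO (-2) mp (fun x Ox => ltW (p1 Ox)) Lhi (LG i).
by congr Lvar; apply/funext => x; rewrite !mxE; field.
Qed.

Let gradE : {ae mu, forall x, Omega x -> wgrad v x = G x}.
Proof. exact: (wgradE oO limit_weak_grad). Qed.

(** The halves [u_ k.+1 / 2] converge to [v / 2] in the modular; the factor 2 is restored inside the
    closure. The index is shifted by one because [rho] has two summands, each at most [2^-(k+1)]. *)
Lemma limit_closure : cl v.
Proof.
have Wv := limit_W.
have : cl (fun x => 2^-1 * v x).
  apply: (@fast_closed_closure R n.+1 Omega p S (fun k x => 2^-1 * u_ k.+1 x)).
  - by move=> k; exact: (WOmegaZ H 2^-1 (Wu k.+1)).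
  - by move=> k; exact: (modular_closureZ H SW Ssub 2^-1 (cu k.+1)).
  - exact: (WOmegaZ H 2^-1 Wv).
  move=> k; rewrite /rho (_ : _ \- _ = (fun x => 2^-1 * (u_ k.+1 \- v) x)); last first.
    by apply/funext => x /=; rewrite mulrBr.
  have -> : 2^-1 ^+ k = 2^-1 ^+ k.+1 + 2^-1 ^+ k.+1 :> R by rewrite exprS; field.
  rewrite EFinD; apply: leeD; first exact: limit_Lq.
  rewrite (grad_energyZ H 2^-1 (WOmegaB H (Wu k.+1) Wv)).
  apply: le_trans (limit_energy k.+1); rewrite le_eqVlt; apply/orP; left; apply/eqP.
  apply: (field_energy_ae H).
  - exact: (measurable_fieldZ 2^-1 (mG (WOmegaB H (Wu k.+1) Wv))).
  - exact: (measurable_fieldZ 2^-1 (measurable_fieldB (mG (Wu k.+1)) mGv)).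
  move: (wgradB H (Wu k.+1) Wv) gradE; apply: filterS2 => x E1 E2 Ox.
  by rewrite (E1 Ox) (E2 Ox).
move=> /(modular_closureZ H SW Ssub 2); congr (cl _).
by apply/funext => x; rewrite mulrA mulfV// mul1r.
Qed.

Lemma limit_dirichlet (c : R) : (\forall k \near \oo, (F (u_ k) <= c%:E)%E) -> (F v <= c%:E)%E.
Proof.
move=> Fc; have Wv := limit_W.
rewrite (dirichletE H phiW Wv).
have -> : field_energy Omega p (fun x => wgrad v x - wgrad phi x) =
   field_energy Omega p (fun x => G x - wgrad phi x).
  apply: (field_energy_ae H).
  - exact: (measurable_fieldB (mG Wv) (mG phiW)).
  - exact: (measurable_fieldB mGv (mG phiW)).
  - by move: gradE; apply: filterS => x E Ox; rewrite (E Ox).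
apply: (fatou_bound mO (F := fun j x => enorm (wgrad (u_ j) x - wgrad phi x) `^ p x / p x)).
- by move=> j; apply: (measurable_energy H); exact: (measurable_fieldB (mG (Wu j)) (mG phiW)).
- by apply: (measurable_energy H); exact: (measurable_fieldB mGv (mG phiW)).
- by move=> j x Ox; exact: (energy_density_ge0 H (fun x => wgrad (u_ j) x - wgrad phi x) Ox).
- move: uG; apply: filterS => x ux Ox; apply: energy_cvg => // i.
  rewrite !mxE; under eq_cvg do rewrite !mxE.
  by apply: cvgB; [exact: ux|exact: cvg_cst].
- by apply: filterS Fc => k; rewrite (dirichletE H phiW (Wu k)).
Qed.

End limit.

Lemma minimizer_exists : exists v, is_minimizer F cl v /\ (F v < +oo)%E.
Proof.
have [m [m0 mF mE]] := dirichlet_infimum H SW Ssub phiW phi_fin.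
have hp (k : nat) : 0 < 2^-1 ^+ k :> R by rewrite exprn_gt0// invr_gt0.
have /choice[t Ht] : forall k : nat, exists t : R, 0 < t /\ forall u v, cl u -> cl v ->
    (F u <= (m + t)%:E)%E -> (F v <= (m + t)%:E)%E ->
    [/\ (\int[mu]_(x in Omega) `|u x - v x|%:E <= (2^-1 ^+ k)%:E)%E,
     forall i, (\int[mu]_(x in Omega) `|wgrad u x ord0 i - wgrad v x ord0 i|%:E <= (2^-1 ^+ k)%:E)%E,
     (\int[mu]_(x in Omega) (`|2^-1 * (u x - v x)| `^ q)%:E <= (2^-1 ^+ k)%:E)%E &
     (field_energy Omega p (fun x => 2^-1 *: (wgrad u x - wgrad v x)) <= (2^-1 ^+ k)%:E)%E].
  move=> k; have [t t0 Ht] := dirichlet_close H Obnd SW Ssub Scs phiW m0 mF (hp k).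
  by exists t; split; [exact: t0|exact: Ht].
(* [s k] is below all of [t 0], ..., [t k], so every [u_ j] with [j >= k] meets the threshold of
   step [k]; being below [2^-k], it also drives the energies to [m]. *)
have /choice[s Hs] : forall k : nat, exists s : R,
    0 < s /\ forall i : 'I_k.+1, s <= Num.min (t i) (2^-1 ^+ k).
  move=> k; have [|s s0 Hs] := @ord_min_pos R k.+1 (fun i => Num.min (t i) (2^-1 ^+ k)).
    by move=> i; rewrite lt_min hp (Ht i).1.
  by exists s.
have /choice[u_ Hu] : forall k : nat, exists u, cl u /\ (F u <= (m + s k)%:E)%E.
  by move=> k; have [u cu Fu] := mE _ (Hs k).1; exists u.
have cu k : cl (u_ k) by exact: (Hu k).1.
have Fu k j : (k <= j)%N -> (F (u_ j) <= (m + t k)%:E)%E.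
  move=> kj; apply: (le_trans (Hu j).2); rewrite lee_fin lerD2l.
  have kj' : (k < j.+1)%N by [].
  by have := (Hs j).2 (Ordinal kj'); rewrite le_min => /andP[].
have close k j (kj : (k <= j)%N) := (Ht k).2 _ _ (cu k) (cu j) (Fu k k (leqnn k)) (Fu k j kj).
have Wu k : W (u_ k) := clW (cu k).
have [v [mv uv]] : exists v, measurable_fun Omega v /\
    {ae mu, forall x, Omega x -> u_ ^~ x @ \oo --> v x}.
  apply: (fast_cauchy mO) => k; first exact: WOmega_measurable (Wu k).
  have [h _ _ _] := close k k.+1 (leqnSn k).
  by under eq_integral do rewrite distrC; exact: h.
have /choice[G_ HG] : forall i : 'I_n.+1, exists g : 'rV[R]_n.+1 -> R, measurable_fun Omega g /\
    {ae mu, forall x, Omega x -> (fun k => wgrad (u_ k) x ord0 i) @ \oo --> g x}.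
  move=> i; apply: (@fast_cauchy _ _ _ _ _ mO (fun k x => wgrad (u_ k) x ord0 i)) => k.
    exact: (mG (Wu k)).
  have [_ h _ _] := close k k.+1 (leqnSn k).
  by under eq_integral do rewrite distrC; exact: h.
pose G (x : 'rV[R]_n.+1) : 'rV[R]_n.+1 := \row_i G_ i x.
have mGv : measurable_field Omega G.
  by move=> i; under eq_fun do rewrite mxE; exact: (HG i).1.
have uG : {ae mu, forall x, forall i, Omega x ->
    (fun k => wgrad (u_ k) x ord0 i) @ \oo --> G x ord0 i}.
  apply: ae_forall_ord => i; move: (HG i).2; apply: filterS => x Gx Ox.
  by rewrite mxE; exact: Gx.
have Fv (c : R) : 0 < c -> (F v <= (m + c)%:E)%E.
  move=> c0; apply: (limit_dirichlet cu close mv mGv uv uG).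
  have [k kc] := exists_half_pow_le c0; exists k => // j /= kj.
  apply: (le_trans (Hu j).2); rewrite lee_fin lerD2l; apply: le_trans kc.
  apply: (@le_trans _ _ (2^-1 ^+ j)).
    by have := (Hs j).2 ord0; rewrite le_min => /andP[].
  by apply: ler_wiXn2l => //; rewrite ?invr_ge0// invf_le1// ler1n.
have cv := limit_closure cu close mv mGv uv uG.
exists v; split; last exact: le_lt_trans (Fv 1 ltr01) (ltry _).
split; first exact: cv.
move=> w cw; apply: le_trans (mF w cw).
by apply/lee_addgt0Pr => c c0; rewrite -EFinD; exact: Fv.
Qed.

End minimizer_existence.

(** * The weak equation *)

Section flux.
Variables (R : realType) (n : nat).
Implicit Types (a z : 'rV[R]_n).

Lemma flux_le (r : R) a z : 1 < r ->
  `|enorm a `^ (r - 2) * dotv a z| <= enorm a `^ (r - 1) * enorm z.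
Proof.
move=> r1; rewrite normrM ger0_norm ?powR_ge0//.
apply: le_trans (ler_wpM2l (powR_ge0 _ _) (normr_dotv_le a z)) _.
by rewrite mulrA powRB2M1 ?enorm_ge0 ?gt_eqF.
Qed.

(** Young's inequality gives [|a|^r] the coefficient [(r - 1) / r], here bounded by 1. No bound by a
    multiple of [|a|^r / r] uniform in [r] would hold for this term. *)
Lemma flux_young (r : R) a z : 1 < r ->
  enorm a `^ (r - 1) * enorm z <= enorm a `^ r + enorm z `^ r / r.
Proof.
move=> r1; have r0 : 0 < r by lra.
have Y := young_powR (enorm_ge0 a) (enorm_ge0 z) (ltW r1).
have P := powR_ge0 (enorm a) r.
rewrite -(ler_pM2l r0) mulrA mulrDr mulrCA mulfV ?gt_eqF// mulr1.
by apply: (le_trans Y); rewrite lerD2r ler_wpM2r// gerBl.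
Qed.

Lemma cvg_coord_dotv (a_ : nat -> 'rV[R]_n) a z :
  (forall i, (fun k => a_ k ord0 i) @ \oo --> a ord0 i) ->
  (fun k => dotv (a_ k) z) @ \oo --> dotv a z.
Proof.
move=> H.
have S (r : seq 'I_n) : (fun k => \sum_(i <- r) a_ k ord0 i * z ord0 i) @ \oo -->
    \sum_(i <- r) a ord0 i * z ord0 i.
  elim: r => [|i r IH].
    by under eq_cvg do rewrite big_nil; rewrite big_nil; exact: cvg_cst.
  under eq_cvg do rewrite big_cons; rewrite big_cons; apply: cvgD; last exact: IH.
  by apply: cvgM; [exact: H|exact: cvg_cst].
exact: (S (index_enum 'I_n)).
Qed.

(** Where [a] is nonzero each factor is continuous. At [a = 0] the power may blow up for [r < 2],
    and the flux is squeezed by [|a_ k|^(r-1) |z|], which tends to 0 since [r > 1]. *)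
Lemma cvg_flux (r : R) (a_ : nat -> 'rV[R]_n) a z : 1 < r ->
  (forall i, (fun k => a_ k ord0 i) @ \oo --> a ord0 i) ->
  (fun k => enorm (a_ k) `^ (r - 2) * dotv (a_ k) z) @ \oo -->
    enorm a `^ (r - 2) * dotv a z.
Proof.
move=> r1 H; have Ha := cvg_enorm H.
have [a0|a0] := eqVneq a 0.
  rewrite a0 dotvC dotv0r mulr0.
  apply: norm_cvg0.
  apply: (@squeeze_cvgr _ _ _ _ (fun=> 0) (fun k => enorm (a_ k) `^ (r - 1) * enorm z)).
  - by apply: nearW => k; rewrite normr_ge0 flux_le.
  - exact: cvg_cst.
  - rewrite -[X in _ --> X](mul0r (enorm z)); apply: cvgM; last exact: cvg_cst.
    rewrite a0 enorm0 in Ha.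
    apply: (@cvg_powR0 R _ 1 (r - 1)) => //; [by rewrite subr_gt0|by move=> k; exact: enorm_ge0|].
    by under eq_cvg do rewrite powRr1 ?enorm_ge0// divr1.
have ap : 0 < enorm a.
  by rewrite lt_def enorm_ge0 andbT; apply/eqP => /enorm_eq0 /eqP; rewrite (negbTE a0).
apply: cvgM; last exact: cvg_coord_dotv.
apply: (@continuous_cvg _ _ _ _ _ _ (fun s : R => s `^ (r - 2)) _ _ Ha).
apply: differentiable_continuous; apply/derivable1_diffP.
by have [] := is_derive1_powR (r - 2) ap.
Qed.

End flux.

Section weak_equation.
Variables (R : realType) (n : nat) (Omega : set 'rV[R]_n) (p : 'rV[R]_n -> R).
Local Notation mu := (lebesgue_rV R n).
Local Notation q := (exp_inf Omega p).
Hypothesis H : admissible_exponent Omega p.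
Implicit Types (f g u v w : 'rV[R]_n -> R) (a b z A B : 'rV[R]_n -> 'rV[R]_n).

Let oO : open Omega. Proof. by case: H. Qed.
Let mp : measurable_fun Omega p. Proof. by case: H. Qed.
Let q1 : 1 < q. Proof. by case: H. Qed.
Let qp x : Omega x -> q <= p x. Proof. by case: H => _ _ _ _; exact. Qed.
Let mO : measurable Omega. Proof. exact: open_rV_measurable. Qed.
Let p1 x : Omega x -> 1 < p x. Proof. by move=> /qp; exact: lt_le_trans. Qed.

Definition flux_density a z x : R := enorm (a x) `^ (p x - 2) * dotv (a x) (z x).

Definition energy_density a x : R := enorm (a x) `^ p x / p x.

Lemma measurable_flux a z : measurable_field Omega a -> measurable_field Omega z ->
  measurable_fun Omega (flux_density a z).
Proof.
move=> ma mz; apply: measurable_funM; last exact: measurable_dotv.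
apply: measurable_powR2 => //; first exact: measurable_enorm.
exact: measurable_funB.
Qed.

Lemma integrable_dominated f g : measurable_fun Omega f ->
  (forall x, Omega x -> `|f x| <= g x) -> mu.-integrable Omega (EFin \o g) ->
  mu.-integrable Omega (EFin \o f).
Proof.
move=> mf fg ig; apply: (le_integrable mO _ _ ig); first exact/measurable_EFinP.
by move=> x Ox; rewrite /= lee_fin; exact: le_trans (fg x Ox) (ler_norm _).
Qed.

Lemma integrable_energy_density a : measurable_field Omega a ->
  (field_energy Omega p a < +oo)%E -> mu.-integrable Omega (EFin \o energy_density a).
Proof.
move=> ma E; apply/integrableP; split.
  by apply/measurable_EFinP; exact: (measurable_energy H ma).
apply: le_lt_trans E; rewrite le_eqVlt; apply/orP; left; apply/eqP.
apply: eq_integral => x /set_mem Ox.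
by rewrite /= ger0_norm// (energy_density_ge0 H a Ox).
Qed.

Lemma field_energy_Rintegral a : mu.-integrable Omega (EFin \o energy_density a) ->
  field_energy Omega p a = (\int[mu]_(x in Omega) energy_density a x)%R%:E.
Proof. by move=> ia; rewrite /Rintegral fineK//; exact: integrable_fin_num. Qed.

Lemma Rintegral_cvg0_le (f_ : nat -> 'rV[R]_n -> R) f (g : 'rV[R]_n -> \bar R) :
  (forall k, mu.-integrable Omega (EFin \o f_ k)) -> mu.-integrable Omega (EFin \o f) ->
  mu.-integrable Omega g ->
  {ae mu, forall x, Omega x -> forall k, (`|f_ k x - f x|%:E <= g x)%E} ->
  {ae mu, forall x, Omega x -> f_ ^~ x @ \oo --> f x} ->
  forall e : R, 0 < e -> exists k,
    `|(\int[mu]_(x in Omega) f_ k x)%R - (\int[mu]_(x in Omega) f x)%R| <= e.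
Proof.
move=> if_ iF ig fg fc e e0.
have iD k : mu.-integrable Omega (EFin \o (fun x => f_ k x - f x)) by exact: integrable_subr.
have mD k : measurable_fun Omega (fun x => `|f_ k x - f x|).
  by apply: measurableT_comp => //; apply/measurable_EFinP; exact: measurable_int (iD k).
have C := @dominated_integral0 _ _ R mu Omega mO (fun k x => `|f_ k x - f x|) g mD
  (fun _ _ _ => normr_ge0 _) ig fg.
have [|N _ /(_ N (leqnn N)) /ltW I] := cvge0_lt (C _) e0.
  move: fc; apply: filterS => x fx Ox; have := fx Ox => {}fx.
  rewrite -(normr0 R) -(subrr (f x)); apply: cvg_norm.
  by apply: cvgB; [exact: fx|exact: cvg_cst].
exists N; rewrite -RintegralB; [|exact: mO|exact: if_|exact: iF].
apply: (le_trans (le_normr_Rintegral mO (iD N))).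
rewrite -lee_fin /Rintegral fineK; first exact: I.
by apply: integrable_fin_num => //; exact: (integrable_norm (iD N)).
Qed.

(* Convexity at b - t z bounds t times the flux there by E(b) - E(b - t z) <= 0;
   then t -> 0. *)
Lemma first_variation b z (D : 'rV[R]_n -> R) : measurable_field Omega b ->
  measurable_field Omega z -> (field_energy Omega p b < +oo)%E ->
  mu.-integrable Omega (EFin \o D) ->
  (forall t x, `|t| <= 1 -> Omega x ->
    enorm (b x - t *: z x) `^ (p x - 1) * enorm (z x) <= D x) ->
  (forall t, (field_energy Omega p b <= field_energy Omega p (fun x => b x - t *: z x)%R)%E) ->
  mu.-integrable Omega (EFin \o flux_density b z) /\ (\int[mu]_(x in Omega) flux_density b z x)%R <= 0.
Proof.
move=> mb mz Eb iD bD minb.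
pose a (t : R) x := b x - t *: z x.
have ma t : measurable_field Omega (a t).
  exact: (measurable_fieldB mb (measurable_fieldZ t mz)).
have fD t x : `|t| <= 1 -> Omega x -> `|flux_density (a t) z x| <= D x.
  by move=> t1 Ox; apply: (le_trans (flux_le _ _ (p1 Ox))); exact: bD.
have if_ t : `|t| <= 1 -> mu.-integrable Omega (EFin \o flux_density (a t) z).
  by move=> t1; apply: (integrable_dominated (measurable_flux (ma t) mz) _ iD) => x; exact: fD.
have a0 : a 0 = b by apply/funext => x; rewrite /a scale0r subr0.
have n0 : `|0 : R| <= 1 by rewrite normr0.
have ifb := if_ 0 n0; rewrite a0 in ifb.
split; first exact: ifb.
have iB := integrable_energy_density mb Eb.
have neg (t : R) : 0 < t -> t <= 1 -> (\int[mu]_(x in Omega) flux_density (a t) z x)%R <= 0.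
  move=> t0 t1; have t1' : `|t| <= 1 by rewrite ger0_norm// ltW.
  have cvx x : Omega x -> energy_density (a t) x + t * flux_density (a t) z x <= energy_density b x.
    move=> Ox; have := powR_enorm_convex (a t x) (b x) (p1 Ox).
    have -> : b x - a t x = t *: z x by rewrite /a opprB addrC subrK.
    by rewrite dotvZr mulrCA.
  have mA : measurable_fun Omega (energy_density (a t)) by exact: (measurable_energy H (ma t)).
  (* The same convexity inequality bounds the energy density at [b - t z] by that at [b] plus [D],
     since [t <= 1]. *)
  have iA : mu.-integrable Omega (EFin \o energy_density (a t)).
    apply: (integrable_dominated mA _ (integrable_addr mO iB iD)) => x Ox.
    rewrite ger0_norm ?(energy_density_ge0 H (a t) Ox)//.
    have h1 := cvx x Ox; have h2 := fD t x t1' Ox.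
    apply: (@le_trans _ _ (energy_density b x - t * flux_density (a t) z x)); first by rewrite lerBrDr.
    rewrite lerD2l -mulrN; apply: le_trans h2.
    apply: (@le_trans _ _ (t * `|flux_density (a t) z x|)); last by rewrite ler_piMl.
    by apply: ler_wpM2l; [exact: ltW|rewrite -normrN; exact: ler_norm].
  have := minb t; rewrite (field_energy_Rintegral iB) (field_energy_Rintegral iA) lee_fin => h1.
  have itJ := integrable_scalel mO t (if_ t t1').
  have h2 : (\int[mu]_(x in Omega) energy_density (a t) x)%R +
      t * (\int[mu]_(x in Omega) flux_density (a t) z x)%R <=
      (\int[mu]_(x in Omega) energy_density b x)%R.
    rewrite -RintegralZl; [|exact: mO|exact: (if_ t t1')].
    rewrite -RintegralD; [|exact: mO|exact: iA|exact: itJ].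
    apply: le_Rintegral; [exact: mO|exact: (integrable_addr mO iA itJ)|exact: iB|exact: cvx].
  rewrite -(pmulr_rle0 _ t0); move: h1 h2; set X := Rintegral _ _ _; set Y := Rintegral _ _ _.
  by move=> h1 h2; have := le_trans h2 h1; rewrite gerDl.
pose t_ (k : nat) : R := 2^-1 ^+ k.
have t0 k : 0 < t_ k by rewrite exprn_gt0// invr_gt0.
have t1 k : t_ k <= 1 by rewrite exprn_ile1// ?invr_ge0// invf_le1// ler1n.
have t1' k : `|t_ k| <= 1 by rewrite ger0_norm// ltW.
apply/ler_addgt0Pr => e e0; rewrite add0r.
have ig : mu.-integrable Omega (fun x => (D x + D x)%:E) by exact: integrable_addr.
have [|| k hk] := @Rintegral_cvg0_le (fun k => flux_density (a (t_ k)) z) (flux_density b z) _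
    (fun k => if_ _ (t1' k)) ifb ig _ _ e e0.
- apply: aeW => x Ox k; rewrite lee_fin; apply: (le_trans (ler_normB _ _)); apply: lerD.
    exact: fD.
  by rewrite -a0; exact: fD.
- apply: aeW => x Ox.
  have C := @cvg_flux R n (p x) (fun k => a (t_ k) x) (b x) (z x) (p1 Ox).
  apply: C => i.
  have T : t_ @ \oo --> (0 : R) by exact: cvg_half_pow.
  have L : (fun k => b x ord0 i - t_ k * z x ord0 i) @ \oo -->
      b x ord0 i - 0 * z x ord0 i.
    by apply: cvgB; [exact: cvg_cst|apply: cvgM; [exact: T|exact: cvg_cst]].
  rewrite mul0r subr0 in L.
  rewrite (_ : (fun k => a (t_ k) x ord0 i) = (fun k => b x ord0 i - t_ k * z x ord0 i))//.
  by apply/funext => k; rewrite /a !mxE.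
have := neg _ (t0 k) (t1 k); move: hk; rewrite distrC.
move: (Rintegral _ _ _) (Rintegral _ _ _) => X Y h1 h2.
by have := le_trans (ler_norm _) h1; rewrite lerBlDr => /le_trans; apply; rewrite gerDl.
Qed.

(** The one-sided inequality is used for [z] and for [-z]; the domination and minimality assumptions
    are symmetric under [t -> -t]. *)
Lemma first_variation0 b z (D : 'rV[R]_n -> R) : measurable_field Omega b ->
  measurable_field Omega z -> (field_energy Omega p b < +oo)%E ->
  mu.-integrable Omega (EFin \o D) ->
  (forall t x, `|t| <= 1 -> Omega x ->
    enorm (b x - t *: z x) `^ (p x - 1) * enorm (z x) <= D x) ->
  (forall t, (field_energy Omega p b <= field_energy Omega p (fun x => b x - t *: z x)%R)%E) ->
  mu.-integrable Omega (EFin \o flux_density b z) /\ (\int[mu]_(x in Omega) flux_density b z x)%R = 0.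
Proof.
move=> mb mz Eb iD bD minb.
have [i1 l1] := first_variation mb mz Eb iD bD minb.
have E (t : R) x : b x - t *: (-1 *: z x) = b x - (- t) *: z x.
  by rewrite scalerA mulrN1.
have [||_ l2] := first_variation mb (measurable_fieldZ (-1) mz) Eb iD.
- move=> t x t1 Ox; rewrite E scaleN1r enormN; apply: bD => //.
  by rewrite normrN.
- move=> t; have := minb (- t).
  by rewrite (_ : (fun x => b x - t *: (-1 *: z x)) = (fun x => b x - - t *: z x))//;
    apply/funext => x.
split=> //; apply/eqP; rewrite eq_le l1/=.
have EN : (\int[mu]_(x in Omega) flux_density b (fun x => -1 *: z x) x)%R =
   - (\int[mu]_(x in Omega) flux_density b z x)%R.
  rewrite -[RHS]mulN1r -RintegralZl; [|exact: mO|exact: i1].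
  apply: eq_Rintegral => x _.
  by rewrite /flux_density dotvZr mulrCA.
by move: l2; rewrite EN oppr_le0.
Qed.

End weak_equation.

(** * Weak solutions and minimizers *)

Section weak_solutions.
Variables (R : realType) (n : nat) (Omega : set 'rV[R]_n.+1) (p : 'rV[R]_n.+1 -> R).
Variables (S : set ('rV[R]_n.+1 -> R)) (phi : 'rV[R]_n.+1 -> R).
Local Notation mu := (lebesgue_rV R n.+1).
Local Notation q := (exp_inf Omega p).
Local Notation W := (WOmega Omega p).
Local Notation cl := (modular_closure Omega p S).
Local Notation wgrad := (wgrad Omega).
Local Notation F := (dirichlet_integral Omega p phi).
Local Notation flux := (flux_density p).
Hypothesis H : admissible_exponent Omega p.
Hypothesis SW : S `<=` W.
Hypothesis Ssub : vector_subspace S.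
Hypothesis phiW : W phi.
Implicit Types (f g u v w psi : 'rV[R]_n.+1 -> R) (a b z : 'rV[R]_n.+1 -> 'rV[R]_n.+1).

Let oO : open Omega. Proof. by case: H. Qed.
Let mp : measurable_fun Omega p. Proof. by case: H. Qed.
Let q1 : 1 < q. Proof. by case: H. Qed.
Let qp x : Omega x -> q <= p x. Proof. by case: H => _ _ _ _; exact. Qed.
Let mO : measurable Omega. Proof. exact: open_rV_measurable. Qed.
Let p1 x : Omega x -> 1 < p x. Proof. by move=> /qp; exact: lt_le_trans. Qed.
Let p0 x : Omega x -> 0 < p x. Proof. by move=> /p1; exact: lt_trans. Qed.
Let clW u : cl u -> W u. Proof. exact: closure_WOmega. Qed.
Let mG u : W u -> measurable_field Omega (wgrad u).
Proof. by move=> Wu; exact: (WOmega_grad_measurable H Wu). Qed.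

Lemma integrable_ae f g : measurable_fun Omega g ->
  {ae mu, forall x, Omega x -> f x = g x} -> mu.-integrable Omega (EFin \o f) ->
  mu.-integrable Omega (EFin \o g).
Proof.
move=> mg fg iF; have [/measurable_EFinP mf If] := integrableP _ _ _ iF.
apply/integrableP; split; first exact/measurable_EFinP.
rewrite (_ : (\int[mu]_(x in Omega) `|(EFin \o g) x|)%E =
   (\int[mu]_(x in Omega) `|(EFin \o f) x|)%E) //.
apply: (ge0_integral_ae_eq mO (f := fun x => `|g x|) (g := fun x => `|f x|)).
- exact: measurableT_comp.
- exact: measurableT_comp.
- by move: fg; apply: filterS => x E Ox; rewrite (E Ox).
Qed.

Lemma Lvar_sum_norm (I : Type) (s : seq I) (f : I -> 'rV[R]_n.+1 -> R) :
  (forall i, Lvar Omega p (f i)) -> Lvar Omega p (fun x => \sum_(i <- s) `|f i x|).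
Proof.
move=> Lf; elim: s => [|i s IH].
  under eq_fun do rewrite big_nil.
  split; first exact: measurable_cst.
  exists 1; first exact: ltr01.
  rewrite (eq_integral (fun=> 0%E)) ?integral0// => x /set_mem Ox.
  by rewrite mulr0 normr0 powR0// gt_eqF// p0.
under eq_fun do rewrite big_cons.
have Ln : Lvar Omega p (fun x => `|f i x|).
  have [mf [l l0 J]] := Lf i; split; first exact: measurableT_comp.
  exists l; first exact: l0.
  by under eq_integral do rewrite normrM normr_id -normrM.
have := Lvar_lin mO 1 mp (fun x Ox => ltW (p1 Ox)) Ln IH.
by under eq_fun do rewrite mul1r.
Qed.

Hypothesis p_cont : {within Omega, continuous p}.

Lemma exponent_bounded_compact (K : set 'rV[R]_n.+1) : compact K -> K `<=` Omega ->
  exists2 P : R, 0 <= P & forall x, K x -> p x <= P.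
Proof.
move=> cK KO; have pK : {within K, continuous p} by exact: continuous_subspaceW p_cont.
have /compact_bounded[M [_ HM]] := continuous_compact pK cK.
exists (`|M| + 1); first by rewrite addr_ge0.
move=> x Kx; apply: le_trans (ler_norm _) _.
by apply: (HM (`|M| + 1)); [by rewrite (le_lt_trans (ler_norm M))// ltrDl|exists x].
Qed.

(* On the compact support of psi the exponent is bounded, so the modular is
   doubling there. *)
Lemma compact_flux_dominated b psi : measurable_field Omega b ->
  (field_energy Omega p b < +oo)%E -> W psi -> compactly_supported Omega psi ->
  exists z (D : 'rV[R]_n.+1 -> R), [/\ measurable_field Omega z,
    {ae mu, forall x, Omega x -> z x = wgrad psi x},
    mu.-integrable Omega (EFin \o D) &
    forall t x, `|t| <= 1 -> Omega x ->
      enorm (b x - t *: z x) `^ (p x - 1) * enorm (z x) <= D x].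
Proof.
move=> mb Eb Wpsi [K [cK KO psiK]].
have mK := compact_rV_measurable cK.
have [P P0 pP] := exponent_bounded_compact cK KO.
(* Almost everywhere equal to the gradient of [psi], but exactly 0 outside [K], so that the
   domination holds at every point of [Omega]. *)
pose z (x : 'rV[R]_n.+1) := (\1_K x : R) *: wgrad psi x.
pose s (x : 'rV[R]_n.+1) := \sum_i `|wgrad psi x ord0 i|.
have [ms [l l0 Is]] : Lvar Omega p s.
  by apply: Lvar_sum_norm => i; case: Wpsi => _ _; exact.
(* Being at least 1, [C] satisfies [C^(p x) <= C^P] on [K], which removes the scale [l] of the
   modular there. *)
pose C : R := Num.max 1 l^-1.
pose D (x : 'rV[R]_n.+1) := 2 `^ P * (P * energy_density p b x + C `^ P * `|l * s x| `^ p x).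
have D0 x : Omega x -> 0 <= D x.
  move=> Ox; apply: mulr_ge0; first exact: powR_ge0.
  apply: addr_ge0; last by apply: mulr_ge0; exact: powR_ge0.
  by apply: mulr_ge0; [exact: P0|exact: (energy_density_ge0 H b Ox)].
exists z, D; split.
- move=> i; rewrite (_ : (fun x => _) = (fun x => \1_K x * wgrad psi x ord0 i)); last first.
    by apply/funext => x; rewrite mxE.
  apply: measurable_funM; last exact: (mG Wpsi i).
  exact: measurable_indic.
- have L := weak_grad_local oO (wgradP (WOmega_wd Wpsi)) cK KO psiK.
  move: L; apply: filterS => x Lx Ox; rewrite /z indicE.
  have [Kx|Kx] := pselect (K x); first by rewrite mem_set// scale1r.
  by rewrite memNset// scale0r (Lx Ox Kx).
- have ls : mu.-integrable Omega (EFin \o (fun x => `|l * s x| `^ p x)).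
    apply/integrableP; split.
      apply/measurable_EFinP; apply: measurable_powR_normr => //.
      exact: measurable_funM.
    apply: le_lt_trans Is; rewrite le_eqVlt; apply/orP; left; apply/eqP.
    by apply: eq_integral => x _; rewrite /= ger0_norm ?powR_ge0.
  have ib := integrable_energy_density H mb Eb.
  apply: (integrable_scalel mO); apply: (integrable_addr mO).
    exact: (integrable_scalel mO P ib).
  exact: (integrable_scalel mO (C `^ P) ls).
move=> t x t1 Ox.
have [Kx|Kx] := pselect (K x); last first.
  have -> : z x = 0 by rewrite /z indicE memNset// scale0r.
  by rewrite enorm0 mulr0 D0.
have zx : z x = wgrad psi x by rewrite /z indicE mem_set// scale1r.
have px1 := p1 Ox; have px0 := p0 Ox; have pxP := pP x Kx.
have bz0 : 0 <= enorm (b x) + enorm (z x) by rewrite addr_ge0 ?enorm_ge0.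
apply: (@le_trans _ _ ((enorm (b x) + enorm (z x)) `^ p x)).
  rewrite -(mulr_powRB1 bz0 px0) mulrC; apply: ler_pM; rewrite ?enorm_ge0 ?powR_ge0//.
    by rewrite lerDr enorm_ge0.
  apply: ge0_ler_powR; rewrite ?nnegrE ?enorm_ge0 ?subr_ge0 ?(ltW px1)//.
  apply: (le_trans (enormD _ _)); rewrite lerD2l enormN enormZ.
  by rewrite ler_piMl ?enorm_ge0.
apply: (le_trans (powR_add_le (enorm_ge0 _) (enorm_ge0 _) (ltW px0))).
apply: ler_pM; rewrite ?addr_ge0 ?powR_ge0//.
  by apply: ler_powR; rewrite ?ler1n.
apply: lerD.
  have -> : enorm (b x) `^ p x = p x * energy_density p b x.
    by rewrite /energy_density mulrCA mulfV ?mulr1// gt_eqF.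
  by apply: ler_wpM2r => //; exact: (energy_density_ge0 H b Ox).
apply: (@le_trans _ _ (s x `^ p x)).
  have s0 : 0 <= s x by apply: sumr_ge0.
  apply: ge0_ler_powR; rewrite ?nnegrE ?enorm_ge0 ?(ltW px0)//.
  by rewrite zx; exact: enorm_le_sum.
have s0 : 0 <= s x by apply: sumr_ge0.
have li : 0 <= l^-1 by rewrite invr_ge0 ltW.
have sE : s x = l^-1 * `|l * s x|.
  by rewrite ger0_norm ?mulr_ge0 ?(ltW l0)// mulKf// gt_eqF.
rewrite [leLHS](_ : _ = (l^-1 * `|l * s x|) `^ p x); last by rewrite -sE.
rewrite powRM//; apply: ler_wpM2r; first exact: powR_ge0.
have C1 : 1 <= C by rewrite le_max lexx.
apply: (@le_trans _ _ (C `^ p x)); last exact: ler_powR.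
by apply: ge0_ler_powR; rewrite ?nnegrE ?li ?(le_trans ler01 C1) ?(ltW px0)// le_max lexx orbT.
Qed.

Lemma dirichlet_opp u : W u -> F u = field_energy Omega p (wgrad (phi \- u)).
Proof.
move=> Wu; rewrite (dirichletE H phiW Wu) -(field_energyN Omega p).
apply: (field_energy_ae H).
- have := measurable_fieldZ (-1) (measurable_fieldB (mG Wu) (mG phiW)).
  by congr measurable_field; apply/funext => x; rewrite scaleN1r.
- exact: (mG (WOmegaB H phiW Wu)).
- by move: (wgradB H phiW Wu); apply: filterS => x E Ox; rewrite (E Ox) opprB.
Qed.

Lemma minimizer_weak_equation v psi : is_minimizer F cl v -> (F v < +oo)%E -> S psi ->
  compactly_supported Omega psi ->
  mu.-integrable Omega (EFin \o flux (wgrad (phi \- v)) (wgrad psi)) /\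
  (\int[mu]_(x in Omega) flux (wgrad (phi \- v)) (wgrad psi) x)%R = 0.
Proof.
move=> [cv Fv] Fvoo Spsi cs; have Wv := clW cv; have Wpsi := SW Spsi.
have Ww := WOmegaB H phiW Wv; have mb := mG Ww.
have Eb : (field_energy Omega p (wgrad (phi \- v)%R) < +oo)%E.
  by rewrite -(dirichlet_opp Wv); exact: Fvoo.
have [z [D [mz zE iD bD]]] := compact_flux_dominated mb Eb Wpsi cs.
have minb t : (field_energy Omega p (wgrad (phi \- v)%R) <=
    field_energy Omega p (fun x => (wgrad (phi \- v) x - t *: z x)%R))%E.
  have ct : cl (fun x => t * psi x + v x).
    exact: (modular_closureD H SW Ssub
      (modular_closureZ H SW Ssub t (sub_modular_closure SW Spsi)) cv).
  have := Fv _ ct; rewrite (dirichlet_opp Wv) (dirichlet_opp (clW ct)).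
  have -> // : field_energy Omega p (wgrad (phi \- (fun x => t * psi x + v x))) =
    field_energy Omega p (fun x => wgrad (phi \- v) x - t *: z x).
  apply: (field_energy_ae H).
  - exact: (mG (WOmegaB H phiW (clW ct))).
  - exact: (measurable_fieldB mb (measurable_fieldZ t mz)).
  have E1 := wgrad_lin oO (- t) (WOmega_wd Wpsi) (WOmega_wd Ww).
  move: E1 zE; apply: filterS2 => x E1 E2 Ox.
  rewrite (_ : phi \- _ = (fun x => - t * psi x + (phi \- v) x)); last first.
    by apply/funext => y /=; ring.
  by rewrite (E1 Ox) (E2 Ox) scaleNr addrC.
have [i0 I0] := first_variation0 H mb mz Eb iD bD minb.
have fE : {ae mu, forall x, Omega x -> flux (wgrad (phi \- v)) z x =
    flux (wgrad (phi \- v)) (wgrad psi) x}.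
  by move: zE; apply: filterS => x E Ox; rewrite /flux_density (E Ox).
have m1 := measurable_flux H mb (mG Wpsi); have m0 := measurable_flux H mb mz.
split; first exact: (integrable_ae m1 fE i0).
by rewrite -I0; apply/esym; exact: (Rintegral_ae_eq mO m0 m1 fE).
Qed.

Lemma fast_closed_weak_equation b : measurable_field Omega b ->
  (\int[mu]_(x in Omega) (enorm (b x) `^ p x)%:E < +oo)%E ->
  fast_closed Omega p [set psi | W psi /\
    mu.-integrable Omega (EFin \o flux b (wgrad psi)) /\
    (\int[mu]_(x in Omega) flux b (wgrad psi) x)%R = 0].
Proof.
move=> mb Ib v_ v Wv_ Pv_ Wv rv; split; first exact: Wv.
pose B x := enorm (b x) `^ p x.
have mB : measurable_fun Omega B by apply: measurable_powR2 => //; exact: measurable_enorm.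
have iB : mu.-integrable Omega (EFin \o B).
  apply/integrableP; split; first exact/measurable_EFinP.
  apply: le_lt_trans Ib; rewrite le_eqVlt; apply/orP; left; apply/eqP.
  by apply: eq_integral => x _; rewrite /= ger0_norm ?powR_ge0.
pose c k x := wgrad (v_ k) x - wgrad v x.
have mc k : measurable_field Omega (c k) by exact: (measurable_fieldB (mG (Wv_ k)) (mG Wv)).
have Ec k : (field_energy Omega p (c k) <= (2^-1 ^+ k)%:E)%E.
  rewrite -(grad_energyB H (Wv_ k) Wv); apply: le_trans (rv k).
  by rewrite /rho leeDr//; apply: integral_ge0 => x _; rewrite lee_fin powR_ge0.
(* The energies of the differences are summable, so a single integrable [g] majorizes all their
   densities, and these tend to 0 almost everywhere. *)
have [g [ig fg _ f0]] := @fast_dominated _ _ R mu Omega mO (fun k => energy_density p (c k))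
  (fun k => measurable_energy H (mc k)) (fun k x Ox => energy_density_ge0 H (c k) Ox) Ec.
have iv_ k : mu.-integrable Omega (EFin \o flux b (wgrad (v_ k))) by have [_ []] := Pv_ k.
have Iv_ k : (\int[mu]_(x in Omega) flux b (wgrad (v_ k)) x)%R = 0 by have [_ []] := Pv_ k.
have fluxB k x : flux b (wgrad (v_ k)) x - flux b (wgrad v) x = flux b (c k) x.
  by rewrite /flux_density /c dotvBr mulrBr.
have fle k x : Omega x -> `|flux b (c k) x| <= B x + energy_density p (c k) x.
  by move=> Ox; exact: (le_trans (flux_le _ _ (p1 Ox)) (flux_young _ _ (p1 Ox))).
have ic k : mu.-integrable Omega (EFin \o flux b (c k)).
  have ied := integrable_energy_density H (mc k) (le_lt_trans (Ec k) (ltry _)).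
  by apply: (integrable_dominated H (measurable_flux H mb (mc k)) _ (integrable_addr mO iB ied)) => x; exact: fle.
have iv : mu.-integrable Omega (EFin \o flux b (wgrad v)).
  have := integrable_subr mO (iv_ 0) (ic 0).
  by congr (mu.-integrable _ _); apply/funext => x /=; rewrite -fluxB opprB addrC subrK.
split; first exact: iv.
have iBg : mu.-integrable Omega (fun x => ((B x)%:E + g x)%E) by exact: integrableD.
have dom : {ae mu, forall x, Omega x -> forall k,
    (`|flux b (wgrad (v_ k)) x - flux b (wgrad v) x|%:E <= (B x)%:E + g x)%E}.
  apply: aeW => x Ox k; rewrite fluxB.
  apply: (@le_trans _ _ ((B x + energy_density p (c k) x)%:E)); first by rewrite lee_fin; exact: fle.
  by rewrite EFinD; apply: leeD2l; exact: fg.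
have cvg : {ae mu, forall x, Omega x ->
    (fun k => flux b (wgrad (v_ k)) x) @ \oo --> flux b (wgrad v) x}.
  move: f0; apply: filterS => x fx Ox; have {}fx := fx Ox.
  have cx : (fun k => enorm (c k x)) @ \oo --> 0.
    have := @cvg_powR0 R (fun k => enorm (c k x)) (p x) 1 (p0 Ox) ltr01 (fun k => enorm_ge0 _) fx.
    by under eq_cvg do rewrite powRr1 ?enorm_ge0//.
  apply/subr_cvg0.
  apply: norm_cvg0.
  apply: (@squeeze_cvgr _ _ _ _ (fun=> 0) (fun k => enorm (b x) `^ (p x - 1) * enorm (c k x))).
  - by apply: nearW => k; rewrite normr_ge0 /= fluxB; exact: (flux_le _ _ (p1 Ox)).
  - exact: cvg_cst.
  - rewrite -[X in _ --> X](mulr0 (enorm (b x) `^ (p x - 1))).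
    by apply: cvgM; [exact: cvg_cst|exact: cx].
apply/eqP; rewrite -normr_le0; apply/ler_addgt0Pr => e e0; rewrite add0r.
have [k] := Rintegral_cvg0_le H iv_ iv iBg dom cvg e0.
by rewrite Iv_ sub0r normrN.
Qed.

(** The equation extends from [S] to [u - v] in the closure. The gradient of [u - v] is the
    difference of the fields [c] of [phi - v] and [b] of [phi - u], so the linear term in the
    convexity inequality at [b] integrates to 0. *)
Lemma weak_solution_minimizer u : cl u ->
  (\int[mu]_(x in Omega) (enorm (wgrad (phi \- u)%R x) `^ p x)%:E < +oo)%E ->
  (forall psi, S psi ->
    mu.-integrable Omega (EFin \o flux (wgrad (phi \- u)) (wgrad psi)) /\
    (\int[mu]_(x in Omega) flux (wgrad (phi \- u)) (wgrad psi) x)%R = 0) ->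
  is_minimizer F cl u.
Proof.
move=> cu Iu weak; split; first exact: cu.
move=> v cv; have Wu := clW cu; have Wv := clW cv.
have Ww := WOmegaB H phiW Wu; have mb := mG Ww; set b := wgrad (phi \- u) in Iu weak mb *.
have Wc := WOmegaB H phiW Wv; have mc := mG Wc; set c := wgrad (phi \- v) in mc *.
have cuv := modular_closureB H SW Ssub cu cv; have Wuv := clW cuv.
have [_ [id Id]] : [set psi | W psi /\
    mu.-integrable Omega (EFin \o flux b (wgrad psi)) /\
    (\int[mu]_(x in Omega) flux b (wgrad psi) x)%R = 0] (u \- v).
  apply: (modular_closure_sub _ (fast_closed_weak_equation mb Iu) cuv).
  by move=> psi Spsi; split; [exact: SW|exact: weak].
rewrite (dirichlet_opp Wu) (dirichlet_opp Wv) -/b -/c.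
have [Eoo|Efin] := eqVneq (field_energy Omega p c) +oo%E.
  by rewrite Eoo leey.
have Ec : (field_energy Omega p c < +oo)%E by rewrite lt_neqAle Efin leey.
have Eb : (field_energy Omega p b < +oo)%E.
  apply: le_lt_trans Iu; apply: (integral_le mu mO).
  - exact: (measurable_energy H mb).
  - by apply: measurable_powR2 => //; exact: measurable_enorm.
  - by move=> x Ox; exact: (energy_density_ge0 H b Ox).
  - move=> x Ox; have px := p1 Ox; rewrite ler_pdivrMr ?(lt_trans ltr01)//.
    by rewrite ler_peMr ?powR_ge0// ltW.
have ib := integrable_energy_density H mb Eb; have ic := integrable_energy_density H mc Ec.
rewrite (field_energy_Rintegral H ib) (field_energy_Rintegral H ic) lee_fin.
have mcb := measurable_fieldB mc mb.
have fE : {ae mu, forall x, Omega x -> flux b (wgrad (u \- v)) x = flux b (fun x => c x - b x) x}.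
  have E1 := wgradB H Wc Ww.
  rewrite (_ : (phi \- v) \- (phi \- u) = u \- v) in E1; last first.
    by apply/funext => x /=; ring.
  by move: E1; apply: filterS => x E Ox; rewrite /flux_density (E Ox).
have md := measurable_flux H mb (mG Wuv); have md' := measurable_flux H mb mcb.
have id' := integrable_ae md' fE id.
have Id' : (\int[mu]_(x in Omega) flux b (fun x => c x - b x) x)%R = 0.
  by rewrite -Id; apply/esym; exact: (Rintegral_ae_eq mO md md' fE).
rewrite -[leLHS]addr0 -Id' -RintegralD; [|exact: mO|exact: ib|exact: id'].
apply: le_Rintegral; [exact: mO|exact: (integrable_addr mO ib id')|exact: ic|].
by move=> x Ox; exact: (powR_enorm_convex (b x) (c x) (p1 Ox)).
Qed.

End weak_solutions.

(** * Traces *)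

Section zero_trace.
Variables (R : realType) (n : nat) (Omega : set 'rV[R]_n.+1).
Local Notation mu := (lebesgue_rV R n.+1).
Hypothesis oO : open Omega.
Hypothesis Ofin : (mu Omega < +oo)%E.
Implicit Types (f g v : 'rV[R]_n.+1 -> R).

Let mO : measurable Omega := open_rV_measurable oO.

(** On the graph the two sides of the chart inequality are equal, while membership in [Omega] is
    strict. *)
Lemma graph_point_notin x0 (r : R) i b gamma y : C1_chart Omega x0 r i b gamma ->
  ball x0 r (graph_point i gamma y) -> ~ Omega (graph_point i gamma y).
Proof.
move=> [_ _ _ H] /H ->.
have -> : col' i (graph_point i gamma y) = y.
  by apply/rowP => j; rewrite !mxE liftK.
by rewrite mxE unlift_none /= ltxx.
Qed.

Lemma C1c_W1 (q : R) f : 1 < q -> C1c Omega f -> W1 Omega q f.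
Proof.
move=> q1 fc; have q0 : 0 < q by lra.
have [C C0 [fC pC]] := C1c_bounds fc.
have bnd g : measurable_fun Omega g -> (forall x, `|g x| <= C) -> Lvar Omega (fun=> q) g.
  move=> mg gC; apply: (Lvar_cstP mO g (ltW q0)).2; split; first exact: mg.
  apply: (@le_lt_trans _ _ (\int[mu]_(x in Omega) (C `^ q)%:E)%E).
    apply: (integral_le mu mO).
    - exact: measurable_powR_normr.
    - exact: measurable_cst.
    - by move=> x _; exact: powR_ge0.
    - by move=> x _; apply: ge0_ler_powR; rewrite ?nnegrE ?(ltW q0).
  by rewrite integral_cst// lte_mul_pinfty ?lee_fin ?powR_ge0.
have fW := C1c_weak_grad fc.
split.
- by apply: bnd => //; apply: measurable_funTS; exact: C1_measurable fc.1.
- by exists (classical_grad f).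
move=> i.
have mp : measurable_fun Omega (partial i f).
  by apply: measurable_funTS; exact: C1_partial_measurable fc.1.
apply: (Lvar_ae mO _ _ _ (bnd _ mp (pC i))); first exact: measurable_cst.
  by apply: (wgrad_coord_measurable oO); exists (classical_grad f).
by move: (wgradE oO fW); apply: filterS => x E Ox; rewrite (E Ox) mxE.
Qed.

Lemma enorm_powR_le (q : R) m (a : 'rV[R]_m) : 1 <= q ->
  enorm a `^ q <= m%:R `^ q * \sum_i `|a ord0 i| `^ q.
Proof.
move=> q1; have q0 : 0 < q by lra.
set T := \sum_i _; have T0 : 0 <= T by apply: sumr_ge0 => i _; exact: powR_ge0.
have aT i : `|a ord0 i| <= T `^ q^-1.
  have -> : `|a ord0 i| = (`|a ord0 i| `^ q) `^ q^-1.
    by rewrite -powRrM mulfV ?gt_eqF// powRr1.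
  apply: ge0_ler_powR; rewrite ?nnegrE ?powR_ge0 ?invr_ge0 ?(ltW q0)//.
  by rewrite /T (bigD1 i)//= lerDl sumr_ge0// => j _; exact: powR_ge0.
have -> : m%:R `^ q * T = (m%:R * T `^ q^-1) `^ q.
  by rewrite powRM ?powR_ge0// -powRrM mulVf ?gt_eqF// powRr1.
apply: ge0_ler_powR; rewrite ?nnegrE ?enorm_ge0 ?mulr_ge0 ?powR_ge0 ?(ltW q0)//.
apply: (le_trans (enorm_le_sum a)).
apply: (@le_trans _ _ (\sum_(i < m) T `^ q^-1)); first exact: ler_sum.
by rewrite sumr_const card_ord mulr_natl.
Qed.

Lemma cvge_half_pow (u_ : nat -> \bar R) : (forall k, (0 <= u_ k)%E) ->
  (forall k, (u_ k <= (2^-1 ^+ k)%:E)%E) -> u_ @ \oo --> 0%E.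
Proof.
move=> u0 u2; apply: (cvge0P u0) => e e0.
move/cvgrPdist_lt : (@cvg_half_pow R) => /(_ e e0); apply: filterS => k.
rewrite sub0r normrN ger0_norm ?exprn_ge0 ?invr_ge0// => ke.
by apply: (le_lt_trans (u2 k)); rewrite lte_fin.
Qed.

(** Test functions vanish outside [Omega], hence at graph points, so every chart integral is exactly
    0. Only the convergence inside [Omega] has to be checked, at the rate [2^-k]. *)
Lemma W0_zero_trace (q : R) v : 1 < q -> weakly_differentiable Omega v ->
  W0_approximable Omega q v -> has_trace Omega q v (fun=> 0).
Proof.
move=> q1 dv av; have q0 : 0 < q by lra.
have vG := wgradP dv.
(* Passing from the coordinates of the gradient to its Euclidean norm costs the factor of
   [enorm_powR_le] and a sum over [n + 1] coordinates. *)
pose N : R := n.+1%:R `^ q * n.+1%:R.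
have N0 : 0 <= N by rewrite mulr_ge0 ?powR_ge0.
have N1 : 0 < N + 1 by rewrite ltr_wpDl.
have e0 (k : nat) : 0 < 2^-1 ^+ k / (N + 1) :> R.
  by rewrite divr_gt0// exprn_gt0// invr_gt0.
have /choice[f_ Hf] := fun k => av _ (e0 k).
have eN (k : nat) : N * (2^-1 ^+ k / (N + 1)) <= 2^-1 ^+ k :> R.
  by rewrite mulrCA ler_piMr ?exprn_ge0 ?invr_ge0// ler_pdivrMr// mul1r lerDl.
have e1 (k : nat) : 2^-1 ^+ k / (N + 1) <= 2^-1 ^+ k :> R.
  by rewrite ler_pdivrMr// ler_peMr ?exprn_ge0 ?invr_ge0// lerDr.
have fc k : C1c Omega (f_ k) by case: (Hf k).
split; first exact: measurable_cst.
exists f_; split.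
- move=> k; split; first exact: C1c_W1.
  apply: continuous_subspaceT => x; apply: differentiable_continuous.
  exact: (fc k).1.1.
- apply: cvge_half_pow => k; first by apply: integral_ge0 => x _; rewrite lee_fin powR_ge0.
  by have [_ h _] := Hf k; apply: (le_trans h); rewrite lee_fin.
- apply: cvge_half_pow => k; first by apply: integral_ge0 => x _; rewrite lee_fin powR_ge0.
  have [_ _ h] := Hf k.
  have fW := C1c_weak_grad (fc k).
  have dW := is_weak_grad_lin oO (-1) vG fW.
  have mfp i : measurable_fun Omega (fun x => partial i (f_ k) x - wgrad Omega v x ord0 i).
    apply: measurable_funB; last exact: (wgrad_coord_measurable oO i dv).
    by apply: measurable_funTS; exact: C1_partial_measurable (fc k).1.
  have dfv : weakly_differentiable Omega (f_ k \- v).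
    exists (fun x => -1 *: wgrad Omega v x + classical_grad (f_ k) x).
    by move: dW; congr is_weak_grad; apply/funext => x /=; rewrite mulN1r addrC.
  have mW : measurable_fun Omega (fun x => enorm (wgrad Omega (f_ k \- v) x) `^ q).
    apply: measurable_powR2 => //; apply: measurable_enorm => // i.
    exact: (wgrad_coord_measurable oO i dfv).
  have mS i : measurable_fun Omega (fun x => `|partial i (f_ k) x - wgrad Omega v x ord0 i| `^ q).
    exact: measurable_powR_normr.
  pose s (x : 'rV[R]_n.+1) := \sum_i `|partial i (f_ k) x - wgrad Omega v x ord0 i| `^ q.
  have ms : measurable_fun Omega s by exact: measurable_sum.
  have s0 x : 0 <= s x by apply: sumr_ge0 => i _; exact: powR_ge0.
  pose d (x : 'rV[R]_n.+1) : 'rV[R]_n.+1 := classical_grad (f_ k) x - wgrad Omega v x.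
  have md : measurable_fun Omega (fun x => enorm (d x) `^ q).
    apply: measurable_powR2 => //; apply: measurable_enorm => // i.
    by rewrite /d; under eq_fun do rewrite !mxE; exact: mfp.
  have -> : (\int[mu]_(x in Omega) (enorm (wgrad Omega (f_ k \- v)%R x) `^ q)%:E =
      \int[mu]_(x in Omega) (enorm (d x) `^ q)%:E)%E.
    apply: (ge0_integral_ae_eq mO mW md).
    have E := wgradE oO dW.
    rewrite (_ : (fun x => -1 * v x + f_ k x) = f_ k \- v) in E; last first.
      by apply/funext => x /=; rewrite mulN1r addrC.
    by move: E; apply: filterS => x E Ox; rewrite (E Ox) scaleN1r addrC.
  apply: (@le_trans _ _ ((n.+1%:R `^ q)%:E * \int[mu]_(x in Omega) (s x)%:E)%E).
    apply: (integral_leZ mu mO (powR_ge0 _ _) md ms).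
    - by move=> x _; exact: powR_ge0.
    - by move=> x _; exact: s0.
    move=> x _; apply: (le_trans (enorm_powR_le (d x) (ltW q1))).
    apply: ler_wpM2l; first exact: powR_ge0.
    by apply: ler_sum => i _; rewrite !mxE.
  have -> : (\int[mu]_(x in Omega) (s x)%:E = \sum_(i < n.+1)
      \int[mu]_(x in Omega) (`|partial i (f_ k) x - wgrad Omega v x ord0 i| `^ q)%:E)%E.
    rewrite -(ge0_integral_sum mu mO (fun i : 'I_n.+1 => proj2 (measurable_EFinP _ _) (mS i))); last first.
      by move=> i x _; rewrite lee_fin powR_ge0.
    by apply: eq_integral => x _; rewrite sumEFin.
  apply: (@le_trans _ _ ((n.+1%:R `^ q)%:E * \sum_(i < n.+1) (2^-1 ^+ k / (N + 1))%:E)%E).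
    apply: lee_wpmul2l; first by rewrite lee_fin powR_ge0.
    by apply: lee_sum => i _; exact: h.
  rewrite sumEFin (_ : \sum_(i < n.+1) _ = n.+1%:R * (2^-1 ^+ k / (N + 1))); last first.
    by rewrite sumr_const card_ord mulr_natl.
  by rewrite -EFinM lee_fin; apply: le_trans (eN k); rewrite /N -[leRHS]mulrA.
move=> x0 r i b gamma ch.
rewrite (_ : (fun k => _) = (fun=> 0%E)); first exact: cvg_cst.
apply/funext => k; rewrite /chart_integral (eq_integral (fun=> 0%E)) ?integral0//.
move=> y /set_mem /= By; have nO := graph_point_notin ch By.
have [_ [K [_ KO f0]]] := fc k.
rewrite (f0 (graph_point i gamma y)); last by move/KO.
by rewrite subrr normr0 powR0 ?gt_eqF// mul0r.
Qed.

End zero_trace.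

Theorem corollary7p2 (R : realType) (n : nat) (Omega : set 'rV[R]_n.+1)
  (p : 'rV[R]_n.+1 -> R) (S : set ('rV[R]_n.+1 -> R))
  (phi : 'rV[R]_n.+1 -> R)
  (hOmega : bounded_C1_domain Omega)
  (p_gt1 : forall x, Omega x -> 1 < p x)
  (p_cont : {within Omega, continuous p})
  (pm_gt1 : 1 < exp_inf Omega p)
  (S_W : S `<=` WOmega Omega p)
  (S_sub : vector_subspace S)
  (S_cs : forall u, S u -> compactly_supported Omega u)
  (phi_W : WOmega Omega p phi)
  (phi_fin : (grad_energy Omega p phi < +oo)%E) :
  exists w : 'rV[R]_n.+1 -> R,
  [/\ S_weak_solution Omega p S phi w,
      has_trace Omega (exp_inf Omega p) (w \- phi) (fun=> 0),
      is_minimizer (dirichlet_integral Omega p phi)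
        (modular_closure Omega p S) (phi \- w),
      forall u, is_minimizer (dirichlet_integral Omega p phi)
        (modular_closure Omega p S) u -> ae_eq_on Omega (phi \- u) w &
      forall w', S_weak_solution Omega p S phi w' ->
        (\int[lebesgue_rV R n.+1]_(x in Omega)
          (enorm (wgrad Omega w' x) `^ p x)%:E < +oo)%E ->
        ae_eq_on Omega w' w].
Proof.
have [oO _ _ [M0 [M0r HM]] _] := hOmega.
pose M := Num.max 1 (M0 + 1).
have M1 : 0 < M by rewrite lt_max ltr01.
have OM x : Omega x -> `|x| < M.
  (* [bounded_set] bounds [|x|] by every number above [M0], not by [M0] itself; [1/2] leaves room
     for a strict inequality with [M0 + 1]. *)
  move=> Ox; have MM : M0 < M0 + 1/2 by lra.
  apply: (le_lt_trans (HM _ MM x Ox)); rewrite lt_max; apply/orP; right; lra.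
have Obnd : exists2 M : R, 0 < M & forall x, Omega x -> `|x| < M by exists M.
have mO := open_rV_measurable oO.
have Ofin : (lebesgue_rV R n.+1 Omega < +oo)%E.
  have mB := measurable_rV_ball (0 : 'rV[R]_n.+1) M1.
  apply: (@le_lt_trans _ _ (lebesgue_rV R n.+1 (ball (0 : 'rV[R]_n.+1) M))).
    by apply: le_measure; rewrite ?inE// => x /OM; rewrite -ball_normE /ball_ /= sub0r normrN.
  by rewrite lebesgue_rV_ball// ltry.
have H : admissible_exponent Omega p.
  split => //; first exact: open_continuous_measurable.
  move=> x Ox; apply: ge_inf; last by exists x.
  by exists 1 => _ [y Oy <-]; exact: ltW (p_gt1 y Oy).
have [v [vmin vfin]] := minimizer_exists H Obnd S_W S_sub S_cs phi_W phi_fin.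
have cv := vmin.1; have Wv := closure_WOmega cv.
have phiK u : phi \- (phi \- u) = u by apply/funext => x /=; ring.
exists (phi \- v); split.
- split; first exact: (WOmegaB H phi_W Wv).
    by exists v.
  move=> psi Spsi.
  have [i0 I0] := minimizer_weak_equation H S_W S_sub phi_W p_cont vmin vfin Spsi (S_cs _ Spsi).
  split; first exact: i0.
  rewrite -[LHS]fineK; first by congr EFin; exact: I0.
  by apply: (integrable_fin_num mO); exact: i0.
- have -> : (phi \- v) \- phi = (fun x => -1 * v x).
    by apply/funext => x /=; ring.
  have cNv := modular_closureZ H S_W S_sub (-1) cv.
  apply: (W0_zero_trace oO Ofin pm_gt1 (WOmega_wd (closure_WOmega cNv))).
  exact: (modular_closure_W0 H S_W S_cs cNv).
- by rewrite phiK.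
- move=> u umin; have E := minimizer_unique H Obnd S_W S_sub S_cs phi_W phi_fin umin vmin.
  by move: E; apply: filterS => x E Ox /=; rewrite (E Ox).
move=> w' [Ww' [u cu w'E] weak] fin'.
rewrite w'E in weak fin' *.
have umin : is_minimizer (dirichlet_integral Omega p phi) (modular_closure Omega p S) u.
  apply: (weak_solution_minimizer H S_W S_sub phi_W cu fin') => psi Spsi.
  have [i0 I0] := weak psi Spsi; split; first exact: i0.
  by rewrite /Rintegral; move: I0; rewrite /weak_integrand /flux_density => ->.
have E := minimizer_unique H Obnd S_W S_sub S_cs phi_W phi_fin umin vmin.
by move: E; apply: filterS => x E Ox /=; rewrite (E Ox).
Qed.
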